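(* Let $F=(e^{a_1},e^{a_2})\in\mathrm{TAut}(L_2)$, with $a_1,a_2\in L_2$, i.e. $F$ is the automorphism of the completed free Lie algebra $L_2$ on $x_1,x_2$ with $F(x_i)=e^{-a_i}x_ie^{a_i}$ for $i=1,2$, and let $\theta=F^{-1}\circ\theta^{\exp}$ be the corresponding expansion. If $j(F^{-1})\in|A|$ belongs to the center of the Lie algebra $(|A|,\{-,-\}_\theta)$, then for all $a\in A$ $$\delta^+_\theta(|a|)=-\,\mathrm{tDiv}(\{|a|,-\}_\theta).$$
   Context: **Algebra.** $\mathbb{K}$ is a field of characteristic $0$, $n=2$, and $A$ is the degree completion of the free associative $\mathbb{K}$-algebra on $x_1,\dots,x_n$, a complete Hopf algebra with $x_i$ primitive; $\otimes$ is the completed tensor product. $L=L_n\subset A$ is the Lie algebra of primitive elements (the completed free Lie algebra). $|A|=A/[A,A]$ ($[A,A]$ the closure of the span of commutators), with projection $a\mapsto|a|$; ${\bf 1}=|1|$; $|\ |$ also denotes $|\ |^{\otimes2}:A\otimes A\to|A|\otimes|A|$; $u\wedge v=u\otimes v-v\otimes u$. **Tangential derivations and automorphisms.** $\mathrm{tDer}(A)=A^{\oplus n}$, $u=(u_1,\dots,u_n)$ acting by the derivation $\rho(u)(x_i)=[x_i,u_i]$, bracket $[u,v]_i=\rho(u)(v_i)-\rho(v)(u_i)+[u_i,v_i]$; $\mathrm{tDer}(L)=L^{\oplus n}$ is a Lie subalgebra. $\mathrm{TAut}(L)$ is the group integrating $\mathrm{tDer}(L)$: as a set $\exp(L)^{\times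 n}$, $F=(F_1,\dots,F_n)$ acting on $A$ by $F(x_i)=F_i^{-1}x_iF_i$, product $(FG)_i=F_i\cdot F(G_i)$. **Divergences.** Each $a\in A$ is uniquely $a=a^0+\sum_ia^ix_i$ with $a^0\in\mathbb{K}$, $a^i\in A$; $\mathrm{div}:\mathrm{tDer}(L)\to|A|$, $\mathrm{div}(u)=\sum_i|x_i(u_i)^i|$; $j:\mathrm{TAut}(L)\to|A|$ is the group 1-cocycle with $j(FG)=j(F)+F\cdot j(G)$ and $\frac{d}{dt}j(\exp(tu))|_{t=0}=\mathrm{div}(u)$. Let $\partial_i:A\to A\otimes A$ be the continuous linear map with $\partial_i(ab)=\partial_i(a)(1\otimes b)+(a\otimes1)\partial_i(b)$ and $\partial_i(x_j)=\delta_{ij}\,1\otimes1$. For a derivation $v$ of $A$, $\mathrm{Div}(v)=\sum_i|\partial_i(v(x_i))|\in|A|\otimes|A|$, and for $u\in\mathrm{tDer}(A)$, $\mathrm{tDiv}(u)=\mathrm{Div}(\rho(u))+\sum_i(|u_i|\otimes{\bf 1}-{\bf 1}\otimes|u_i|)$. **Surface operations.** $\Sigma$ is a compact oriented surface of genus $0$ with $n+1=3$ boundary components $\partial_0\Sigma,\dots,\partial_n\Sigma$, embedded orientation-preservingly in $\mathbb{R}^2$ with $\partial_0\Sigma$ outermost; $*\in\partial_0\Sigma$; $\pi=\pi_1(\Sigma,* )$ (in $\alpha\beta$ the path $\alpha$ is traversed first) is free on $\gamma_1,\dots,\gamma_n$, where $\gamma_i$ is freely homotopic to the positively oriented $\partial_i\Sigma$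 and $\gamma_1\cdots\gamma_n$ is the negatively oriented $\partial_0\Sigma$. $|\mathbb{K}\pi|=\mathbb{K}\pi/[\mathbb{K}\pi,\mathbb{K}\pi]$ is the span of free homotopy classes of loops. $\varepsilon(\vec a,\vec b)=\pm1$ according to whether $(\vec a,\vec b)$ is a positively or negatively oriented frame. - $\kappa$: let $\nu:[0,1]\to\partial\Sigma$ be an orientation-preserving embedding with $\nu(1)=*$, $\bullet=\nu(0)$; identify $\pi\cong\pi_1(\Sigma,\bullet)$ by $\alpha\mapsto\nu\alpha\overline\nu$. For immersed loops $\alpha$ at $\bullet$ and $\beta$ at $*$ in general position, $\kappa(\alpha,\beta)=-\sum_{p\in\alpha\cap\beta}\varepsilon(\dot\alpha_p,\dot\beta_p)\,\beta_{*p}\alpha_{p\bullet}\nu\otimes\overline\nu\alpha_{\bullet p}\beta_{p*}$; this gives $\kappa:\mathbb{K}\pi\otimes\mathbb{K}\pi\to\mathbb{K}\pi\otimes\mathbb{K}\pi$. It is the unique linear map with $\kappa(a,bc)=\kappa(a,b)(1\otimes c)+(b\otimes1)\kappa(a,c)$, $\kappa(ab,c)=\kappa(a,c)(b\otimes1)+(1\otimes a)\kappa(b,c)$, $\kappa(\gamma_i,\gamma_i)=1\otimes\gamma_i^2-\gamma_i\otimes\gamma_i$, $\kappa(\gamma_i,\gamma_j)=0$ for $i<j$, $\kappa(\gamma_i,\gamma_j)=1\otimes\gamma_i\gamma_j+\gamma_j\gamma_i\otimes1-\gamma_i\otimes\gamma_j-\gamma_j\otimes\gamma_i$ for $i>j$.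 - $\delta^+:|\mathbb{K}\pi|\to|\mathbb{K}\pi|\otimes|\mathbb{K}\pi|$: for a free homotopy class choose an immersed representative $\alpha:S^1\to\Sigma$ with only transverse double points and rotation number $0$ with respect to the standard framing of $\mathbb{R}^2$; $\delta^+(\alpha)=\sum_{t_1\ne t_2,\,\alpha(t_1)=\alpha(t_2)}\varepsilon(\dot\alpha(t_1),\dot\alpha(t_2))|\alpha_{t_1t_2}|\otimes|\alpha_{t_2t_1}|$ (ordered pairs; $\alpha_{st}$ is the restriction of $\alpha$ to the arc from $s$ to $t$). Equivalently $\delta^+(|\gamma|)=-\mathrm{Alt}(1\otimes|\ |)\mu(\gamma)+|\gamma|\wedge{\bf 1}$ for $\gamma\in\pi$, where $\mathrm{Alt}(u\otimes v)=u\wedge v$ and $\mu:\mathbb{K}\pi\to|\mathbb{K}\pi|\otimes\mathbb{K}\pi$ is the unique linear map with $\mu(xy)=\mu(x)(1\otimes y)+(1\otimes x)\mu(y)+(|\ |\otimes1)\kappa(x,y)$ and $\mu(\gamma_i)=0$. **Transfer.** $\theta^{\exp}:\mathbb{K}\pi\to A$ is the algebra homomorphism with $\theta^{\exp}(\gamma_i)=e^{x_i}$. For $\theta=F^{-1}\circ\theta^{\exp}$, $\kappa_\theta:A\otimes A\to A\otimes A$ and $\delta^+_\theta:|A|\to|A|\otimes|A|$ are the unique continuous linear maps with $\kappa_\theta\circ(\theta\otimes\theta)=(\theta\otimes\theta)\circ\kappa$ and $\delta^+_\theta\circ\theta=(\theta\otimes\theta)\circ\delta^+$. Writing $\kappa_\theta(a,b)=\kappa_\theta(a,b)'\otimes\kappa_\theta(a,b)''$,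 the Lie bracket on $|A|$ is $\{|a|,|b|\}_\theta=|\kappa_\theta(a,b)'\kappa_\theta(a,b)''|$. For each $a\in A$ there are unique $\sum c_i'\otimes c_i''\in A\otimes A$ ($i=1,\dots,n$) with $\kappa_\theta(a,x_i)=\sum(c_i''\otimes c_i'x_i-x_ic_i''\otimes c_i')$, and $\{|a|,-\}_\theta\in\mathrm{tDer}(A)$ denotes the element $-(\sum c_1''c_1',\dots,\sum c_n''c_n')$, which depends only on $|a|$. *)

(* Defs.v *)
From HB Require Import structures.
From mathcomp Require Import all_boot all_order all_algebra.
From mathcomp Require Import finmap.
From mathcomp Require Import boolp classical_sets.
From mathcomp.multinomials Require Import monalg.

Set Implicit Arguments.
Unset Strict Implicit.
Unset Printing Implicit Defensive.

Import GRing.Theory.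
Local Open Scope ring_scope.
Local Open Scope quotient_scope.

HB.mixin Record isFiltered (K : pzRingType) V of GRing.Lmodule K V := {
  fil : nat -> V -> Prop;
  fil0 : forall N, fil N 0;
  filP : forall N (c : K) u v, fil N u -> fil N v -> fil N (c *: u + v)
}.

#[short(type="filtModType")]
HB.structure Definition FiltModule (K : pzRingType) :=
  {V of GRing.Lmodule K V & isFiltered K V}.

Section Filtered.
Variable (K : pzRingType).

Lemma filD (V : filtModType K) N (u v : V) : fil N u -> fil N v -> fil N (u + v).
Proof. by move=> hu hv; rewrite -[u]scale1r; apply: filP. Qed.

Lemma filZ (V : filtModType K) N c (u : V) : fil N u -> fil N (c *: u).
Proof. by move=> hu; rewrite -[_ *: _]addr0; apply: filP => //; apply: fil0. Qed.

(* For a linear map this is continuity for the filtration topologies. *)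
Definition filt_continuous (U V : filtModType K) (f : U -> V) :=
  forall N, exists M, forall u, fil M u -> fil N (f u).

Definition closed_span (V : filtModType K) (X : V -> Prop) (v : V) : Prop :=
  forall N, exists s : seq (K * V),
    (forall p, p \in s -> X p.2) /\ fil N (v - \sum_(p <- s) p.1 *: p.2).

Lemma closed_span0 (V : filtModType K) (X : V -> Prop) : closed_span X 0.
Proof.
move=> N; exists [::]; split=> //.
by rewrite big_nil subr0; apply: fil0.
Qed.

Lemma closed_spanP (V : filtModType K) (X : V -> Prop) c u v :
  closed_span X u -> closed_span X v -> closed_span X (c *: u + v).
Proof.
move=> hu hv N; have [s [hs fs]] := hu N; have [t [ht ft]] := hv N.
exists ([seq (c * p.1, p.2) | p <- s] ++ t); split.
  move=> p; rewrite mem_cat => /orP[/mapP[q qs ->]|/ht//] /=; exact: hs.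
rewrite big_cat big_map /= opprD addrACA; apply: filD => //.
rewrite (eq_bigr (fun p => c *: (p.1 *: p.2))); last by move=> p _; rewrite scalerA.
by rewrite -scaler_sumr -scalerBr; apply: filZ.
Qed.

Definition in_closed_span (V : filtModType K) (X : V -> Prop) : {pred V} :=
  fun v => `[< closed_span X v >].

Lemma closed_span_zmod (V : filtModType K) (X : V -> Prop) :
  zmod_closed (in_closed_span X).
Proof.
split=> [|u v /asboolP hu /asboolP hv]; apply/asboolP; first exact: closed_span0.
by rewrite addrC -scaleN1r; apply: closed_spanP.
Qed.

HB.instance Definition _ (V : filtModType K) (X : V -> Prop) :=
  GRing.isZmodClosed.Build V (in_closed_span X) (closed_span_zmod X).

(* The quotient of V by the closure of the span of X, with the filtration     *)
(* induced from V.                                                            *)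
Definition cquot (V : filtModType K) (X : V -> Prop) : Type :=
  {ideal_quot (in_closed_span X)}.

Section ClosedQuotient.
Variables (V : filtModType K) (X : V -> Prop).

HB.instance Definition _ := EqQuotient.on (cquot X).
HB.instance Definition _ := GRing.Zmodule.on (cquot X).

Definition cproj (v : V) : cquot X := \pi_(cquot X) v.

Lemma cprojP u v : cproj u = cproj v <-> closed_span X (u - v).
Proof.
have E := Quotient.idealrBE (in_closed_span X) u v.
split=> [/eqP h|h]; first by apply/asboolP; move: h; rewrite -[_ == _]E.
by apply/eqP; rewrite -[_ == _]E; apply/asboolP.
Qed.

Lemma cprojK z : cproj (repr z) = z.
Proof. exact: reprK. Qed.

Lemma cprojD : {morph cproj : u v / u + v}.
Proof. exact: (Quotient.pi_add (in_closed_span X)). Qed.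

Definition cquot_scale (c : K) (z : cquot X) : cquot X := cproj (c *: repr z).

Lemma cquot_scaleE c v : cquot_scale c (cproj v) = cproj (c *: v).
Proof.
apply/cprojP; rewrite -scalerBr -[c *: _]addr0; apply: closed_spanP.
  by apply/cprojP; rewrite cprojK.
exact: closed_span0.
Qed.

Fact cquot_scaleA a b z : cquot_scale a (cquot_scale b z) = cquot_scale (a * b) z.
Proof. by rewrite -[z]cprojK !cquot_scaleE scalerA. Qed.

Fact cquot_scale1 : left_id 1 cquot_scale.
Proof. by move=> z; rewrite -[z]cprojK cquot_scaleE scale1r. Qed.

Fact cquot_scaleDr : right_distributive cquot_scale +%R.
Proof.
move=> c y z; rewrite -[y]cprojK -[z]cprojK -cprojD !cquot_scaleE.
by rewrite scalerDr cprojD.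
Qed.

Fact cquot_scaleDl z : {morph cquot_scale^~ z : a b / a + b}.
Proof. by move=> a b; rewrite -[z]cprojK !cquot_scaleE scalerDl cprojD. Qed.

HB.instance Definition _ := GRing.Zmodule_isLmodule.Build K (cquot X)
  cquot_scaleA cquot_scale1 cquot_scaleDr cquot_scaleDl.

Lemma cproj_is_linear : linear cproj.
Proof. by move=> c u v; rewrite cprojD -cquot_scaleE. Qed.

HB.instance Definition _ := GRing.isLinear.Build K V (cquot X) _ cproj
  cproj_is_linear.

Definition cquot_fil N (z : cquot X) := exists2 v, fil N v & cproj v = z.

Fact cquot_fil0 N : cquot_fil N 0.
Proof. by exists 0; [exact: fil0 | exact: linear0]. Qed.

Fact cquot_filP N (c : K) y z :
  cquot_fil N y -> cquot_fil N z -> cquot_fil N (c *: y + z).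
Proof.
by move=> [u hu <-] [v hv <-]; exists (c *: u + v); [exact: filP | rewrite linearP].
Qed.

HB.instance Definition _ := isFiltered.Build K (cquot X) cquot_fil0 cquot_filP.

End ClosedQuotient.

(* "df/dt at t = 0 is v" over an arbitrary field: f is the sum of a power     *)
(* series in t whose coefficients tend to 0, and v is its coefficient at t.   *)
Definition formal_deriv0 (V : filtModType K) (f : K -> V) (v : V) :=
  exists2 c : nat -> V, c 1%N = v &
    forall N, exists M, forall m t, (M <= m)%N ->
      fil N (f t - \sum_(k < m) t ^+ k *: c k).

End Filtered.

(* a w is the coefficient of the word w. *)
Definition ncseries (R : Type) : Type := seq 'I_2 -> R.

HB.instance Definition _ (R : choiceType) := Choice.on (ncseries R).

Section SeriesModule.

Section Zmod.
Variable V : zmodType.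
Implicit Types a b c : ncseries V.

Let zero : ncseries V := fun=> 0.
Let opp a : ncseries V := fun w => - a w.
Let add a b : ncseries V := fun w => a w + b w.

Fact ncs_addA : associative add.
Proof. by move=> a b c; apply: funext => w; rewrite /add addrA. Qed.
Fact ncs_addC : commutative add.
Proof. by move=> a b; apply: funext => w; rewrite /add addrC. Qed.
Fact ncs_add0 : left_id zero add.
Proof. by move=> a; apply: funext => w; rewrite /add add0r. Qed.
Fact ncs_addN : left_inverse zero opp add.
Proof. by move=> a; apply: funext => w; rewrite /add /opp addNr. Qed.

HB.instance Definition _ := GRing.isZmodule.Build (ncseries V)
  ncs_addA ncs_addC ncs_add0 ncs_addN.

Lemma ncs0E w : (0 : ncseries V) w = 0. Proof. by []. Qed.
Lemma ncsDE a b w : (a + b) w = a w + b w. Proof. by []. Qed.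
Lemma ncsNE a w : (- a) w = - a w. Proof. by []. Qed.
Lemma ncs_sumE I (r : seq I) (P : pred I) (F : I -> ncseries V) w :
  (\sum_(i <- r | P i) F i) w = \sum_(i <- r | P i) F i w.
Proof. by elim/big_rec2: _ => // i y x _ <-. Qed.
End Zmod.

Section Lmod.
Variables (K : pzRingType) (V : lmodType K).
Implicit Types a b : ncseries V.

Let scale (c : K) a : ncseries V := fun w => c *: a w.

Fact ncs_scaleA c d a : scale c (scale d a) = scale (c * d) a.
Proof. by apply: funext => w; rewrite /scale scalerA. Qed.
Fact ncs_scale1 : left_id 1 scale.
Proof. by move=> a; apply: funext => w; rewrite /scale scale1r. Qed.
Fact ncs_scaleDr : right_distributive scale +%R.
Proof. by move=> c a b; apply: funext => w; rewrite /scale scalerDr. Qed.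
Fact ncs_scaleDl a : {morph scale^~ a : c d / c + d}.
Proof. by move=> c d; apply: funext => w; rewrite /scale scalerDl. Qed.

HB.instance Definition _ := GRing.Zmodule_isLmodule.Build K (ncseries V)
  ncs_scaleA ncs_scale1 ncs_scaleDr ncs_scaleDl.

Lemma ncsZE c a w : (c *: a) w = c *: a w. Proof. by []. Qed.
End Lmod.

Section Filt.
Variables (K : pzRingType) (V : filtModType K).

Definition ncs_fil N (a : ncseries V) := forall w, fil (N - size w) (a w).

Fact ncs_fil0 N : ncs_fil N 0.
Proof. by move=> w; apply: fil0. Qed.
Fact ncs_filP N (c : K) a b : ncs_fil N a -> ncs_fil N b -> ncs_fil N (c *: a + b).
Proof. by move=> ha hb w; apply: filP. Qed.

HB.instance Definition _ := isFiltered.Build K (ncseries V) ncs_fil0 ncs_filP.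
End Filt.

End SeriesModule.

Section SeriesRing.
Variable R : nzRingType.
Implicit Types a b c : ncseries R.

Definition ncs_one : ncseries R := fun w => (w == [::])%:R.
Definition ncs_mul a b : ncseries R :=
  fun w => \sum_(k < (size w).+1) a (take k w) * b (drop k w).

Definition ncs_shift (i : 'I_2) a : ncseries R := fun w => a (i :: w).

Lemma ncs_mul_nil a b : ncs_mul a b [::] = a [::] * b [::].
Proof. by rewrite /ncs_mul big_ord1. Qed.

Lemma ncs_mul_cons a b i w :
  ncs_mul a b (i :: w) = a [::] * b (i :: w) + ncs_mul (ncs_shift i a) b w.
Proof. by rewrite /ncs_mul big_ord_recl. Qed.

Fact ncs_mulDl : left_distributive ncs_mul +%R.
Proof.
move=> a b c; apply: funext => w; rewrite ncsDE /ncs_mul -big_split /=.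
by apply: eq_bigr => k _; rewrite mulrDl.
Qed.

Fact ncs_mulDr : right_distributive ncs_mul +%R.
Proof.
move=> a b c; apply: funext => w; rewrite ncsDE /ncs_mul -big_split /=.
by apply: eq_bigr => k _; rewrite mulrDr.
Qed.

Lemma ncs_mulZ r a b w : ncs_mul (fun v => r * a v) b w = r * ncs_mul a b w.
Proof. by rewrite /ncs_mul big_distrr; apply: eq_bigr => k _; rewrite /= mulrA. Qed.

Fact ncs_mulA : associative ncs_mul.
Proof.
move=> a b c; apply: funext => w; elim: w a => [|i w IH] a.
  by rewrite !ncs_mul_nil mulrA.
rewrite !ncs_mul_cons ncs_mul_nil IH mulrDr -mulrA -addrA; congr (_ + _).
have -> : ncs_shift i (ncs_mul a b) =
    ((fun v => a [::] * ncs_shift i b v) : ncseries R) + ncs_mul (ncs_shift i a) b.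
  by apply: funext => v; rewrite /ncs_shift ncs_mul_cons.
by rewrite ncs_mulDl ncsDE ncs_mulZ.
Qed.

Fact ncs_mul1l : left_id ncs_one ncs_mul.
Proof.
move=> a; apply: funext => w; rewrite /ncs_mul big_ord_recl take0 drop0 mul1r.
rewrite big1 ?addr0 // => k _; rewrite /ncs_one /=.
by case: w k => [[]|i w k] //=; rewrite mul0r.
Qed.

Fact ncs_mul1r : right_id ncs_one ncs_mul.
Proof.
move=> a; apply: funext => w; rewrite /ncs_mul big_ord_recr /= take_size drop_size.
rewrite mulr1 big1 ?add0r // => k _; rewrite /ncs_one.
by rewrite -size_eq0 size_drop subn_eq0 leqNgt ltn_ord mulr0.
Qed.

Fact ncs_one_neq0 : ncs_one != 0.
Proof.
by apply/eqP => /(congr1 (fun a : ncseries R => a [::]))/eqP; rewrite oner_eq0.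
Qed.

HB.instance Definition _ := GRing.Zmodule_isNzRing.Build (ncseries R)
  ncs_mulA ncs_mul1l ncs_mul1r ncs_mulDl ncs_mulDr ncs_one_neq0.

Lemma ncs1E w : (1 : ncseries R) w = (w == [::])%:R. Proof. by []. Qed.
Lemma ncsME a b w :
  (a * b) w = \sum_(k < (size w).+1) a (take k w) * b (drop k w).
Proof. by []. Qed.
End SeriesRing.

Section SeriesAlgebra.
Variables (K : comNzRingType) (R : algType K).

Fact ncs_scaleAl (c : K) (a b : ncseries R) : c *: (a * b) = c *: a * b.
Proof.
apply: funext => w; rewrite ncsZE !ncsME scaler_sumr.
by apply: eq_bigr => k _; rewrite scalerAl.
Qed.
HB.instance Definition _ := GRing.Lmodule_isLalgebra.Build K (ncseries R) ncs_scaleAl.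

Fact ncs_scaleAr (c : K) (a b : ncseries R) : c *: (a * b) = a * (c *: b).
Proof.
apply: funext => w; rewrite ncsZE !ncsME scaler_sumr.
by apply: eq_bigr => k _; rewrite scalerAr.
Qed.
HB.instance Definition _ := GRing.Lalgebra_isAlgebra.Build K (ncseries R) ncs_scaleAr.
End SeriesAlgebra.

Section Scalars.
Variable K : pzRingType.

Definition scalar_fil N (c : K^o) : Prop := (0 < N)%N -> c = 0.

Fact scalar_fil0 N : scalar_fil N 0. Proof. by []. Qed.
Fact scalar_filP N (c : K) (a b : K^o) :
  scalar_fil N a -> scalar_fil N b -> scalar_fil N (c *: a + b).
Proof. by move=> ha hb hN; rewrite ha // hb // scaler0 addr0. Qed.

HB.instance Definition _ := isFiltered.Build K K^o scalar_fil0 scalar_filP.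
End Scalars.

(* In the completed tensor square, t u v is the coefficient of u (x) v; the   *)
(* ring structure of ncseries (ncseries _) is the componentwise product       *)
(* (a (x) b) (c (x) d) = ac (x) bd.                                           *)
Notation "''A[' K ]" := (ncseries K^o) (at level 0, K at level 2, format "''A[' K ]").
Notation "''A2[' K ]" := (ncseries (ncseries K^o))
  (at level 0, K at level 2, format "''A2[' K ]").

Section FreeAlgebra.
Variable K : fieldType.
Notation A := 'A[K].
Notation A2 := 'A2[K].

Definition gen (i : 'I_2) : A := fun w => (w == [:: i])%:R.

Definition tens (a b : A) : A2 := fun u v => a u * b v.
Definition tswap (t : A2) : A2 := fun u v => t v u.
Definition tmult (t : A2) : A :=
  fun w => \sum_(k < (size w).+1) t (take k w) (drop k w).

(* Sums of series c 0 + c 1 + ... in which c k has no term of degree < k. *)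
Definition ssum (c : nat -> A) : A := fun w => \sum_(k < (size w).+1) c k w.
Definition ssum2 (c : nat -> A2) : A2 :=
  fun u v => \sum_(k < (size u + size v).+1) c k u v.

(* exp a for a without constant term, a^-1 for a with constant term 1. *)
Definition sexp (a : A) : A := ssum (fun k => (k`!%:R)^-1 *: a ^+ k).
Definition sinv (a : A) : A := ssum (fun k => (1 - a) ^+ k).

(* The image of the degree k part of a under x_i |-> y i. *)
Definition hom_subst (R : algType K) (y : 'I_2 -> R) (a : A) (k : nat) : R :=
  \sum_(w : k.-tuple 'I_2) a w *: \prod_(i <- w) y i.

Definition coprod (a : A) : A2 :=
  ssum2 (hom_subst (fun i => tens (gen i) 1 + tens 1 (gen i)) a).

Definition primitive (a : A) : Prop := coprod a = tens a 1 + tens 1 a.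

Definition comm_set (c : A) : Prop := exists a b : A, c = a * b - b * a.
Definition comm_set2 (t : A2) : Prop :=
  exists a b c : A, t = tens (a * b - b * a) c \/ t = tens c (a * b - b * a).

(* cyc is |A|; cyc2 is the completed tensor product of |A| with itself, as the *)
(* quotient of A (x) A by the closure of [A,A] (x) A + A (x) [A,A].           *)
Definition cyc : Type := cquot comm_set.
Definition cyc2 : Type := cquot comm_set2.
HB.instance Definition _ := FiltModule.on cyc.
HB.instance Definition _ := FiltModule.on cyc2.

Definition cp (a : A) : cyc := cproj comm_set a.
Definition cp2 (t : A2) : cyc2 := cproj comm_set2 t.

(* Deleting each occurrence of x_i in turn: u x_i v |-> u (x) v. *)
Definition pder (i : 'I_2) (a : A) : A2 := fun u v => a (u ++ i :: v).

Lemma tens1_nil a : tens a 1 [::] = a [::] *: 1.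
Proof. by []. Qed.

Lemma tens_shift i a b : ncs_shift i (tens a b) = tens (ncs_shift i a) b.
Proof. by []. Qed.

Lemma tens1l b u : tens 1 b u = if u is [::] then b else 0.
Proof.
apply: funext => v; rewrite /tens ncs1E.
by case: u => [|i u] /=; rewrite ?mul1r ?mul0r.
Qed.

Lemma ncs_nilE (R : nzRingType) (a b : ncseries R) : (a * b) [::] = a [::] * b [::].
Proof. exact: ncs_mul_nil. Qed.

Lemma ncs_consE (R : nzRingType) (a b : ncseries R) i w :
  (a * b) (i :: w) = a [::] * b (i :: w) + (ncs_shift i a * b) w.
Proof. exact: ncs_mul_cons. Qed.

Lemma tens1_mul a t u : (tens a 1 * t) u = \sum_(k < (size u).+1) a (take k u) *: t (drop k u).
Proof.
rewrite ncsME; apply: eq_bigr => k _.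
by rewrite -[tens a 1 _]/(a (take k u) *: (1 : A)) -scalerAl mul1r.
Qed.

Lemma mul_1tens t b u : (t * tens 1 b) u = t u * b.
Proof.
rewrite ncsME big_ord_recr /= take_size drop_size tens1l big1 ?add0r // => k _.
rewrite tens1l; case E: (drop k u) => [|i v]; last by rewrite mulr0.
by have := size_drop k u; rewrite E /= => /esym/eqP; rewrite subn_eq0 leqNgt ltn_ord.
Qed.

Lemma pder_gen i j : pder i (gen j) = (i == j)%:R.
Proof.
apply: funext => u; apply: funext => v; rewrite /pder /gen.
have -> : (u ++ i :: v == [:: j]) = [&& i == j, u == [::] & v == [::]].
  case: u => [|k u] /=; first by rewrite eqseq_cons.
  by rewrite eqseq_cons andbF; case: u => [|? ?]; rewrite andbF.
case: (i == j) => //=; rewrite [RHS]/= -[(1%:R : A2)]/(1 : A2) !ncs1E.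
by case: (u == [::]).
Qed.

Lemma pderM i a b : pder i (a * b) = pder i a * tens 1 b + tens a 1 * pder i b.
Proof.
apply: funext => u; rewrite ncsDE mul_1tens.
elim: u a => [|j u IH] a.
  rewrite ncs_nilE tens1_nil -scalerAl mul1r; apply: funext => v.
  by rewrite {1}/pder /= ncs_consE addrC.
rewrite ncs_consE tens1_nil -scalerAl mul1r tens_shift addrCA -IH.
by apply: funext => v; rewrite ncsDE {1}/pder /= ncs_consE.
Qed.

Lemma tmult_cons t i w : tmult t (i :: w) = t [::] (i :: w) + tmult (ncs_shift i t) w.
Proof. by rewrite /tmult big_ord_recl. Qed.

Lemma tmultD : {morph tmult : s t / s + t}.
Proof. by move=> s t; apply: funext => w; rewrite ncsDE /tmult -big_split. Qed.

Lemma tmult1 : tmult 1 = 1.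
Proof.
apply: funext => w; rewrite /tmult big_ord_recl take0 drop0 big1 ?addr0 //.
by move=> k _; rewrite ncs1E; case: w k => [[]|i w k].
Qed.

Lemma tmult_mulr t b : tmult (t * tens 1 b) = tmult t * b.
Proof.
have -> : t * tens 1 b = (fun u => t u * b) :> A2.
  by apply: funext => u; rewrite mul_1tens.
apply: funext => w; elim: w t => [|i w IH] t.
  by rewrite /tmult big_ord1 !ncs_nilE big_ord1.
rewrite tmult_cons (IH (ncs_shift i t)) !ncs_consE -addrA; congr (_ + _).
  by rewrite /tmult big_ord1.
rewrite -ncsDE -mulrDl; congr ((_ * b) w).
by apply: funext => v; rewrite ncsDE [RHS]tmult_cons.
Qed.

Lemma tmult_mull a t : tmult (tens a 1 * t) = a * tmult t.
Proof.
apply: funext => w; elim: w a t => [|i w IH] a t.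
  by rewrite /tmult big_ord1 !ncs_nilE big_ord1 tens1_nil -scalerAl mul1r.
rewrite tmult_cons ncs_nilE tens1_nil -scalerAl mul1r ncs_consE tmult_cons mulrDr -addrA.
congr (_ + _); rewrite -IH.
have -> : ncs_shift i (tens a 1 * t) =
    a [::] *: ncs_shift i t + tens (ncs_shift i a) 1 * t :> A2.
  by apply: funext => u; rewrite {1}/ncs_shift ncs_consE tens1_nil -scalerAl mul1r.
rewrite tmultD ncsDE; congr (_ + _).
by rewrite /tmult big_distrr.
Qed.

Lemma tens_comm a b : tens 1 b * tens a 1 = tens a 1 * tens 1 b :> A2.
Proof.
apply: funext => u; rewrite mul_1tens ncsME big_ord_recl /= take0 drop0 tens1l.
rewrite big1 ?addr0; last first.
  by move=> k _; rewrite tens1l; case: u k => [[]|i u k] //=; rewrite mul0r.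
by rewrite -[tens a 1 u]/(a u *: (1 : A)) -scalerAr -scalerAl mulr1 mul1r.
Qed.

(* The continuous derivation x_i |-> v i. *)
Definition deriv_of (v : 'I_2 -> A) (a : A) : A :=
  \sum_i tmult (pder i a * tens (v i) 1).

Lemma deriv_of_gen v i : deriv_of v (gen i) = v i.
Proof.
rewrite /deriv_of (bigD1 i) //= pder_gen eqxx mul1r big1 ?addr0.
  by rewrite -[tens _ _]mulr1 tmult_mull tmult1 mulr1.
move=> j jNi; rewrite pder_gen (negbTE jNi) mul0r.
by apply: funext => w; rewrite /tmult big1.
Qed.

Lemma deriv_ofM v a b : deriv_of v (a * b) = deriv_of v a * b + a * deriv_of v b.
Proof.
rewrite /deriv_of mulr_suml mulr_sumr -big_split /=; apply: eq_bigr => i _.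
by rewrite pderM mulrDl tmultD -!mulrA tens_comm tmult_mull mulrA tmult_mulr.
Qed.

Definition rho (u : 'I_2 -> A) : A -> A :=
  deriv_of (fun i => gen i * u i - u i * gen i).

(* a = a^0 + \sum_i a^i x_i with a^i = rquo i a. *)
Definition rquo (i : 'I_2) (a : A) : A := fun w => a (rcons w i).

Definition div (u : 'I_2 -> A) : cyc := \sum_i cp (gen i * rquo i (u i)).

Definition Div (v : A -> A) : cyc2 := \sum_i cp2 (pder i (v (gen i))).

Definition tDiv (u : 'I_2 -> A) : cyc2 :=
  Div (rho u) + \sum_i (cp2 (tens (u i) 1) - cp2 (tens 1 (u i))).

(* An element of TAut(L) is the pair (F_0, F_1); tact F is its action on A by *)
(* x_i |-> F_i^-1 x_i F_i, tmul and tinv the product and inverse of TAut(L).  *)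
Definition is_TAut (F : 'I_2 -> A) : Prop :=
  forall i, exists2 a, primitive a & F i = sexp a.

Definition tact (F : 'I_2 -> A) (a : A) : A :=
  ssum (hom_subst (fun i => sinv (F i) * gen i * F i) a).

Definition tact_cyc (F : 'I_2 -> A) (z : cyc) : cyc := cp (tact F (repr z)).

Definition tmul (F G : 'I_2 -> A) : 'I_2 -> A := fun i => F i * tact F (G i).

(* tact F is unipotent, with inverse \sum_k (id - tact F)^k. *)
Definition tact_inv (F : 'I_2 -> A) (a : A) : A :=
  ssum (fun k => iter k (fun b => b - tact F b) a).

Definition tinv (F : 'I_2 -> A) : 'I_2 -> A := fun i => tact_inv F (sinv (F i)).

(* exp u in TAut(L): F(t) = exp(tu) satisfies F(0) = 1 and, by                *)
(* differentiating F(s + t) = F(s) F(t) at s = 0,                             *)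
(* dF_i/dt = u_i F_i + rho(u)(F_i).                                           *)
Definition texp (u : 'I_2 -> A) : 'I_2 -> A := fun i =>
  ssum (fun k => (k`!%:R)^-1 *: iter k (fun b => u i * b + rho u b) 1).

Definition is_div_cocycle (j : ('I_2 -> A) -> cyc) : Prop :=
  (forall F G, is_TAut F -> is_TAut G ->
     j (tmul F G) = j F + tact_cyc F (j G)) /\
  (forall u, (forall i, primitive (u i)) ->
     formal_deriv0 (fun t : K => j (texp (fun i => t *: u i))) (div u)).

End FreeAlgebra.

(* (false, i) stands for gamma_i and (true, i) for its inverse. *)
Definition letter : Type := (bool * 'I_2)%type.
HB.instance Definition _ := Finite.on letter.
Definition linv (l : letter) : letter := (~~ l.1, l.2).

Definition reduced (w : seq letter) : bool := sorted (fun l m => m != linv l) w.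

Definition push (l : letter) (w : seq letter) : seq letter :=
  if w is m :: w' then if m == linv l then w' else l :: w else [:: l].

Lemma linvK : involutive linv.
Proof. by case=> b i; rewrite /linv /= negbK. Qed.

Lemma push_reduced l w : reduced w -> reduced (push l w).
Proof.
case: w => [|m w] //= hw; case: ifPn => [_|h] /=; last by rewrite h.
exact: path_sorted hw.
Qed.

Lemma pushK l w : reduced w -> push l (push (linv l) w) = w.
Proof.
case: w => [|m w] /=; first by rewrite eqxx.
rewrite linvK => hw; case: eqP => [e|_] /=; last by rewrite eqxx.
subst m; case: w hw => [|m w] //= /andP[/negbTE-> _].
by [].
Qed.

Lemma cat_reduced v w : reduced w -> reduced (foldr push w v).
Proof. by move=> hw; elim: v => //= l v; apply: push_reduced. Qed.

Lemma foldr_push l v w : reduced w -> foldr push w (push l v) = push l (foldr push w v).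
Proof.
case: v => [|m v] //= hw; case: eqP => [->|] //=.
by rewrite pushK //; apply: cat_reduced.
Qed.

Definition free2 : Type := {w : seq letter | reduced w}.
HB.instance Definition _ := SubType.on free2.
HB.instance Definition _ := Choice.on free2.

Definition free2_one : free2 := exist _ [::] isT.
Definition free2_mul (v w : free2) : free2 :=
  exist _ (foldr push (val w) (val v)) (cat_reduced (val v) (valP w)).

Definition winv (v : seq letter) : seq letter := rev (map linv v).

Fact winv_reduced v : reduced v -> reduced (winv v).
Proof.
rewrite /winv /reduced rev_sorted sorted_map; apply: sub_sorted => l m /=.
by rewrite linvK eq_sym => /negP h; apply/negP => /eqP e; apply: h; apply/eqP.
Qed.

Definition free2_inv (v : free2) : free2 := exist _ (winv (val v)) (winv_reduced (valP v)).

Fact free2_mulA : associative free2_mul.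
Proof.
move=> u v w; apply: val_inj => /=; elim: (val u) => //= l s ->.
by rewrite foldr_push //; apply: (valP w).
Qed.

Fact free2_mul1l : left_id free2_one free2_mul.
Proof. by move=> v; apply: val_inj. Qed.

Lemma foldr_push_nil v : reduced v -> foldr push [::] v = v.
Proof.
elim: v => //= l v IH hv; rewrite IH; last exact: path_sorted hv.
by case: v hv {IH} => [|m v] //= /andP[/negbTE-> _].
Qed.

Fact free2_mul1r : right_id free2_one free2_mul.
Proof. by move=> v; apply: val_inj; apply: foldr_push_nil; apply: (valP v). Qed.

Fact free2_mulV : left_inverse free2_one free2_inv free2_mul.
Proof.
case=> v hv; apply: val_inj => /=; rewrite -[LHS](foldr_push_nil _); last first.
  exact/cat_reduced.
rewrite foldr_push_nil; last exact/cat_reduced.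
elim: v hv => //= l v IH hv; rewrite /winv /= rev_cons foldr_rcons /=.
rewrite /push linvK eqxx; exact: IH (path_sorted hv).
Qed.

Lemma free2_invK : involutive free2_inv.
Proof.
move=> v; apply: val_inj; rewrite /= /winv map_rev revK -map_comp.
by apply: map_id_in => l _; apply: linvK.
Qed.

Fact free2_mulgV : right_inverse free2_one free2_inv free2_mul.
Proof. by move=> v; rewrite -{1}[v]free2_invK free2_mulV. Qed.

HB.instance Definition _ := isGroup.Build free2
  free2_mulA free2_mul1l free2_mul1r free2_mulV free2_mulgV.

Definition gamma (i : 'I_2) : free2 := exist _ [:: (false, i)] isT.

Definition conjugate (g h : free2) : bool := `[< exists k, h = (g ^ k)%g >].

Fact conjugate_equiv : equiv_class_of conjugate.
Proof.
split=> [g|g h|h g k].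
- by apply/asboolP; exists 1%g; rewrite conjg1.
- by apply/asboolP/asboolP => -[k ->]; exists k^-1%g; rewrite conjgK.
- by move=> /asboolP[a ->] /asboolP[b ->]; apply/asboolP; exists (a * b)%g; rewrite conjgM.
Qed.

Canonical conjugate_rel := EquivRelPack conjugate_equiv.
Canonical conjugate_encModRel := defaultEncModRel conjugate.

Definition loops : Type := {eq_quot conjugate}.
HB.instance Definition _ := EqQuotient.on loops.
HB.instance Definition _ := Choice.on loops.

Definition loop_class (g : free2) : loops := \pi_loops g.

Section Surface.
Variable K : fieldType.

Definition mlin (S : choiceType) (V : lmodType K) (f : S -> V) (p : {malg K[S]}) : V :=
  \sum_(x <- msupp p) p@_x *: f x.

Definition mmap (S T : choiceType) (f : S -> T) : {malg K[S]} -> {malg K[T]} :=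
  mlin (fun x => << f x >>).

(* Tensor products of free modules are free on products of bases; |K pi| is   *)
(* free on the conjugacy classes of pi, i.e. on free homotopy classes.        *)
Notation Kpi := {malg K[free2]}.
Notation Kpi2 := {malg K[(free2 * free2)%type]}.
Notation Kloops := {malg K[loops]}.
Notation Kloops_pi := {malg K[(loops * free2)%type]}.
Notation Kloops2 := {malg K[(loops * loops)%type]}.

(* (a (x) b) t and t (a (x) b). *)
Definition lact2 (a b : free2) : Kpi2 -> Kpi2 :=
  mmap (fun p => (a * p.1, b * p.2)%g).
Definition ract2 (t : Kpi2) (a b : free2) : Kpi2 :=
  mmap (fun p => (p.1 * a, p.2 * b)%g) t.

(* The intersection operations kappa, mu, delta^+ of the surface are          *)
(* specified by their product rules and values on generators, each of which   *)
(* determines a unique linear map. The rules are multilinear, so they are     *)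
(* imposed on group elements only.                                            *)
Definition is_kappa (kappa : Kpi2 -> Kpi2) : Prop :=
  [/\ forall a b c : free2, kappa << (a, (b * c)%g) >> =
        ract2 (kappa << (a, b) >>) 1%g c + lact2 b 1%g (kappa << (a, c) >>),
      forall a b c : free2, kappa << ((a * b)%g, c) >> =
        ract2 (kappa << (a, c) >>) b 1%g + lact2 1%g a (kappa << (b, c) >>),
      forall i, kappa << (gamma i, gamma i) >> =
        << (1%g, (gamma i * gamma i)%g) >> - << (gamma i, gamma i) >>,
      forall i j : 'I_2, (i < j)%N -> kappa << (gamma i, gamma j) >> = 0 &
      forall i j : 'I_2, (j < i)%N -> kappa << (gamma i, gamma j) >> =
        << (1%g, (gamma i * gamma j)%g) >> + << ((gamma j * gamma i)%g, 1%g) >>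
        - << (gamma i, gamma j) >> - << (gamma j, gamma i) >>].

Definition is_mu (kappa : Kpi2 -> Kpi2) (mu : Kpi -> Kloops_pi) : Prop :=
  (forall x y : free2, mu << (x * y)%g >> =
     mmap (fun p => (p.1, p.2 * y)%g) (mu << x >>)
     + mmap (fun p => (p.1, x * p.2)%g) (mu << y >>)
     + mmap (fun p => (loop_class p.1, p.2)) (kappa << (x, y) >>)) /\
  (forall i, mu << gamma i >> = 0).

Definition Alt (t : Kloops2) : Kloops2 := t - mmap (fun p => (p.2, p.1)) t.

Definition is_delta_plus (mu : Kpi -> Kloops_pi) (delta : Kloops -> Kloops2) : Prop :=
  forall g : free2, delta << loop_class g >> =
    - Alt (mmap (fun p => (p.1, loop_class p.2)) (mu << g >>))
    + (<< (loop_class g, loop_class 1%g) >> - << (loop_class 1%g, loop_class g) >>).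

Definition theta_exp : Kpi -> 'A[K] :=
  mlin (fun g => \prod_(l <- val g) sexp (if l.1 then - gen K l.2 else gen K l.2)).

Definition theta2 (theta : Kpi -> 'A[K]) : Kpi2 -> 'A2[K] :=
  mlin (fun p => tens (theta << p.1 >>) (theta << p.2 >>)).

Definition theta_cyc (theta : Kpi -> 'A[K]) : Kloops -> cyc K :=
  mlin (fun c : loops => cp (theta << repr c >>)).

Definition theta_cyc2 (theta : Kpi -> 'A[K]) : Kloops2 -> cyc2 K :=
  mlin (fun p : (loops * loops)%type => cp2 (tens (theta << repr p.1 >>) (theta << repr p.2 >>))).

Definition cyc_bracket (kappa_t : 'A2[K] -> 'A2[K]) (y z : cyc K) : cyc K :=
  cp (tmult (kappa_t (tens (repr y) (repr z)))).

Definition central (kappa_t : 'A2[K] -> 'A2[K]) (z : cyc K) : Prop :=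
  forall y, cyc_bracket kappa_t z y = 0.

(* The c_i are unique when they exist; the default value 0 is irrelevant.     *)
(* ham kappa_t a is the element {|a|, -} of tDer(A).                          *)
Definition ham_rep (kappa_t : 'A2[K] -> 'A2[K]) (a : 'A[K]) : 'I_2 -> 'A2[K] :=
  xget (fun=> 0) (fun c => forall i, kappa_t (tens a (gen K i)) =
    tswap (c i) * tens 1 (gen K i) - tens (gen K i) 1 * tswap (c i)).

Definition ham (kappa_t : 'A2[K] -> 'A2[K]) (a : 'A[K]) : 'I_2 -> 'A[K] :=
  fun i => - tmult (tswap (ham_rep kappa_t a i)).

End Surface.

(* Main.v *)
(** Put G = F^-1 (a pair of group-like series) and let Gam_i be the image of gamma_i under theta.
    In the coordinates Gam_i the Hamiltonian derivation of |a| sends Gam_i to [Gam_i, u_i], where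
    u_i is built from the cyclic derivatives of a, and it kills Gam_1 Gam_2; the product rules of
    mu and kappa turn delta^+(|a|) into - sum_i |dG_i(u_i) (Gam_i (x) 1 - 1 (x) Gam_i)|, a
    divergence in these coordinates. Writing G = exp(w) and using that tDiv is a 1-cocycle, the
    change of coordinates back to the x_i turns this into
    - tDiv({|a|,-}) - {|a|,-}.|Dt(j(G))| with Dt = (1 (x) antipode) o coproduct.
    The last term vanishes when z = j(G) is central: a derivation that kills Gam_1 Gam_2 and whose
    values are all sums of commutators is inner, ad h with h a series in Gam_1 Gam_2; hence the
    cyclic derivatives of z differ from series in Gam_1, Gam_2, Gam_1 Gam_2 by elements that
    cancel, and Euler's formula exhibits z itself as a sum of such series. Finally if y is
    group-like and {|a|,y} = [y,u], then {|a|,-}.Dt(y^m) is a sum of commutators. *)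
Require Import Defs.
From HB Require Import structures.
From mathcomp Require Import all_boot all_order all_algebra.
From mathcomp Require Import finmap.
From mathcomp Require Import boolp classical_sets.
From mathcomp.multinomials Require Import monalg.
From mathcomp Require Import ring zify.

Set Implicit Arguments.
Unset Strict Implicit.
Unset Printing Implicit Defensive.

Import GRing.Theory.
Local Open Scope ring_scope.

(** * Complete filtered modules *)

(** Dt enters through primitivity: an expansion in the elements x_i (x) 1 - 1 (x) x_i is unique,
    which forces d_i p = Dt(p^i) for the double partial derivatives of a primitive p. Hence tDiv(w)
    = |Dt(div w)|, and integrating the cocycle tDiv along exp(sw) turns div w into j(exp w). The
    passage from x_i to e^{x_i} is free, because d_i f times x_i (x) 1 - 1 (x) x_i in A (x) A^op is
    the same in both coordinates; only the conjugation by G_i contributes. Why such derivations are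
    inner: let v kill x_0 and have sums of commutators as values. Then x_0^N v(q) = v(x_0^N q) has
    class 0 for all N, so v(q) has no coefficient on a word x_1 W x_1, and q = x_1 x_0^m x_1 x_0^m
    x_1 isolates v(x_1). No flow is differentiated: exponentials are series of degree-raising
    operators, and identities between them are checked term by term after multiplication by n + 1.
    Since j is known only through its cocycle law and its derivative, its value on exp(w) is found
    by induction on the filtration. *)

HB.mixin Record isComplete (K : pzRingType) V of FiltModule K V := {
  filW : forall M N (v : V), (M <= N)%N -> fil N v -> fil M v;
  fil_0 : forall v : V, fil 0%N v;
  fil_sep : forall v : V, (forall N, fil N v) -> v = 0;
  csum : (nat -> V) -> V;
  csum_sub : forall c : nat -> V, (forall k, fil k (c k)) ->
    forall N, fil N (csum c - \sum_(k < N) c k)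
}.

#[short(type="complModType")]
HB.structure Definition ComplModule (K : pzRingType) :=
  {V of FiltModule K V & isComplete K V}.

Arguments filW {K s M N v}.
Arguments fil_0 {K s}.

Section Complete.
Variable K : pzRingType.
Implicit Types V : complModType K.

Lemma filN (V : filtModType K) N (v : V) : fil N v -> fil N (- v).
Proof. by move=> h; rewrite -scaleN1r; apply: filZ. Qed.

Lemma filB (V : filtModType K) N (u v : V) : fil N u -> fil N v -> fil N (u - v).
Proof. by move=> hu hv; apply: filD => //; apply: filN. Qed.

Lemma fil_sum (V : filtModType K) N I (r : seq I) (P : pred I) (F : I -> V) :
  (forall i, P i -> fil N (F i)) -> fil N (\sum_(i <- r | P i) F i).
Proof.
by move=> h; elim/big_rec: _ => [|i v Pi hv]; [exact: fil0 | apply: filD; auto].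
Qed.

Lemma fil_sub_sym (V : filtModType K) N (u v : V) : fil N (u - v) -> fil N (v - u).
Proof. by move=> h; rewrite -opprB; apply: filN. Qed.

Lemma fil_trans (V : filtModType K) N (v u w : V) :
  fil N (u - v) -> fil N (v - w) -> fil N (u - w).
Proof. by move=> h1 h2; rewrite -(subrKA v); apply: filD. Qed.

Definition separated (V : filtModType K) := forall v : V, (forall N, fil N v) -> v = 0.

Lemma compl_sep V : separated V.
Proof. exact: fil_sep. Qed.

Lemma sep_eq (V : filtModType K) (u v : V) : separated V ->
  (forall N, fil N (u - v)) -> u = v.
Proof. by move=> sV h; apply/eqP; rewrite -subr_eq0; apply/eqP/sV. Qed.

Lemma fil_eq V (u v : V) : (forall N, fil N (u - v)) -> u = v.
Proof. exact/sep_eq/compl_sep. Qed.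

(** The rate of convergence is fixed: the N-th partial sum is exact modulo [fil N]. Sums are then
    preserved by every filtered linear map, with no modulus to carry along. *)
Definition is_sum (V : filtModType K) (c : nat -> V) (s : V) := forall N, fil N (s - \sum_(k < N) c k).

Lemma csumP V (c : nat -> V) : (forall k, fil k (c k)) -> is_sum c (csum c).
Proof. exact: csum_sub. Qed.

Lemma is_sum_uniq (V : filtModType K) (c : nat -> V) s t : separated V ->
  is_sum c s -> is_sum c t -> s = t.
Proof.
move=> sV hs ht; apply: sep_eq => // N; apply: fil_trans (hs N) _; exact/fil_sub_sym/ht.
Qed.

Lemma eq_is_sum (V : filtModType K) (c d : nat -> V) s : c =1 d -> is_sum c s -> is_sum d s.
Proof. by move=> e h N; under eq_bigr do rewrite -e. Qed.

Lemma is_sum_fil (V : filtModType K) (c : nat -> V) s N : is_sum c s ->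
  (forall k, fil N (c k)) -> fil N s.
Proof.
move=> h hc; rewrite -[s](subrK (\sum_(k < N) c k)); apply: filD => //.
by apply: fil_sum => k _; apply: hc.
Qed.

Lemma is_sum_term V (c : nat -> V) s k : is_sum c s -> fil k (c k).
Proof.
move=> h; have := filB (h k) (filW (leqnSn k) (h k.+1)).
by rewrite big_ord_recr opprB addrC subrKA addrC addKr.
Qed.

Definition filtered (U V : filtModType K) (f : U -> V) :=
  forall N u, fil N u -> fil N (f u).
Definition raising (V : filtModType K) (f : V -> V) :=
  forall N u, fil N u -> fil N.+1 (f u).

(** Two notions are kept apart because double derivations lower the degree by one. Filtered maps
    commute with sums of series; continuity is enough for density arguments and for factoring
    through quotients. *)
Definition clin (U V : filtModType K) (f : U -> V) := linear f /\ filt_continuous f.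
Definition flin (U V : filtModType K) (f : U -> V) := linear f /\ filtered f.

Section LinearProp.
Variables (U V : filtModType K) (f : U -> V).
Hypothesis lf : linear f.
Lemma lin0 : f 0 = 0.
Proof.
by have := lf (-1) 0 0; rewrite scaler0 addr0 scaleN1r addNr.
Qed.
Lemma linD u v : f (u + v) = f u + f v.
Proof. by rewrite -[u]scale1r lf !scale1r. Qed.
Lemma linZ c u : f (c *: u) = c *: f u.
Proof. by rewrite -[c *: u]addr0 lf lin0 addr0. Qed.
Lemma linN u : f (- u) = - f u.
Proof. by rewrite -scaleN1r linZ scaleN1r. Qed.
Lemma linB u v : f (u - v) = f u - f v.
Proof. by rewrite linD linN. Qed.
Lemma lin_sum I (r : seq I) (P : pred I) (F : I -> U) :
  f (\sum_(i <- r | P i) F i) = \sum_(i <- r | P i) f (F i).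
Proof. by elim/big_rec2: _ => [|i u v _ <-]; [exact: lin0 | rewrite linD]. Qed.
End LinearProp.

Lemma filtered_cont (U V : filtModType K) (f : U -> V) :
  filtered f -> filt_continuous f.
Proof. by move=> h N; exists N => u; apply: h. Qed.

Lemma flin_clin (U V : filtModType K) (f : U -> V) : flin f -> clin f.
Proof. by case=> l h; split=> //; apply: filtered_cont. Qed.

Lemma clin_id (V : filtModType K) : clin (fun v : V => v).
Proof. by split=> // N; exists N. Qed.

Lemma clin_comp (U V W : filtModType K) (f : V -> W) (g : U -> V) :
  clin f -> clin g -> clin (fun u => f (g u)).
Proof.
move=> [lf cf] [lg cg]; split=> [c u v|N]; first by rewrite lg lf.
have [M hM] := cf N; have [L hL] := cg M.
by exists L => u /hL /hM.
Qed.

Lemma flin_comp (U V W : filtModType K) (f : V -> W) (g : U -> V) :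
  flin f -> flin g -> flin (fun u => f (g u)).
Proof.
move=> [lf cf] [lg cg]; split=> [c u v|N u h]; first by rewrite lg lf.
exact/cf/cg.
Qed.

Lemma flin_id (V : filtModType K) : flin (fun v : V => v).
Proof. by split. Qed.

Lemma flin_iter (V : filtModType K) (f : V -> V) k : flin f -> flin (fun v => iter k f v).
Proof.
by move=> h; elim: k => [|k IH]; [exact: flin_id | apply: (flin_comp h IH)].
Qed.

Lemma raising_iter (V : filtModType K) (f : V -> V) k N u :
  raising f -> fil N u -> fil (k + N) (iter k f u).
Proof. by move=> h hu; elim: k => //= k IH; apply: h. Qed.

Lemma is_sum_flin (U V : filtModType K) (f : U -> V) c s :
  flin f -> is_sum c s -> is_sum (fun k => f (c k)) (f s).
Proof.
by move=> [lf ff] h N; rewrite -(lin_sum lf (index_enum 'I_N) xpredT (fun k => c k)) -linB //; apply: ff.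
Qed.

Lemma is_sumD (V : filtModType K) (c d : nat -> V) s t : is_sum c s -> is_sum d t ->
  is_sum (fun k => c k + d k) (s + t).
Proof. by move=> h h' N; rewrite big_split opprD addrACA; apply: filD. Qed.

(** Since [d n m] lies in [fil (n + m)], only the triangle n + m < N survives modulo [fil N], in
    either order of summation. *)
Lemma is_sum_double V (c : nat -> V) (d : nat -> nat -> V) s :
  is_sum c s -> (forall n, is_sum (d n) (c n)) ->
  (forall n m, fil (n + m) (d n m)) ->
  is_sum (fun p => \sum_(n < p.+1) d n (p - n)%N) s.
Proof.
move=> hs hc hd N; apply: fil_trans (hs N) _.
have -> : \sum_(p < N) \sum_(n < p.+1) d n (p - n)%N =
    \sum_(n < N) \sum_(m < N - n) d n m.
  elim: N => [|N IH]; first by rewrite !big_ord0.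
  rewrite big_ord_recr [RHS]big_ord_recr /= subSnn big_ord1.
  under [X in _ = X + _]eq_bigr => n _ do
    rewrite (subSn (ltnW (ltn_ord n))) big_ord_recr /=.
  by rewrite big_split -IH -!addrA big_ord_recr subnn.
rewrite -sumrB; apply: fil_sum => n _.
apply: fil_trans (hc n N) _.
have split_at M : M = (N - n + n)%N -> \sum_(k < M) d n k =
    \sum_(m < N - n) d n m + \sum_(m < n) d n (N - n + m)%N.
  by move=> ->; rewrite big_split_ord.
rewrite (split_at N) ?subnK 1?ltnW //.
rewrite addrAC subrr add0r; apply: fil_sum => m _.
by apply: filW (hd _ _); lia.
Qed.

End Complete.

Section ScalarComplete.
Variable K : pzRingType.
Implicit Types (c : nat -> K^o) (a : K^o).

Fact scalar_filW M N a : (M <= N)%N -> fil N a -> fil M a.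
Proof. by move=> h ha M0; apply: ha; apply: leq_trans h. Qed.
Fact scalar_fil_0 a : fil 0%N a.
Proof. by []. Qed.
Fact scalar_fil_sep a : (forall N, fil N a) -> a = 0.
Proof. by move=> h; apply: (h 1%N). Qed.
Fact scalar_csum_sub c : (forall k, fil k (c k)) ->
  forall N, fil N ((c 0%N : K^o) - \sum_(k < N) c k).
Proof.
move=> h [|N] // _; rewrite big_ord_recl opprD addrA subrr sub0r.
by rewrite big1 ?oppr0 // => k _; apply: h.
Qed.

HB.instance Definition _ := isComplete.Build K K^o
  scalar_filW scalar_fil_0 scalar_fil_sep scalar_csum_sub.
End ScalarComplete.

Section SeriesComplete.
Variables (K : pzRingType) (V : complModType K).
Implicit Types (c : nat -> ncseries V) (a : ncseries V).

(** For [c k] in [fil k], the terms of index below [size w] are unconstrained at w, while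
    [c (size w + k) w] lies in [fil k]. The finite head is therefore added by hand and only the
    shifted tail is summed in V. *)
Definition ncs_csum c : ncseries V := fun w =>
  \sum_(k < size w) c k w + csum (fun k => c (size w + k)%N w).

Fact ncs_filW M N a : (M <= N)%N -> fil N a -> fil M a.
Proof. by move=> h ha w; apply: filW (ha w); apply: leq_sub2r. Qed.
Fact ncs_fil_0 a : fil 0%N a.
Proof. by move=> w; rewrite sub0n; apply: fil_0. Qed.
Fact ncs_fil_sep a : (forall N, fil N a) -> a = 0.
Proof.
move=> h; apply: funext => w; apply: fil_sep => N.
by have := h (N + size w)%N w; rewrite addnK.
Qed.
Fact ncs_csum_sub c : (forall k, fil k (c k)) ->
  forall N, fil N (ncs_csum c - \sum_(k < N) c k).
Proof.
move=> h N w; rewrite ncsDE ncsNE ncs_sumE /ncs_csum.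
have [le|/ltnW le] := leqP N (size w).
  by rewrite (eqP le : (N - _ = 0)%N); apply: fil_0.
have split_at M : M = (size w + (N - size w))%N -> \sum_(k < M) c k w =
    \sum_(m < size w) c m w + \sum_(m < N - size w) c (size w + m)%N w.
  by move=> ->; rewrite big_split_ord.
rewrite [X in fil _ (_ - X)]split_at ?subnKC // opprD addrACA subrr add0r.
apply: (@csum_sub _ _ (fun k => c (size w + k)%N w)) => k.
by have := h (size w + k)%N w; rewrite addKn.
Qed.

HB.instance Definition _ := isComplete.Build K (ncseries V)
  ncs_filW ncs_fil_0 ncs_fil_sep ncs_csum_sub.
End SeriesComplete.

Section CquotSeparated.
Variables (K : pzRingType) (V : filtModType K) (X : V -> Prop).

(** Holds because the quotient is by the closure of the span. |A| and its tensor square get no sum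
    operator: separation alone lets equalities there be tested modulo each [fil N]. *)
Lemma cquot_sep : separated (cquot X).
Proof.
move=> z; rewrite -[z]cprojK => h; rewrite -(linear0 (cproj X)); apply/cprojP => N.
rewrite subr0; have [v hv /cprojP e] := h N.
have [s [hs fs]] := closed_spanP (-1) e (closed_span0 _) N.
exists s; split=> //; rewrite addr0 scaleN1r opprB in fs.
by rewrite -[repr z](subrK v) addrAC; apply: filD.
Qed.
End CquotSeparated.

HB.mixin Record isFiltAlg (K : comNzRingType) R of GRing.Algebra K R & FiltModule K R := {
  filM : forall M N (a b : R), fil M a -> fil N b -> fil (M + N)%N (a * b)
}.

#[short(type="complAlgType")]
HB.structure Definition ComplAlgebra (K : comNzRingType) :=
  {R of GRing.Algebra K R & ComplModule K R & isFiltAlg K R}.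

Arguments filM {K s M N a b}.

Section Instances.
Variable K : comNzRingType.

Fact scalar_filM M N (a b : K^o) : fil M a -> fil N b -> fil (M + N) (a * b : K^o).
Proof.
move=> ha hb; rewrite /fil /= /scalar_fil addn_gt0.
by case/orP=> [/ha|/hb] ->; rewrite ?mul0r ?mulr0.
Qed.
HB.instance Definition _ := isFiltAlg.Build K K^o scalar_filM.

Fact ncs_filM (R : complAlgType K) M N (a b : ncseries R) :
  fil M a -> fil N b -> fil (M + N) (a * b).
Proof.
move=> ha hb w; rewrite ncsME; apply: fil_sum => k _.
apply: filW (filM (ha _) (hb _)).
have le : (k <= size w)%N by rewrite -ltnS.
rewrite size_takel // size_drop; move: (nat_of_ord k) le => l le; lia.
Qed.
HB.instance Definition _ (R : complAlgType K) := isFiltAlg.Build K (ncseries R) (@ncs_filM R).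
End Instances.

Section Cyc.
Variable K : fieldType.

Lemma cyc_sep : separated (cyc K).
Proof. exact: (@cquot_sep K _ (@comm_set K)). Qed.

Lemma cyc2_sep : separated (cyc2 K).
Proof. exact: (@cquot_sep K _ (@comm_set2 K)). Qed.

Lemma cyc2_filW M N (z : cyc2 K) : (M <= N)%N -> fil N z -> fil M z.
Proof.
move=> h [t ht e]; exists t => // u; apply: filW (ht u); exact: leq_sub2r.
Qed.

End Cyc.

(** * The tensor square of the algebra of noncommutative series *)

Section LinearCombinators.
Variable K : comNzRingType.

Section Filtered.
Variables (U V : filtModType K).
Implicit Types f g : U -> V.

Lemma flin0 : flin (fun _ : U => 0 : V).
Proof. by split=> [c u v|N u _]; [rewrite scaler0 addr0 | apply: fil0]. Qed.
Lemma flin_add f g : flin f -> flin g -> flin (fun u => f u + g u).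
Proof.
move=> [lf ff] [lg fg]; split=> [c u v|N u h]; last by apply: filD; auto.
by rewrite lf lg scalerDr addrACA.
Qed.
Lemma flin_opp f : flin f -> flin (fun u => - f u).
Proof.
move=> [lf ff]; split=> [c u v|N u h]; last by apply: filN; auto.
by rewrite lf opprD scalerN.
Qed.
Lemma flin_scale c f : flin f -> flin (fun u => c *: f u).
Proof.
move=> [lf ff]; split=> [d u v|N u h]; last by apply: filZ; auto.
by rewrite lf scalerDr !scalerA mulrC.
Qed.
Lemma flin_sum I (r : seq I) (P : pred I) (f : I -> U -> V) :
  (forall i, flin (f i)) -> flin (fun u => \sum_(i <- r | P i) f i u).
Proof.
move=> h; split=> [c u v|N u hu]; last by apply: fil_sum => i _; apply: (h i).2.
rewrite scaler_sumr -big_split; apply: eq_bigr => i _; exact: (h i).1.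
Qed.
End Filtered.

Section Continuous.
Variables (U : complModType K) (V : filtModType K).
Implicit Types f g : U -> V.

Lemma clin0 : clin (fun _ : U => 0 : V).
Proof. exact/flin_clin/flin0. Qed.
Lemma clin_add f g : clin f -> clin g -> clin (fun u => f u + g u).
Proof.
move=> [lf cf] [lg cg]; split=> [c u v|N]; first by rewrite lf lg scalerDr addrACA.
have [M1 h1] := cf N; have [M2 h2] := cg N.
exists (maxn M1 M2) => u h; apply: filD; [apply: h1 | apply: h2]; apply: filW h.
  exact: leq_maxl.
exact: leq_maxr.
Qed.
Lemma clin_scale c f : clin f -> clin (fun u => c *: f u).
Proof.
move=> [lf cf]; split=> [d u v|N]; first by rewrite lf scalerDr !scalerA mulrC.
by have [M h] := cf N; exists M => u hu; apply/filZ/h.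
Qed.
Lemma clin_opp f : clin f -> clin (fun u => - f u).
Proof.
by move=> /(clin_scale (-1)); under [X in clin X]funext => u do rewrite scaleN1r.
Qed.
Lemma clin_sum I (r : seq I) (P : pred I) (f : I -> U -> V) :
  (forall i, clin (f i)) -> clin (fun u => \sum_(i <- r | P i) f i u).
Proof.
move=> h; elim: r => [|i r IH].
  by under [X in clin X]funext => u do rewrite big_nil; apply: clin0.
under [X in clin X]funext => u do rewrite big_cons.
by case: (P i) => //; apply: clin_add.
Qed.
End Continuous.

Section Alg.
Variable R : complAlgType K.

Lemma flin_mull (b : R) : flin (fun a : R => b * a).
Proof.
split=> [c u v|N u h]; first by rewrite mulrDr scalerAr.
exact: (filM (fil_0 b) h).
Qed.
Lemma flin_mulr (b : R) : flin (fun a : R => a * b).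
Proof.
split=> [c u v|N u h]; first by rewrite mulrDl scalerAl.
by have := filM h (fil_0 b); rewrite addn0.
Qed.
End Alg.

End LinearCombinators.

Section Tensors.
Variable K : fieldType.
Notation A := 'A[K].
Notation A2 := 'A2[K].
Implicit Types (a b c d : A) (s t : A2) (i : 'I_2).

Lemma filA N a : fil N a <-> forall w, (size w < N)%N -> a w = 0.
Proof.
split=> h w; first by move=> l; apply: (h w); rewrite subn_gt0.
by rewrite /fil /= /scalar_fil subn_gt0; apply: h.
Qed.

Lemma filA2 N t : fil N t <-> forall u v, (size u + size v < N)%N -> t u v = 0.
Proof.
split=> h u; last by apply/filA => v l; apply: h; lia.
by move=> v l; have /filA := h u; apply; lia.
Qed.

Lemma filA_0 a : fil 0 a. Proof. exact/filA. Qed.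
Lemma filA2_0 t : fil 0 t. Proof. exact/filA2. Qed.

Lemma filA2W M N t : (M <= N)%N -> fil N t -> fil M t.
Proof. by move=> le /filA2 h; apply/filA2 => u v l; apply: h; apply: leq_trans le. Qed.

Lemma fil_tens M N a b : fil M a -> fil N b -> fil (M + N) (tens a b).
Proof.
move=> /filA ha /filA hb; apply/filA2 => u v l; rewrite /tens.
by have [/ha ->|lu] := ltnP (size u) M; [rewrite mul0r | rewrite hb ?mulr0; last lia].
Qed.

Lemma tensE a b u : tens a b u = a u *: b.
Proof. by []. Qed.

Lemma flin_tensl b : flin (fun a => tens a b).
Proof.
split=> [c u v|N u h]; first by apply: funext => w; apply: funext => x;
  rewrite !(ncsDE, ncsZE) /tens mulrDl scalerAl.
by have := fil_tens h (filA_0 b); rewrite addn0.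
Qed.

Lemma flin_tensr a : flin (tens a).
Proof.
split=> [c u v|N u h]; first by apply: funext => w; apply: funext => x;
  rewrite !(ncsDE, ncsZE) /tens mulrDr scalerAr.
exact: (fil_tens (filA_0 a) h).
Qed.

Lemma filA2M M N s t : fil M s -> fil N t -> fil (M + N) (s * t).
Proof.
move=> hs ht u; apply: fil_sum => k _; apply: filW (filM (hs _) (ht _)).
have le : (k <= size u)%N by rewrite -ltnS.
rewrite size_takel // size_drop; move: (nat_of_ord k) le => l le; lia.
Qed.

Lemma flin_mull2 s : flin (fun t : A2 => s * t).
Proof.
split=> [c t r|N t h].
  apply: funext => u; rewrite ncsDE ncsZE !ncsME scaler_sumr -big_split.
  by apply: eq_bigr => k _; rewrite mulrDr -scalerAr.
by have := filA2M (filA2_0 s) h; rewrite add0n.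
Qed.
Lemma flin_mulr2 t : flin (fun s : A2 => s * t).
Proof.
split=> [c r s|N s h].
  apply: funext => u; rewrite ncsDE ncsZE !ncsME scaler_sumr -big_split.
  by apply: eq_bigr => k _; rewrite mulrDl -scalerAl.
by have := filA2M h (filA2_0 t); rewrite addn0.
Qed.

Definition tensDl a b c := linD (flin_tensl c).1 a b.
Definition tensDr a b c := linD (flin_tensr a).1 b c.
Definition tensBl a b c := linB (flin_tensl c).1 a b.
Definition tensBr a b c := linB (flin_tensr a).1 b c.
Lemma tens11 : tens 1 1 = 1 :> A2.
Proof. by apply: funext => -[|i u]; rewrite tens1l ?ncs1E. Qed.

Lemma tens_mul a b c d : tens a b * tens c d = tens (a * c) (b * d).
Proof.
apply: funext => u; rewrite tensE !ncsME scaler_suml; apply: eq_bigr => k _.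
by rewrite !tensE -scalerAl -scalerAr scalerA.
Qed.

Lemma flin_tswap : flin (@tswap K).
Proof.
split=> // N t /filA2 h; apply/filA2 => u v l; apply: h; by rewrite addnC.
Qed.
Lemma tswapK : involutive (@tswap K). Proof. by []. Qed.
Lemma tswap_tens a b : tswap (tens a b) = tens b a.
Proof. by apply: funext => u; apply: funext => v; rewrite /tswap /tens /= mulrC. Qed.

Lemma flin_tmult : flin (@tmult K).
Proof.
split=> [c s t|N t /filA2 h]; last first.
  by apply/filA => w l; apply: big1 => k _; apply: h; rewrite -size_cat cat_take_drop.
apply: funext => w; rewrite ncsDE ncsZE /tmult scaler_sumr -big_split.
by apply: eq_bigr.
Qed.

Lemma linear_pder i : linear (@pder K i). Proof. by []. Qed.
Lemma fil_pder i N a : fil N.+1 a -> fil N (pder i a).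
Proof.
by move=> /filA h; apply/filA2 => u v l; apply: h; rewrite size_cat /= addnS.
Qed.
Lemma clin_pder i : clin (@pder K i).
Proof. by split=> // N; exists N.+1; apply: fil_pder. Qed.

(** The product of A (x) A^op: (a (x) b)(c (x) d) = ac (x) db. For it, double derivations obey a
    chain rule ([dder_expand]), [sand] is an action on A and [tcop] is multiplicative. The ring laws
    come from series over the converse ring through [omulC]. *)
Definition omul : A2 -> A2 -> A2 :=
  locked (fun s t u => \sum_(k < (size u).+1) t (drop k u) * s (take k u)).
Local Notation "s ** t" := (omul s t) (at level 40, left associativity).

Lemma omulE s t u : (s ** t) u = \sum_(k < (size u).+1) t (drop k u) * s (take k u).
Proof. by rewrite /omul -lock. Qed.

Lemma omulC s t : s ** t = (s : ncseries 'A[K]^c) * t :> ncseries 'A[K]^c.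
Proof. by apply: funext => u; rewrite omulE ncsME. Qed.

Lemma omulA s t (r : A2) : s ** (t ** r) = s ** t ** r.
Proof. by have := @mulrA (ncseries 'A[K]^c) s t r; rewrite -!omulC. Qed.
Lemma omul1r : left_id 1 omul.
Proof. by move=> s; have := @mul1r (ncseries 'A[K]^c) s; rewrite -omulC. Qed.
Lemma omulr1 : right_id 1 omul.
Proof. by move=> s; have := @mulr1 (ncseries 'A[K]^c) s; rewrite -omulC. Qed.
Lemma omul_tens a b c d : tens a b ** tens c d = tens (a * c) (d * b).
Proof.
apply: funext => u; rewrite tensE omulE scaler_suml; apply: eq_bigr => k _.
by rewrite !tensE -scalerAl -scalerAr scalerA mulrC.
Qed.
Lemma fil_omul M N s t : fil M s -> fil N t -> fil (M + N) (s ** t).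
Proof.
move=> hs ht u; rewrite omulE; apply: fil_sum => k _; apply: filW (filM (ht _) (hs _)).
have le : (k <= size u)%N by rewrite -ltnS.
rewrite size_takel // size_drop; move: (nat_of_ord k) le => l le; lia.
Qed.
Lemma flin_omull s : flin (omul s).
Proof.
split=> [c t r|N t h]; last by have := fil_omul (filA2_0 s) h; rewrite add0n.
apply: funext => u; rewrite ncsDE ncsZE !omulE scaler_sumr -big_split.
by apply: eq_bigr => k _; rewrite mulrDl -scalerAl.
Qed.
Lemma flin_omulr t : flin (fun s => s ** t).
Proof.
split=> [c s r|N s h]; last by have := fil_omul h (filA2_0 t); rewrite addn0.
apply: funext => u; rewrite ncsDE ncsZE !omulE scaler_sumr -big_split.
by apply: eq_bigr => k _; rewrite mulrDr -scalerAr.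
Qed.

Definition closed_sub (V : filtModType K) (P : V -> Prop) :=
  (forall (k : K) u v, P u -> P v -> P (k *: u + v)) /\
  (forall v, (forall N, exists2 p, P p & fil N (v - p)) -> P v).

Lemma closed_sub_eq (U : complModType K) (V : filtModType K) (f g : U -> V) :
  separated V -> clin f -> clin g -> closed_sub (fun u => f u = g u).
Proof.
move=> sV [lf cf] [lg cg]; split=> [c u v eu ev|v h]; first by rewrite lf lg eu ev.
apply: sep_eq => // N; have [M1 h1] := cf N; have [M2 h2] := cg N.
have [p ep hp] := h (maxn M1 M2); apply: (@fil_trans _ _ _ (f p)).
  by rewrite -linB //; apply: h1; apply: filW hp; apply: leq_maxl.
by apply: fil_sub_sym; rewrite ep -linB //; apply: h2; apply: filW hp; apply: leq_maxr.
Qed.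

Lemma gen_mulE i a w : (gen K i * a) w = if w is j :: v then (j == i)%:R * a v else 0.
Proof.
case: w => [|j w]; first by rewrite ncs_nilE mul0r.
rewrite ncs_consE mul0r add0r ncsME big_ord_recl take0 drop0 big1 ?addr0.
  by rewrite /ncs_shift /gen eqseq_cons andbT.
move=> k _; rewrite /ncs_shift /gen eqseq_cons.
by case: w k => [|l w] k; [case: k|rewrite andbF mul0r].
Qed.

Lemma A_decomp a : a = a [::] *: 1 + \sum_i gen K i * ncs_shift i a.
Proof.
apply: funext => w; rewrite ncsDE ncsZE ncs_sumE ncs1E.
under eq_bigr do rewrite gen_mulE.
case: w => [|j w]; first by rewrite big1 // addr0 [_ *: _]mulr1.
rewrite [_ *: _]mulr0 add0r (bigD1 j) //= eqxx mul1r big1 ?addr0 // => i /negbTE iNj.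
by rewrite eq_sym iNj mul0r.
Qed.

Lemma gen_tens_mulE i t u :
  (tens (gen K i) 1 * t) u = if u is j :: v then (j == i)%:R *: t v else 0.
Proof.
case: u => [|j u]; first by rewrite ncs_nilE tensE scale0r mul0r.
rewrite ncs_consE tensE scale0r mul0r add0r tens_shift ncsME big_ord_recl take0 drop0.
rewrite big1 ?addr0; first by rewrite tensE /ncs_shift /gen eqseq_cons andbT -scalerAl mul1r.
move=> k _; rewrite tensE /ncs_shift /gen eqseq_cons.
by case: u k => [|l u] k; [case: k|rewrite andbF scale0r mul0r].
Qed.

Lemma A2_decomp t : t = tens 1 (t [::]) + \sum_i tens (gen K i) 1 * ncs_shift i t.
Proof.
apply: funext => u; rewrite ncsDE ncs_sumE tens1l.
under eq_bigr do rewrite gen_tens_mulE.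
case: u => [|j u]; first by rewrite big1 // addr0.
rewrite add0r (bigD1 j) //= eqxx scale1r big1 ?addr0 // => i /negbTE iNj.
by rewrite eq_sym iNj scale0r.
Qed.

Lemma fil_gen i : fil 1 (gen K i).
Proof. by apply/filA => -[]. Qed.

Lemma fil_shift N i a : fil N.+1 a -> fil N (ncs_shift i a).
Proof. by move=> /filA h; apply/filA => w l; apply: h. Qed.

(** Splitting off the first letter gains one degree of precision, so N steps reach an element of P
    modulo [fil N]. *)
Lemma A_ind (P : A -> Prop) : closed_sub P -> P 1 ->
  (forall i a, P a -> P (gen K i * a)) -> forall a, P a.
Proof.
move=> [lP cP] P1 Pg a; apply: cP => N; elim: N a => [|N IH] a.
  by exists 1 => //; apply: fil_0.
have /choice[p hp] : forall i, exists p, P p /\ fil N (ncs_shift i a - p).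
  by move=> i; have [p] := IH (ncs_shift i a); exists p.
have P0 : P 0 by have := lP (-1) 1 1 P1 P1; rewrite scaleN1r addNr.
exists (a [::] *: 1 + \sum_i gen K i * p i).
  apply: (lP) => //; elim/big_rec: _ => // i x _ Px.
  by rewrite -[_ * _]scale1r; apply: lP => //; apply: Pg; case: (hp i).
rewrite {1}[a]A_decomp opprD addrACA subrr add0r -sumrB; apply: fil_sum => i _.
by rewrite -mulrBr -add1n; apply: filM (fil_gen i) _; case: (hp i).
Qed.

Lemma A2_ind (P : A2 -> Prop) : closed_sub P -> (forall a b, P (tens a b)) ->
  forall t, P t.
Proof.
move=> [lP cP] Pt t; apply: cP => N.
suff [r hr] : exists r : seq (A * A), fil N (t - \sum_(p <- r) tens p.1 p.2).
  exists (\sum_(p <- r) tens p.1 p.2) => //; elim: r {hr} => [|p r IH].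
    by rewrite big_nil -(lin0 (flin_tensr 0).1).
  by rewrite big_cons; have := lP 1 _ _ (Pt p.1 p.2) IH; rewrite scale1r.
elim: N t => [|N IH] t; first by exists [::]; apply: filA2_0.
have /choice[r hr] := fun i : 'I_2 => IH (ncs_shift i t).
exists ((1, t [::]) :: flatten [seq [seq (gen K i * p.1, p.2) | p <- r i] | i <- enum 'I_2]).
rewrite big_cons {1}[t]A2_decomp opprD addrACA subrr add0r big_flatten /= big_map big_enum.
rewrite -sumrB; apply: fil_sum => i _; rewrite big_map /=.
rewrite (eq_bigr (fun p => tens (gen K i) 1 * tens p.1 p.2)) => [|p _]; last first.
  by rewrite tens_mul mul1r.
rewrite -mulr_sumr -mulrBr -add1n; apply: filA2M (hr i).
by have := fil_tens (fil_gen i) (filA_0 1); rewrite addn0.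
Qed.

Lemma A2_eq (V : filtModType K) (f g : A2 -> V) : separated V -> clin f -> clin g ->
  (forall a b, f (tens a b) = g (tens a b)) -> forall t, f t = g t.
Proof. by move=> sV cf cg; apply: A2_ind; apply: closed_sub_eq. Qed.

End Tensors.

Notation "s ** t" := (omul s t) (at level 40, left associativity) : ring_scope.

Section TensorMaps.
Variable K : fieldType.
Notation A := 'A[K].
Notation A2 := 'A2[K].
Implicit Types (a b c d : A) (s t : A2) (i : 'I_2) (f g : A -> A).

Lemma flin_mullA a : flin (fun b : A => a * b). Proof. exact: flin_mull. Qed.
Lemma flin_mulrA a : flin (fun b : A => b * a). Proof. exact: flin_mulr. Qed.
Lemma filAM M N a b : fil M a -> fil N b -> fil (M + N) (a * b).
Proof. exact: filM. Qed.

Lemma flin_cp : flin (@cp K).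
Proof. by split=> [c u v|N u h]; [apply: cproj_is_linear | exists u]. Qed.
Lemma flin_cp2 : flin (@cp2 K).
Proof. by split=> [c u v|N u h]; [apply: cproj_is_linear | exists u]. Qed.

Definition tmapr f t : A2 := fun u => f (t u).
Definition tmapl f t : A2 := tswap (tmapr f (tswap t)).

Lemma flin_tmapr f : flin f -> flin (tmapr f).
Proof.
move=> [lf ff]; split=> [c s t|N t h u]; first by apply: funext => u; apply: lf.
exact/ff/h.
Qed.
Lemma flin_tmapl f : flin f -> flin (tmapl f).
Proof.
move=> hf; apply: (flin_comp (flin_tswap K)); apply: flin_comp (flin_tmapr hf) _.
exact: flin_tswap.
Qed.
Lemma tmapr_tens f a b : flin f -> tmapr f (tens a b) = tens a (f b).
Proof. by move=> [lf _]; apply: funext => u; rewrite /tmapr tensE linZ. Qed.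
Lemma tmapl_tens f a b : flin f -> tmapl f (tens a b) = tens (f a) b.
Proof. by move=> hf; rewrite /tmapl tswap_tens tmapr_tens // tswap_tens. Qed.
End TensorMaps.

Ltac flin :=
  match goal with
  | H : flin ?f |- flin ?g => constr_eq f g; exact: H
  | |- flin (@tswap _) => exact: (flin_tswap _)
  | |- flin (@tmult _) => exact: (flin_tmult _)
  | |- flin (@cp _) => exact: (flin_cp _)
  | |- flin (@cp2 _) => exact: (flin_cp2 _)
  | |- flin (omul ?s) => exact: (flin_omull s)
  | |- flin (tens ?s) => exact: (flin_tensr s)
  | |- flin ( *%R ?s) => first [exact: (flin_mullA s) | exact: (flin_mull2 s)]
  | |- flin (tmapr _) => apply: flin_tmapr; flin
  | |- flin (tmapl _) => apply: flin_tmapl; flin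
  | |- flin (fun x => x) => exact: flin_id
  | |- flin (fun x => 0) => exact: flin0
  | |- flin (fun x => @?f x + @?g x) => apply: (@flin_add _ _ _ f g); flin
  | |- flin (fun x => - @?f x) => apply: (@flin_opp _ _ _ f); flin
  | |- flin (fun x => ?c *: @?f x) => apply: (@flin_scale _ _ _ c f); flin
  | |- flin (fun x => \sum_(i <- _ | _) _) => apply: flin_sum => ?; flin
  | |- flin (fun x => ?s * @?f x) =>
      first [apply: (flin_comp (g := f) (flin_mullA s)) | apply: (flin_comp (g := f) (flin_mull2 s))]; flin
  | |- flin (fun x => @?f x * ?s) =>
      first [apply: (flin_comp (g := f) (flin_mulrA s)) | apply: (flin_comp (g := f) (flin_mulr2 s))]; flin
  | |- flin (fun x => ?s ** @?f x) => apply: (flin_comp (g := f) (flin_omull s)); flin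
  | |- flin (fun x => @?f x ** ?s) => apply: (flin_comp (g := f) (flin_omulr s)); flin
  | |- flin (fun x => tens ?s (@?f x)) => apply: (flin_comp (g := f) (flin_tensr s)); flin
  | |- flin (fun x => tens (@?f x) ?s) => apply: (flin_comp (g := f) (flin_tensl s)); flin
  | |- flin (fun x => ?h (@?f x)) => apply: (flin_comp (f := h) (g := f)); flin
  end.

Ltac clin :=
  match goal with
  | H : clin ?f |- clin ?g => constr_eq f g; exact: H
  | H : flin ?f |- clin ?g => constr_eq f g; exact: (flin_clin H)
  | |- clin (pder _) => exact: clin_pder
  | |- clin (@tswap _) => exact: (flin_clin (flin_tswap _))
  | |- clin (@tmult _) => exact: (flin_clin (flin_tmult _))
  | |- clin (@cp _) => exact: (flin_clin (flin_cp _))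
  | |- clin (@cp2 _) => exact: (flin_clin (flin_cp2 _))
  | |- clin (omul ?s) => exact: (flin_clin (flin_omull s))
  | |- clin (tens ?s) => exact: (flin_clin (flin_tensr s))
  | |- clin ( *%R ?s) => first [exact: (flin_clin (flin_mullA s)) | exact: (flin_clin (flin_mull2 s))]
  | |- clin (tmapr _) => apply: flin_clin; apply: flin_tmapr; flin
  | |- clin (tmapl _) => apply: flin_clin; apply: flin_tmapl; flin
  | |- clin (fun x => x) => exact: clin_id
  | |- clin (fun x => 0) => exact: clin0
  | |- clin (fun x => @?f x + @?g x) => apply: (@clin_add _ _ _ f g); clin
  | |- clin (fun x => - @?f x) => apply: (@clin_opp _ _ _ f); clin
  | |- clin (fun x => ?c *: @?f x) => apply: (@clin_scale _ _ _ c f); clin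
  | |- clin (fun x => \sum_(i <- _ | _) _) => apply: clin_sum => ?; clin
  | |- clin (fun x => ?s * @?f x) =>
      first [apply: (clin_comp (g := f) (flin_clin (flin_mullA s))) | apply: (clin_comp (g := f) (flin_clin (flin_mull2 s)))]; clin
  | |- clin (fun x => @?f x * ?s) =>
      first [apply: (clin_comp (g := f) (flin_clin (flin_mulrA s))) | apply: (clin_comp (g := f) (flin_clin (flin_mulr2 s)))]; clin
  | |- clin (fun x => ?s ** @?f x) => apply: (clin_comp (g := f) (flin_clin (flin_omull s))); clin
  | |- clin (fun x => @?f x ** ?s) => apply: (clin_comp (g := f) (flin_clin (flin_omulr s))); clin
  | |- clin (fun x => tens ?s (@?f x)) => apply: (clin_comp (g := f) (flin_clin (flin_tensr s))); clin
  | |- clin (fun x => tens (@?f x) ?s) => apply: (clin_comp (g := f) (flin_clin (flin_tensl s))); clin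
  | |- clin (fun x => ?h (@?f x)) => apply: (clin_comp (f := h) (g := f)); clin
  end.

Section TensorIdentities.
Variable K : fieldType.
Notation A := 'A[K].
Notation A2 := 'A2[K].
Implicit Types (a b c d : A) (s t : A2) (i : 'I_2) (f g : A -> A).

Lemma A_sep : separated A. Proof. exact: compl_sep. Qed.
Lemma A2_sep : separated A2.
Proof. by move=> t h; apply: funext => u; apply: funext => v; have /filA2 := h (size u + size v).+1; apply. Qed.

Lemma tmult_tens a b : tmult (tens a b) = a * b.
Proof.
by rewrite -[tens a b](_ : tens a 1 * tens 1 b = _) ?tens_mul ?mulr1 ?mul1r // -{1}[tens a 1]mulr1 tmult_mulr tmult_mull tmult1 mulr1.
Qed.

Lemma omul_tensE a b t : tens a b ** t = tens a 1 * t * tens 1 b.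
Proof.
move: t; apply: (A2_eq A2_sep) => [||c d]; [clin | clin |].
by rewrite omul_tens !tens_mul mul1r mulr1.
Qed.

(** The sandwich action of A (x) A^op on A, in which a (x) b sends c to acb. *)
Definition sand t c := tmult (t * tens c 1).
Lemma sand_tens a b c : sand (tens a b) c = a * c * b.
Proof. by rewrite /sand tens_mul mulr1 tmult_tens. Qed.
Lemma flin_sandl c : flin (fun t => sand t c). Proof. by rewrite /sand; flin. Qed.
Lemma flin_sandr t : flin (sand t). Proof. by rewrite /sand; flin. Qed.
Lemma sand_omul s t c : sand (s ** t) c = sand s (sand t c).
Proof.
move: s; apply: (A2_eq A_sep) => [||p q].
- by apply: clin_comp (flin_clin (flin_sandl c)) _; clin.
- exact/flin_clin/flin_sandl.
move: t; apply: (A2_eq A_sep) => [||p' q'].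
- by apply: clin_comp (flin_clin (flin_sandl c)) _; clin.
- by apply: clin_comp (flin_clin (flin_sandr _)) _; apply/flin_clin/flin_sandl.
by rewrite omul_tens !sand_tens !mulrA.
Qed.
Lemma sand1 t : sand t 1 = tmult t.
Proof. by rewrite /sand tens11 mulr1. Qed.

Lemma cpC a b : cp (a * b) = cp (b * a).
Proof.
apply/cprojP => N; exists [:: (1, a * b - b * a)]; split.
  by move=> p; rewrite inE => /eqP ->; exists a, b.
by rewrite big_seq1 scale1r subrr; apply: fil0.
Qed.

Lemma closed_span_ker (U V : filtModType K) (X : U -> Prop) (f : U -> V) u :
  separated V -> clin f -> (forall x, X x -> f x = 0) -> closed_span X u -> f u = 0.
Proof.
move=> sV [lf cf] fX hu; apply: sV => N; have [M hM] := cf N.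
have [s [hs fs]] := hu M; have := hM _ fs; rewrite linB // lin_sum // big_seq big1 ?subr0 //.
by move=> p ps; rewrite linZ // fX ?scaler0 //; apply: hs.
Qed.

(** Replaces the universal property of |A| without constructing the induced map; in particular it
    allows passing to the representative [repr]. *)
Lemma cp_factor (V : filtModType K) (f : A -> V) a b : separated V -> clin f ->
  (forall c d, f (c * d) = f (d * c)) -> cp a = cp b -> f a = f b.
Proof.
move=> sV cf fC /cprojP h; apply/eqP; rewrite -subr_eq0 -(linB cf.1); apply/eqP.
apply: (closed_span_ker sV cf _ h) => _ [c [d ->]].
by rewrite (linB cf.1) fC subrr.
Qed.

Lemma cp2_commr a b c : cp2 (tens c (a * b)) = cp2 (tens c (b * a)).
Proof.
apply/cprojP => N; exists [:: (1, tens c (a * b - b * a))]; split.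
  by move=> p; rewrite inE => /eqP ->; exists a, b, c; right.
by rewrite big_seq1 scale1r tensBr subrr; apply: fil0.
Qed.

Lemma cp2_comml a b c : cp2 (tens (a * b) c) = cp2 (tens (b * a) c).
Proof.
apply/cprojP => N; exists [:: (1, tens (a * b - b * a) c)]; split.
  by move=> p; rewrite inE => /eqP ->; exists a, b, c; left.
by rewrite big_seq1 scale1r tensBl subrr; apply: fil0.
Qed.

Lemma cp2_factor (V : filtModType K) (f : A2 -> V) s t : separated V -> clin f ->
  (forall a b c, f (tens (a * b) c) = f (tens (b * a) c)) ->
  (forall a b c, f (tens c (a * b)) = f (tens c (b * a))) -> cp2 s = cp2 t -> f s = f t.
Proof.
move=> sV cf fl fr /cprojP h; apply/eqP; rewrite -subr_eq0 -(linB cf.1); apply/eqP.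
apply: (closed_span_ker sV cf _ h) => _ [a [b [c [->|->]]]].
  by rewrite tensBl (linB cf.1) fl subrr.
by rewrite tensBr (linB cf.1) fr subrr.
Qed.

Lemma cp2_omulC s t : cp2 (s ** t) = cp2 (t ** s).
Proof.
move: s; apply: (A2_eq (@cyc2_sep K)) => [||a b]; [clin | clin |].
move: t; apply: (A2_eq (@cyc2_sep K)) => [||c d]; [clin | clin |].
by rewrite !omul_tens cp2_comml cp2_commr.
Qed.

End TensorIdentities.

(** * Derivations, double derivations and substitutions *)

Section Derivations.
Variable K : fieldType.
Notation A := 'A[K].
Notation A2 := 'A2[K].
Implicit Types (a b c d : A) (s t : A2) (i : 'I_2) (v : A -> A) (D : A -> A2).

Definition derivation v := forall a b, v (a * b) = v a * b + a * v b.

Lemma deriv1 v : derivation v -> v 1 = 0.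
Proof.
move=> dv; have := dv 1 1; rewrite !mulr1 mul1r => /eqP.
by rewrite -subr_eq0 opprD addNKr oppr_eq0 => /eqP.
Qed.

Lemma deriv_eq v v' a : clin v -> clin v' -> derivation v -> derivation v' ->
  (forall i, v (gen K i) = v' (gen K i)) -> v a = v' a.
Proof.
move=> cv cv' dv dv' e; apply: (A_ind (closed_sub_eq (@A_sep K) cv cv')) a => [|i a ea].
  by rewrite !deriv1.
by rewrite dv dv' e ea.
Qed.

Lemma clin_deriv_of (w : 'I_2 -> A) : clin (deriv_of w).
Proof. by rewrite /deriv_of; clin. Qed.

Lemma flin_deriv_of (w : 'I_2 -> A) : (forall i, fil 1 (w i)) -> flin (deriv_of w).
Proof.
move=> h; split=> [|[|N] a ha]; first by case: (clin_deriv_of w).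
  exact: filA_0.
apply: fil_sum => i _; apply: (flin_tmult K).2.
rewrite -addn1; apply: filA2M (fil_pder i ha) _.
by have := fil_tens (h i) (filA_0 1); rewrite addn0.
Qed.

Lemma fil_bracket_gen i a N : fil N a -> fil N.+1 (gen K i * a - a * gen K i).
Proof.
move=> h; apply: filB; first by rewrite -add1n; apply: filAM (fil_gen K i) h.
by rewrite -addn1; apply: filAM h (fil_gen K i).
Qed.

Lemma flin_rho (u : 'I_2 -> A) : flin (rho u).
Proof. by apply: flin_deriv_of => i; apply: fil_bracket_gen; apply: filA_0. Qed.
Lemma deriv_rho (u : 'I_2 -> A) : derivation (rho u).
Proof. by move=> a b; apply: deriv_ofM. Qed.
Lemma rho_gen (u : 'I_2 -> A) i : rho u (gen K i) = gen K i * u i - u i * gen K i.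
Proof. exact: deriv_of_gen. Qed.

Definition tder2 v t := tmapl v t + tmapr v t.

Lemma flin_tder2 v : flin v -> flin (tder2 v).
Proof. by move=> hv; rewrite /tder2; flin. Qed.

Lemma tder2_tens v a b : flin v -> tder2 v (tens a b) = tens (v a) b + tens a (v b).
Proof. by move=> hv; rewrite /tder2 tmapl_tens // tmapr_tens. Qed.

Lemma tder2M v s t : flin v -> derivation v -> tder2 v (s * t) = tder2 v s * t + s * tder2 v t.
Proof.
move=> hv dv; have hv2 := flin_tder2 hv.
move: s; apply: (A2_eq (@A2_sep K)) => [||a b]; [clin | clin |].
move: t; apply: (A2_eq (@A2_sep K)) => [||c d]; [clin | clin |].
rewrite tens_mul !tder2_tens // !dv tensDl tensDr mulrDl mulrDr !tens_mul.
by rewrite -!addrA; congr (_ + _); rewrite addrCA.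
Qed.

Lemma tder2_omul v s t : flin v -> derivation v ->
  tder2 v (s ** t) = tder2 v s ** t + s ** tder2 v t.
Proof.
move=> hv dv; have hv2 := flin_tder2 hv.
move: s; apply: (A2_eq (@A2_sep K)) => [||a b]; [clin | clin |].
move: t; apply: (A2_eq (@A2_sep K)) => [||c d]; [clin | clin |].
rewrite omul_tens !tder2_tens // !dv tensDl tensDr.
rewrite (linD (flin_omulr _).1) (linD (flin_omull _).1) !omul_tens.
by rewrite -!addrA; congr (_ + _); rewrite [RHS]addrCA; congr (_ + _); rewrite addrC.
Qed.

(** Double derivations: derivations into A (x) A with its outer bimodule structure. *)
Definition dder D := forall a b, D (a * b) = D a * tens 1 b + tens a 1 * D b.

Lemma dder1 D : dder D -> D 1 = 0.
Proof.
move=> dD; have := dD 1 1; rewrite mulr1 !tens11 mulr1 mul1r => /eqP.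
by rewrite -subr_eq0 opprD addNKr oppr_eq0 => /eqP.
Qed.

Lemma dder_eq D D' a : clin D -> clin D' -> dder D -> dder D' ->
  (forall i, D (gen K i) = D' (gen K i)) -> D a = D' a.
Proof.
move=> cD cD' dD dD' e; apply: (A_ind (closed_sub_eq (@A2_sep K) cD cD')) a => [|i a ea].
  by rewrite !dder1.
by rewrite dD dD' e ea.
Qed.

Lemma omul_1tens b t : tens 1 b ** t = t * tens 1 b.
Proof. by rewrite omul_tensE tens11 mul1r. Qed.
Lemma omul_tens1 a t : tens a 1 ** t = tens a 1 * t.
Proof. by rewrite omul_tensE tens11 mulr1. Qed.
Definition omulDl s t r := linD (flin_omulr r).1 s t.
Definition omulDr r s t := linD (flin_omull r).1 s t.
Definition omulBl s t r := linB (flin_omulr r).1 s t.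
Definition omulBr r s t := linB (flin_omull r).1 s t.
Definition omulNr r s := linN (flin_omull r).1 s.
Lemma dderE D a b : dder D -> D (a * b) = tens 1 b ** D a + tens a 1 ** D b.
Proof. by move=> ->; rewrite omul_1tens omul_tens1. Qed.

Lemma dder_omulr D s : dder D -> dder (fun a => D a ** s).
Proof.
by move=> dD a b; rewrite dderE // omulDl -!omulA omul_1tens omul_tens1.
Qed.

Lemma dder_sum I (r : seq I) (P : pred I) (D : I -> A -> A2) :
  (forall j, dder (D j)) -> dder (fun a => \sum_(j <- r | P j) D j a).
Proof.
move=> dD a b; rewrite mulr_suml mulr_sumr -big_split; apply: eq_bigr => i _; exact: dD.
Qed.

Lemma dder_pder i : dder (pder i). Proof. move=> a b; exact: pderM. Qed.

(** The inner double derivation. Its expansion in the [tdif (gen K i)] is the fundamental formula of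
    Fox calculus, and on primitive elements it agrees with Dt. *)
Definition tdif : A -> A2 := locked (fun a => tens a 1 - tens 1 a).
Lemma tdifE a : tdif a = tens a 1 - tens 1 a. Proof. by rewrite /tdif -lock. Qed.

Lemma flin_tdif : flin tdif.
Proof. by rewrite (_ : tdif = fun a => tens a 1 - tens 1 a); [flin | apply: funext => a; exact: tdifE]. Qed.

Lemma dder_tdif : dder tdif.
Proof. by move=> a b; rewrite !tdifE mulrBl mulrBr !tens_mul !mulr1 !mul1r [RHS]addrC subrKA. Qed.

(** Multiplying by a fixed right factor for [**] preserves double derivations, so both sides are
    double derivations in a that agree on generators. *)
Lemma dder_expand D a : clin D -> dder D -> D a = \sum_i pder i a ** D (gen K i).
Proof.
move=> cD dD; apply: (dder_eq (D' := fun a => \sum_i pder i a ** D (gen K i))) => // [||j].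
- by clin.
- by apply: dder_sum => i; apply/dder_omulr/dder_pder.
rewrite (bigD1 j) //= big1 => [|i /negbTE iNj]; rewrite pder_gen ?eqxx ?iNj.
  by rewrite addr0 omul1r.
exact: (lin0 (flin_omulr _).1).
Qed.

End Derivations.

Section Substitution.
Variables (K : fieldType) (R : complAlgType K).
Variable (y : 'I_2 -> R).
Notation A := 'A[K].
Implicit Types (a b : A).

Lemma hom_subst0 a : hom_subst y a 0 = a [::] *: 1.
Proof.
rewrite /hom_subst (big_pred1 [tuple]) => [|w]; first by rewrite big_nil.
by rewrite [w]tuple0 /= eqxx.
Qed.

Lemma hom_substS a k :
  hom_subst y a k.+1 = \sum_i y i * hom_subst y (ncs_shift i a) k.
Proof.
rewrite /hom_subst; under [RHS]eq_bigr do rewrite mulr_sumr.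
rewrite pair_big /= (reindex (fun p : 'I_2 * k.-tuple 'I_2 => [tuple of p.1 :: p.2])).
  by apply: eq_bigr => p _; rewrite big_cons -scalerAr.
exists (fun w : k.+1.-tuple 'I_2 => (thead w, [tuple of behead w])) => [[i w]|w] _ /=.
  by rewrite theadE; congr (_, _); apply: val_inj.
by rewrite [RHS]tuple_eta; apply: val_inj.
Qed.

Lemma hom_subst_lin k : linear (fun a => hom_subst y a k).
Proof.
move=> c a b; rewrite /hom_subst scaler_sumr -big_split; apply: eq_bigr => w _.
by rewrite ncsDE ncsZE scalerDl scalerA.
Qed.

Lemma hom_substM a b n :
  hom_subst y (a * b) n = \sum_(k < n.+1) hom_subst y a k * hom_subst y b (n - k)%N.
Proof.
elim: n a => [|n IH] a.
  by rewrite big_ord1 !hom_subst0 ncs_nilE -scalerAl mul1r scalerA.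
rewrite big_ord_recl hom_subst0 -scalerAl mul1r subn0.
under eq_bigr => k _ do rewrite hom_substS subSS mulr_suml.
rewrite exchange_big /= 2!hom_substS scaler_sumr -big_split; apply: eq_bigr => i _.
have -> : ncs_shift i (a * b) = a [::] *: ncs_shift i b + ncs_shift i a * b.
  by apply: funext => w; rewrite /ncs_shift ncs_consE.
rewrite (hom_subst_lin n) mulrDr -scalerAr; congr (_ + _).
by rewrite IH mulr_sumr; apply: eq_bigr => k _; rewrite mulrA.
Qed.

Hypothesis y1 : forall i, fil 1 (y i).

(** The maximum records two facts: degree k parts go to [fil k], which gives convergence, and parts
    of degree below N vanish, which makes [hsubst] filtered. *)
Lemma fil_hom_subst a k N : fil N a -> fil (maxn k N) (hom_subst y a k).
Proof.
move=> /filA h; have [lt|le] := ltnP k N.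
  rewrite /hom_subst big1 => [|w _]; first exact: fil0.
  by rewrite h ?scale0r // size_tuple.
apply: fil_sum => w _; apply: filZ.
rewrite -[k in fil k _](size_tuple w).
elim: (tval w) => [|i v IH]; first exact: fil_0.
by rewrite big_cons /= -add1n; apply: filM.
Qed.

Definition hsubst a : R := csum (hom_subst y a).

Lemma hsubst_sum a : is_sum (hom_subst y a) (hsubst a).
Proof. by apply: csumP => k; have := fil_hom_subst k (filA_0 a); rewrite maxn0. Qed.

Lemma flin_hsubst : flin hsubst.
Proof.
split=> [c a b|N a h]; last first.
  by apply: is_sum_fil (hsubst_sum a) _ => k; apply: filW (fil_hom_subst k h); apply: leq_maxr.
apply: is_sum_uniq (hsubst_sum _) _; first exact: compl_sep.
have := is_sumD (is_sum_flin (flin_scale c (flin_id _)) (hsubst_sum a)) (hsubst_sum b).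
by apply: eq_is_sum => k; rewrite hom_subst_lin.
Qed.

Lemma hsubst1 : hsubst 1 = 1.
Proof.
apply: is_sum_uniq (hsubst_sum _) _; first exact: compl_sep.
case=> [|N]; first exact: fil_0.
rewrite big_ord_recl hom_subst0 ncs1E scale1r big1 => [|k _].
  by rewrite addr0 subrr; apply: fil0.
rewrite hom_substS big1 // => i _.
have -> : ncs_shift i (1 : A) = 0 by apply: funext.
by rewrite (lin0 (hom_subst_lin k)) mulr0.
Qed.

Lemma hsubstM a b : hsubst (a * b) = hsubst a * hsubst b.
Proof.
apply: is_sum_uniq (hsubst_sum _) _; first exact: compl_sep.
have F k c : fil k (hom_subst y c k) by exact: is_sum_term (hsubst_sum c).
have := @is_sum_double _ _ (fun k => hom_subst y a k * hsubst b)
  (fun k l => hom_subst y a k * hom_subst y b l) (hsubst a * hsubst b).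
have -> : (fun p => \sum_(n < p.+1) hom_subst y a n * hom_subst y b (p - n)%N) =
  hom_subst y (a * b) by apply: funext => p; rewrite hom_substM.
apply=> [|n|n m]; last exact: filM.
  exact: is_sum_flin (flin_mulr (hsubst b)) (hsubst_sum a).
exact: is_sum_flin (flin_mull _) (hsubst_sum b).
Qed.

Lemma hsubst_gen i : hsubst (gen K i) = y i.
Proof.
apply: is_sum_uniq (hsubst_sum _) _; first exact: compl_sep.
case=> [|[|N]]; first exact: fil_0.
  by rewrite big_ord1 hom_subst0 scale0r subr0.
rewrite big_ord_recl hom_subst0 scale0r add0r big_ord_recl big1 ?addr0 => [|k _].
  rewrite hom_substS (bigD1 i) //= big1 => [|j /negbTE jNi]; rewrite hom_subst0.
    by rewrite /ncs_shift /gen eqxx scale1r mulr1 addr0 subrr; apply: fil0.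
  by rewrite /ncs_shift /gen eqseq_cons jNi scale0r mulr0.
rewrite -[nat_of_ord _]/(k.+2) hom_substS big1 // => j _; rewrite hom_substS big1 ?mulr0 // => l _.
have -> : ncs_shift l (ncs_shift j (gen K i)) = 0.
  by apply: funext => w; rewrite /ncs_shift /gen eqseq_cons andbF.
by rewrite (lin0 (hom_subst_lin k)) mulr0.
Qed.

End Substitution.

(** * Homomorphisms, Neumann inverses, antipode and coproduct *)

Section Homs.
Variable K : fieldType.
Notation A := 'A[K].
Notation A2 := 'A2[K].
Implicit Types (a b c d : A) (s t : A2) (i : 'I_2) (f g : A -> A).

Lemma ssumE (c : nat -> A) : ssum c = csum c.
Proof.
apply: funext => w; rewrite /ssum big_ord_recr /=.
by rewrite [RHS]/(_ + c (size w + 0)%N w) addn0.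
Qed.

Lemma ssum2E (c : nat -> A2) : ssum2 c = csum c.
Proof.
apply: funext => u; apply: funext => v; rewrite /ssum2 -addnS big_split_ord big_ord_recr /=.
transitivity ((\sum_(k < size u) c k u : A) v + csum (fun k => c (size u + k)%N u : A) v).
  rewrite ncs_sumE; congr (_ + _).
  by rewrite [RHS]/(_ + c (size u + (size v + 0))%N u v) addn0.
by [].
Qed.

Definition ahom (R : complAlgType K) (f : A -> R) :=
  [/\ flin f, f 1 = 1 & forall a b, f (a * b) = f a * f b].

Lemma ahom_hsubst (R : complAlgType K) (y : 'I_2 -> R) :
  (forall i, fil 1 (y i)) -> ahom (hsubst y).
Proof. by move=> h; split; [apply: flin_hsubst | apply: hsubst1 | apply: hsubstM]. Qed.

Lemma ahom_eq f g a : ahom f -> ahom g -> (forall i, f (gen K i) = g (gen K i)) -> f a = g a.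
Proof.
move=> [hf f1 fM] [hg g1 gM] e.
apply: (A_ind (closed_sub_eq (@A_sep K) (flin_clin hf) (flin_clin hg))) a => [|i a ea].
  by rewrite f1 g1.
by rewrite fM gM e ea.
Qed.

Lemma ahom_comp f g : ahom f -> ahom g -> ahom (fun a => f (g a)).
Proof.
move=> [hf f1 fM] [hg g1 gM]; split=> [||a b]; first exact: flin_comp.
  by rewrite g1 f1.
by rewrite gM fM.
Qed.

Lemma ahom_id : ahom (fun a => a). Proof. by split=> //; apply: flin_id. Qed.

Definition tmap2 f t := tmapl f (tmapr f t).

Lemma flin_tmap2 f : flin f -> flin (tmap2 f).
Proof. by move=> hf; rewrite /tmap2; flin. Qed.

Lemma tmap2_tens f a b : flin f -> tmap2 f (tens a b) = tens (f a) (f b).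
Proof. by move=> hf; rewrite /tmap2 tmapr_tens // tmapl_tens. Qed.

Lemma tmap2M f s t : ahom f -> tmap2 f (s * t) = tmap2 f s * tmap2 f t.
Proof.
move=> [hf _ fM]; have hf2 := flin_tmap2 hf.
move: s; apply: (A2_eq (@A2_sep K)) => [||a b]; [clin | clin |].
move: t; apply: (A2_eq (@A2_sep K)) => [||c d]; [clin | clin |].
by rewrite tens_mul !tmap2_tens // tens_mul !fM.
Qed.

Lemma tmap2_omul f s t : ahom f -> tmap2 f (s ** t) = tmap2 f s ** tmap2 f t.
Proof.
move=> [hf _ fM]; have hf2 := flin_tmap2 hf.
move: s; apply: (A2_eq (@A2_sep K)) => [||a b]; [clin | clin |].
move: t; apply: (A2_eq (@A2_sep K)) => [||c d]; [clin | clin |].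
by rewrite omul_tens !tmap2_tens // omul_tens !fM.
Qed.

Lemma tmap2K f g t : flin f -> flin g -> cancel f g -> tmap2 g (tmap2 f t) = t.
Proof.
move=> hf hg fK; have hf2 := flin_tmap2 hf; have hg2 := flin_tmap2 hg.
move: t; apply: (A2_eq (@A2_sep K)) => [||a b]; [clin | clin |].
by rewrite !tmap2_tens // !fK.
Qed.

Lemma tmap2_tdif f a : ahom f -> tmap2 f (tdif a) = tdif (f a).
Proof.
by move=> [hf f1 _]; rewrite !tdifE (linB (flin_tmap2 hf).1) !tmap2_tens // f1.
Qed.

Section Unipotent.
Variable f : A -> A.
Hypotheses (hf : flin f) (rf : raising (fun b => b - f b)).
Let n b := b - f b.

Let hn : flin n. Proof. by rewrite /n; flin. Qed.

(** The Neumann series for the inverse of f. It serves for automorphisms and, with f a left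
    multiplication, for [sinv]. *)
Definition uinv a := csum (fun k => iter k n a).

Lemma uinv_sum a : is_sum (fun k => iter k n a) (uinv a).
Proof.
apply: csumP => k; have := raising_iter k rf (filA_0 a); by rewrite addn0.
Qed.

Lemma uinvK a : f (uinv a) = a.
Proof.
apply: (@is_sum_uniq _ _ (fun k => f (iter k n a))); first exact: A_sep.
  exact: is_sum_flin (uinv_sum a).
move=> N; have -> : \sum_(k < N) f (iter k n a) = a - iter N n a.
  elim: N => [|N IH]; first by rewrite big_ord0 subrr.
  by rewrite big_ord_recr IH /= /n opprB -addrA [- _ + _]addrC.
rewrite opprB addrCA subrr addr0.
by have := raising_iter N rf (filA_0 a); rewrite addn0.
Qed.

Lemma unipotent_inj : injective f.
Proof.
move=> a b e; apply/eqP; rewrite -subr_eq0; apply/eqP/(@A_sep K) => N.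
have nab : a - b = n (a - b) by rewrite /n (linB hf.1) e subrr subr0.
have -> : a - b = iter N n (a - b) by elim: N => //= N <-.
by have := raising_iter N rf (filA_0 (a - b)); rewrite addn0.
Qed.

Lemma uinvK' a : uinv (f a) = a.
Proof. by apply: unipotent_inj; rewrite uinvK. Qed.

Lemma flin_uinv : flin uinv.
Proof.
split=> [c a b|N a h].
  by apply: unipotent_inj; rewrite hf.1 !uinvK.
apply: is_sum_fil (uinv_sum a) _ => k; apply: filW (raising_iter k rf h); exact: leq_addl.
Qed.

Lemma ahom_uinv : ahom f -> ahom uinv.
Proof.
move=> [_ f1 fM]; split=> [||a b]; first exact: flin_uinv.
  by rewrite -[in LHS]f1 uinvK'.
by apply: unipotent_inj; rewrite fM !uinvK.
Qed.

End Unipotent.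

(** Telescoping on the first letter x: xb - f(x)f(b) = (x - f(x))b + f(x)(b - f(b)), and each
    summand gains a degree. *)
Lemma ahom_unipotent f : ahom f -> (forall i, fil 2 (gen K i - f (gen K i))) ->
  raising (fun b => b - f b).
Proof.
move=> [hf f1 fM] h; elim=> [|N IH] b hb; rewrite [b]A_decomp.
all: rewrite (linD hf.1) (linZ hf.1) (lin_sum hf.1) f1 opprD addrACA subrr add0r -sumrB.
all: apply: fil_sum => i _; rewrite fM -[X in X - _](subrK (f (gen K i) * ncs_shift i b)).
all: rewrite -mulrBl -addrA -mulrBr; apply: filD.
- by apply: filW (filAM (h i) (filA_0 _)).
- rewrite -[1%N]addn0; apply: filAM (filA_0 _).
  by rewrite -[f _](subKr (gen K i)); apply: filB (fil_gen K i) (filW _ (h i)).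
- by have := filAM (h i) (fil_shift i hb).
- rewrite -addn1 addnC; apply: filAM (IH _ (fil_shift i hb)).
  by rewrite -[f _](subKr (gen K i)); apply: filB (fil_gen K i) (filW _ (h i)).
Qed.

Lemma fil_sub1 a : a [::] = 1 -> fil 1 (1 - a).
Proof. by move=> e; apply/filA => -[|//] _; rewrite ncsDE ncsNE e subrr. Qed.

Section SeriesInverse.
Variable a : A.
Hypothesis a1 : a [::] = 1.

Let raising_a : raising (fun b => b - a * b).
Proof.
move=> N b h; rewrite -{1}[b]mul1r -mulrBl -add1n; apply: filAM h; exact: fil_sub1.
Qed.

Lemma sinvE : sinv a = uinv (fun b => a * b) 1.
Proof.
rewrite /sinv ssumE /uinv; congr csum; apply: funext => k.
by elim: k => [|k IH] //=; rewrite exprS -IH mulrBl mul1r.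
Qed.

Lemma mul_sinvr : a * sinv a = 1.
Proof. by rewrite sinvE (uinvK (flin_mullA a)). Qed.

Lemma mul_sinvl : sinv a * a = 1.
Proof.
by apply: (unipotent_inj (flin_mullA a)) => //; rewrite mulrA mul_sinvr mul1r mulr1.
Qed.

Lemma sinv_nil : sinv a [::] = 1.
Proof. by have /(congr1 (fun b : A => b [::])) := mul_sinvr; rewrite ncs_nilE a1 mul1r. Qed.

End SeriesInverse.

(** The antipode, that is, the anti-automorphism with x_i -> -x_i. *)
Definition spode a : A := fun w => (-1) ^+ size w * a (rev w).

Lemma flin_spode : flin spode.
Proof.
split=> [c a b|N a /filA h]; last first.
  by apply/filA => w l; rewrite /spode h ?mulr0 // size_rev.
by apply: funext => w; rewrite ncsDE ncsZE /spode ncsDE ncsZE mulrDr -scalerAr.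
Qed.

Lemma spode1 : spode 1 = 1.
Proof. by apply: funext => -[|i w]; rewrite /spode ncs1E ?mulr1 // rev_cons -size_eq0 size_rcons mulr0. Qed.

Lemma spode_gen i : spode (gen K i) = - gen K i.
Proof.
apply: funext => w; rewrite ncsNE /spode /gen -[[:: i]]/(rev [:: i]) (inj_eq (can_inj revK)).
by case: eqP => [->|_]; rewrite ?mulr0 ?oppr0 // mulr1.
Qed.

Lemma spodeM a b : spode (a * b) = spode b * spode a.
Proof.
apply: funext => w; rewrite /spode !ncsME size_rev mulr_sumr (reindex_inj rev_ord_inj).
apply: eq_bigr => k _ /=; have le : (k <= size w)%N by rewrite -ltnS.
rewrite subSS take_rev drop_rev subKn // size_takel // size_drop.
rewrite mulrACA -exprD subnKC //; congr (_ * _); exact: mulrC.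
Qed.

Lemma tmapr_spodeM s t : tmapr spode (s * t) = tmapr spode s ** tmapr spode t.
Proof.
have hS := flin_spode.
move: s; apply: (A2_eq (@A2_sep K)) => [||a b]; [clin | clin |].
move: t; apply: (A2_eq (@A2_sep K)) => [||c d]; [clin | clin |].
by rewrite tens_mul !tmapr_tens // omul_tens spodeM.
Qed.

Definition cop_gen i : A2 := tens (gen K i) 1 + tens 1 (gen K i).

Lemma fil_cop_gen i : fil 1 (cop_gen i).
Proof.
apply: filD; first by have := fil_tens (fil_gen K i) (filA_0 1); rewrite addn0.
by have := fil_tens (filA_0 1) (fil_gen K i).
Qed.

Lemma coprodE a : coprod a = hsubst cop_gen a.
Proof. exact: ssum2E. Qed.

Lemma flin_coprod : flin (@coprod K).
Proof.
have [lh fh] := flin_hsubst fil_cop_gen.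
by split=> [c a b|N a h]; rewrite !coprodE; [apply: lh | apply: fh].
Qed.
Lemma coprod1 : coprod (1 : A) = 1.
Proof. by rewrite coprodE (hsubst1 fil_cop_gen). Qed.
Lemma coprodM a b : coprod (a * b) = coprod a * coprod b.
Proof. by rewrite !coprodE (hsubstM fil_cop_gen). Qed.
Lemma coprod_gen i : coprod (gen K i) = tens (gen K i) 1 + tens 1 (gen K i).
Proof. by rewrite coprodE (hsubst_gen fil_cop_gen). Qed.

Lemma coprod_eq (f g : A -> A2) a : flin f -> flin g -> f 1 = g 1 ->
  (forall i b, f b = g b -> f (gen K i * b) = g (gen K i * b)) -> f a = g a.
Proof.
move=> hf hg e1 eg.
exact: (A_ind (closed_sub_eq (@A2_sep K) (flin_clin hf) (flin_clin hg)) e1 eg).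
Qed.

(** The map called Dt in the overview. The antipode reverses products in the second factor, so Dt is
    multiplicative for [**]. *)
Definition tcop a := tmapr spode (coprod a).

Lemma flin_tcop : flin tcop.
Proof. by rewrite /tcop; have h := flin_coprod; have h' := flin_spode; flin. Qed.
Lemma tcop1 : tcop 1 = 1.
Proof. by rewrite /tcop coprod1 -tens11 tmapr_tens ?spode1 //; apply: flin_spode. Qed.
Lemma tcopM a b : tcop (a * b) = tcop a ** tcop b.
Proof. by rewrite /tcop coprodM tmapr_spodeM. Qed.
Lemma tcop_gen i : tcop (gen K i) = tdif (gen K i).
Proof.
have hS := flin_spode; rewrite /tcop coprod_gen (linD (flin_tmapr hS).1) !tmapr_tens //.
by rewrite spode1 spode_gen (linN (flin_tensr 1).1) tdifE.
Qed.

Lemma tmult_tdif_omul a t : tmult (tdif a ** t) = a * tmult t - tmult t * a.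
Proof.
rewrite -sand1 sand_omul sand1 tdifE /sand mulrBl (linB (flin_tmult K).1).
by rewrite !tens_mul !tmult_tens !mulr1 mul1r.
Qed.

(** The antipode axiom. On primitive and on group-like elements it gives the value of the
    antipode. *)
Lemma tmult_tcop a : tmult (tcop a) = a [::] *: 1.
Proof.
have ct : clin (fun a : A => a [::] *: (1 : A)).
  apply: flin_clin; split=> [k b c|N b /filA h].
    by rewrite ncsDE ncsZE scalerDl scalerA.
  case: N h => [|N] h; first exact: filA_0.
  by rewrite h // scale0r; apply: fil0.
have cf : clin (fun a => tmult (tcop a)) by have h := flin_tcop; clin.
apply: (A_ind (closed_sub_eq (@A_sep K) cf ct)) a => [|i a IH].
- by rewrite tcop1 tmult1 scale1r.
- rewrite tcopM tcop_gen tmult_tdif_omul IH -scalerAl -scalerAr mul1r mulr1 subrr.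
  by rewrite ncs_nilE mul0r scale0r.
Qed.

Lemma primitive_nil a : primitive a -> a [::] = 0.
Proof.
move=> h; have: coprod a [::] [::] = a [::].
  by rewrite /coprod /ssum2 big_ord1 hom_subst0; apply: mulr1.
rewrite h [LHS](_ : _ = a [::] * 1 + 1 * a [::]) // mulr1 mul1r => /eqP.
by rewrite eq_sym -subr_eq subrr eq_sym => /eqP.
Qed.

Lemma fil_primitive a : primitive a -> fil 1 a.
Proof. by move=> h; apply/filA => -[|//] _; apply: primitive_nil. Qed.

Lemma spode_primitive a : primitive a -> spode a = - a.
Proof.
move=> h; have := tmult_tcop a; rewrite primitive_nil // scale0r /tcop h.
have hS := flin_spode.
rewrite (linD (flin_tmapr hS).1) !tmapr_tens // spode1 (linD (flin_tmult K).1) !tmult_tens.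
by rewrite mulr1 mul1r => /eqP; rewrite addrC addr_eq0 => /eqP.
Qed.

Lemma tcop_primitive a : primitive a -> tcop a = tdif a.
Proof.
move=> h; have hS := flin_spode; rewrite /tcop h (linD (flin_tmapr hS).1) !tmapr_tens //.
by rewrite spode1 spode_primitive // (linN (flin_tensr 1).1) tdifE.
Qed.

Definition grouplike a := coprod a = tens a a /\ a [::] = 1.

Lemma grouplike_spode a : grouplike a -> spode a = sinv a.
Proof.
move=> [h a1]; have := tmult_tcop a; rewrite /tcop h tmapr_tens ?tmult_tens; last exact: flin_spode.
rewrite a1 scale1r => e.
by rewrite -[spode a]mul1r -(mul_sinvl a1) -mulrA e mulr1.
Qed.

Lemma tcop_grouplike a : grouplike a -> tcop a = tens a (sinv a).
Proof.
move=> h; rewrite /tcop h.1 tmapr_tens; last exact: flin_spode.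
by rewrite grouplike_spode.
Qed.

Lemma grouplike1 : grouplike 1.
Proof. by split; [rewrite coprod1 tens11 | rewrite ncs1E]. Qed.
Lemma grouplikeM a b : grouplike a -> grouplike b -> grouplike (a * b).
Proof.
move=> [ha a1] [hb b1]; split; first by rewrite coprodM ha hb tens_mul.
by rewrite ncs_nilE a1 b1 mulr1.
Qed.
Lemma grouplikeV a : grouplike a -> grouplike (sinv a).
Proof.
move=> [ha a1]; split; last exact: sinv_nil.
have e : tens (sinv a) (sinv a) * tens a a = 1 :> A2.
  by rewrite tens_mul mul_sinvl // tens11.
rewrite -[LHS]mul1r -e -mulrA -ha -coprodM mul_sinvr // coprod1 mulr1.
by [].
Qed.

Lemma coprod_ahom f : ahom f -> (forall i, primitive (f (gen K i))) ->
  forall a, coprod (f a) = tmap2 f (coprod a).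
Proof.
move=> hf pf a; have [lf f1 fM] := hf; have hc := flin_coprod; have h2 := flin_tmap2 lf.
apply: (@coprod_eq (fun a => coprod (f a)) (fun a => tmap2 f (coprod a))) => [|||i b e].
- by flin.
- by flin.
- by rewrite f1 coprod1 -tens11 tmap2_tens // f1.
rewrite fM !coprodM e tmap2M // coprod_gen; congr (_ * _).
by rewrite (pf i) (linD h2.1) !tmap2_tens // f1.
Qed.

Lemma primitive_conj (g p : A) : grouplike g -> primitive p -> primitive (sinv g * p * g).
Proof.
move=> hg hp; have [_ g1] := hg; rewrite /primitive !coprodM (grouplikeV hg).1 hg.1 hp.
by rewrite mulrDr mulrDl !tens_mul !mulr1 mul_sinvl.
Qed.

Lemma primitive_gen i : primitive (gen K i).
Proof. exact: coprod_gen. Qed.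

End Homs.

(** * Exponentials of raising operators *)

Section Exponential.
Variable K : fieldType.
Hypothesis charK0 : [pchar K] =i pred0.

Lemma natS_neq0 n : n.+1%:R != 0 :> K.
Proof. by rewrite ((GRing.pcharf0P K).1 charK0). Qed.

Lemma fact_neq0 n : n`!%:R != 0 :> K.
Proof. by rewrite ((GRing.pcharf0P K).1 charK0) -lt0n fact_gt0. Qed.

Lemma scale_natS_inj (V : lmodType K) n : injective (fun v : V => n.+1%:R *: v).
Proof. by move=> u v /(congr1 (fun x => n.+1%:R^-1 *: x)); rewrite !scalerK ?natS_neq0. Qed.

Lemma factS_inv n : n.+1%:R * (n.+1)`!%:R^-1 = n`!%:R^-1 :> K.
Proof. by rewrite factS natrM invfM mulrA divff ?mul1r // natS_neq0. Qed.

(** A formal substitute for d/dt: n + 1 = m + (n + 1 - m) distributes along the antidiagonal as the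
    product rule does. Identities of exponential series are proved in this form, and
    [scale_natS_inj] removes the factor. *)
Lemma antidiagonalS (V : lmodType K) (f : nat -> nat -> V) n :
  n.+1%:R *: (\sum_(m < n.+2) f m (n.+1 - m)%N) =
  \sum_(m < n.+1) (m.+1%:R *: f m.+1 (n - m)%N + (n - m).+1%:R *: f m (n - m).+1).
Proof.
transitivity (\sum_(m < n.+2) (m%:R *: f m (n.+1 - m)%N +
    (n.+1 - m)%:R *: f m (n.+1 - m)%N)).
  rewrite scaler_sumr; apply: eq_bigr => m _.
  by rewrite -scalerDl -natrD subnKC // -ltnS.
rewrite big_split [RHS]big_split /=; congr (_ + _).
  by rewrite big_ord_recl /= scale0r add0r.
rewrite big_ord_recr /= subnn scale0r addr0; apply: eq_bigr => m _.
by rewrite subSn // -ltnS.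
Qed.

Section Dpow.
Variables (V : complModType K) (L : V -> V).
Hypothesis hL : flin L.

Definition dpow n b : V := (n`!%:R)^-1 *: iter n L b.

Lemma dpow0 b : dpow 0 b = b.
Proof. by rewrite /dpow invr1 scale1r. Qed.

Lemma dpowS n b : n.+1%:R *: dpow n.+1 b = L (dpow n b).
Proof. by rewrite /dpow scalerA factS_inv (linZ hL.1). Qed.

Lemma flin_dpow n : flin (dpow n).
Proof. exact/flin_scale/flin_iter. Qed.

Lemma dpow_comm n b : L (dpow n b) = dpow n (L b).
Proof. by rewrite /dpow -iterSr (linZ hL.1). Qed.

(* The degree n part of exp(L) applied to the series \sum_b e b / b! *)
Definition exp_conv (e : nat -> V) n := \sum_(b < n.+1) dpow (n - b) ((b`!%:R)^-1 *: e b).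

(** Coefficientwise derivative of exp(tL) e(t), where e(t) = sum of t^b e_b / b!; passing to e'(t)
    shifts the index of e. *)
Lemma exp_convS e n :
  n.+1%:R *: exp_conv e n.+1 = L (exp_conv e n) + exp_conv (fun b => e b.+1) n.
Proof.
rewrite /exp_conv (antidiagonalS (fun b m => dpow m ((b`!%:R)^-1 *: e b))).
rewrite big_split addrC (lin_sum hL.1); congr (_ + _); apply: eq_bigr => b _ /=.
  by rewrite -(linZ (flin_dpow _).1) scalerA factS_inv.
by rewrite dpowS.
Qed.

Hypothesis rL : raising L.

Lemma fil_dpow N n b : fil N b -> fil (n + N) (dpow n b).
Proof. by move=> h; apply: filZ; apply: raising_iter. Qed.

Definition expo b := csum (fun n => dpow n b).

Lemma expo_sum b : is_sum (fun n => dpow n b) (expo b).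
Proof.
by apply: csumP => k; rewrite -[k in fil k _]addn0; apply/fil_dpow/fil_0.
Qed.

Lemma flin_expo : flin expo.
Proof.
split=> [c a b|N b h].
  apply: is_sum_uniq (expo_sum _) _; first exact: compl_sep.
  have := is_sumD (is_sum_flin (flin_scale c (flin_id _)) (expo_sum a)) (expo_sum b).
  by apply: eq_is_sum => k; rewrite (flin_dpow k).1.
by apply: is_sum_fil (expo_sum b) _ => k; apply: filW (fil_dpow k h); apply: leq_addl.
Qed.

Lemma exp_conv_sum e s : (forall b, fil b (e b)) ->
  is_sum (fun b => (b`!%:R)^-1 *: e b) s -> is_sum (exp_conv e) (expo s).
Proof.
move=> he hs; apply: (is_sum_double (c := fun b => expo ((b`!%:R)^-1 *: e b))
  (d := fun b n => dpow n ((b`!%:R)^-1 *: e b))) => [|b|b n].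
- exact: is_sum_flin flin_expo hs.
- exact: expo_sum.
- by rewrite addnC; apply/fil_dpow/filZ.
Qed.

Lemma expo_fil N b : fil N b -> fil N.+1 (expo b - b).
Proof.
move=> h; have s := expo_sum b.
have e : is_sum (fun n => if n is 0 then 0 else dpow n b) (expo b - b).
  case=> [|M]; first exact: fil_0.
  have := s M.+1; rewrite !big_ord_recl dpow0 add0r opprD addrA.
  exact.
apply: is_sum_fil e _ => -[|n]; first exact: fil0.
by apply: filW (fil_dpow _ h); rewrite addSn ltnS leq_addl.
Qed.

End Dpow.

Lemma dpow_scale (V : complModType K) (L : V -> V) c n b : flin L ->
  dpow (fun v => c *: L v) n b = c ^+ n *: dpow L n b.
Proof.
move=> hL; rewrite /dpow scalerA mulrC -scalerA; congr (_ *: _).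
elim: n => [|n IH] /=; first by rewrite scale1r.
by rewrite IH (linZ hL.1) scalerA exprS.
Qed.

Lemma flin_cscale (V : filtModType K) (L : V -> V) c : flin L -> flin (fun v => c *: L v).
Proof. exact: flin_scale. Qed.

Lemma raising_scale (V : filtModType K) (L : V -> V) c : raising L ->
  raising (fun v => c *: L v).
Proof. by move=> h N v hv; apply/filZ/h. Qed.

Lemma expo_add (V : complModType K) (L : V -> V) s t b : flin L -> raising L ->
  expo (fun v => s *: L v) (expo (fun v => t *: L v) b) = expo (fun v => (s + t) *: L v) b.
Proof.
move=> hL rL; have hs c := flin_cscale c hL; have rs c := raising_scale c rL.
apply: is_sum_uniq (expo_sum (rs _) _); first exact: compl_sep.
have := exp_conv_sum (hs s) (rs s) (e := fun n => iter n (fun v => t *: L v) b) _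
  (expo_sum (rs t) b).
have F n : fil n (iter n (fun v => t *: L v) b).
  by rewrite -[n in fil n _]addn0; apply: raising_iter (rs t) (fil_0 b).
move/(_ F); apply: eq_is_sum => n; elim: n b {F} => [|n IH] b.
  by rewrite /exp_conv big_ord1 !dpow0 invr1 scale1r.
apply: (@scale_natS_inj _ n); rewrite exp_convS ?dpowS //.
rewrite IH (_ : (fun _ => _) = fun m => iter m (fun v => t *: L v) (t *: L b)); last first.
  by apply: funext => m; rewrite iterSr.
rewrite IH !dpow_scale // (linZ (flin_dpow hL n).1) -dpow_comm // !(linZ hL.1) !scalerA.
by rewrite -scalerDl; congr (_ *: _); ring.
Qed.

Section Leibniz.
Variables (U V W : complModType K) (B : U -> V -> W).
Variables (L1 : U -> U) (L2 : V -> V) (L : W -> W).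
Hypotheses (Bl : forall v, linear (B^~ v)) (Br : forall u, linear (B u)).
Hypothesis (Bfil : forall M N u v, fil M u -> fil N v -> fil (M + N) (B u v)).
Hypotheses (h1 : flin L1) (h2 : flin L2) (h : flin L).
Hypothesis leibniz : forall u v, L (B u v) = B (L1 u) v + B u (L2 v).

Lemma dpow_leibniz n u v :
  dpow L n (B u v) = \sum_(m < n.+1) B (dpow L1 m u) (dpow L2 (n - m) v).
Proof.
elim: n => [|n IH]; first by rewrite big_ord1 !dpow0.
apply: (@scale_natS_inj _ n); rewrite dpowS // IH (lin_sum h.1).
rewrite (antidiagonalS (fun m k => B (dpow L1 m u) (dpow L2 k v))).
apply: eq_bigr => m _; rewrite leibniz -!dpowS //; congr (_ + _).
  by rewrite (linZ (Bl _)).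
by rewrite (linZ (Br _)).
Qed.

Hypotheses (r1 : raising L1) (r2 : raising L2) (r : raising L).

Lemma expo_leibniz u v : expo L (B u v) = B (expo L1 u) (expo L2 v).
Proof.
apply: is_sum_uniq (expo_sum r _) _; first exact: compl_sep.
have fl w : flin (B^~ w) by split=> // N x hx; have := Bfil hx (fil_0 w); rewrite addn0.
have fr w : flin (B w) by split=> // N x hx; exact: (Bfil (fil_0 w) hx).
have := @is_sum_double _ _ (fun n => B (dpow L1 n u) (expo L2 v))
  (fun n m => B (dpow L1 n u) (dpow L2 m v)) (B (expo L1 u) (expo L2 v)).
have e : (fun p => \sum_(n < p.+1) B (dpow L1 n u) (dpow L2 (p - n) v)) =
    (fun n => dpow L n (B u v)).
  by apply: funext => p; rewrite dpow_leibniz.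
rewrite e; apply=> [|n|n m].
- exact: is_sum_flin (fl _) (expo_sum r1 u).
- exact: is_sum_flin (fr _) (expo_sum r2 v).
- apply: Bfil; first by rewrite -[n in fil n _]addn0; exact: (fil_dpow r1 n (fil_0 u)).
  by rewrite -[m in fil m _]addn0; exact: (fil_dpow r2 m (fil_0 v)).
Qed.
End Leibniz.

(** By telescoping, the difference of the powers of exponent k + 1 of L and L' gains k + m degrees;
    only the linear term k = 0 can reach degree m. *)
Lemma expo_approx (V : complModType K) (L L' : V -> V) m b : (0 < m)%N ->
  flin L -> flin L' -> raising L -> raising L' ->
  (forall N v, fil N v -> fil (N + m) (L v - L' v)) ->
  fil m.+1 (expo L b - expo L' b - (L b - L' b)).
Proof.
move=> m0 hL hL' rL rL' d.
have D k : fil (k + m) (iter k.+1 L b - iter k.+1 L' b).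
  elim: k => [|k IH] /=; first exact: d (fil_0 b).
  rewrite -[L _](subrK (L (iter k.+1 L' b))) -addrA -(linB hL.1); apply: filD; first exact: rL.
  by have := d _ _ (raising_iter k.+1 rL' (fil_0 b)); rewrite addn0.
have S : is_sum (fun n => dpow L n b - dpow L' n b) (expo L b - expo L' b).
  have := is_sumD (expo_sum rL b) (is_sum_flin (flin_opp (flin_id _)) (expo_sum rL' b)).
  exact.
have T : is_sum (fun n => if n is k.+2 then dpow L n b - dpow L' n b else 0)
    (expo L b - expo L' b - (L b - L' b)).
  case=> [|[|N]]; [exact: fil_0| |].
    rewrite big_ord1 subr0; apply: filB; last by apply: filW (d 0%N b (fil_0 b)); rewrite add0n.
    by have := S 1%N; rewrite big_ord1 !dpow0 subrr subr0.
  have := S N.+2; rewrite !big_ord_recl !dpow0 subrr !add0r /dpow /= invr1 !scale1r.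
  by rewrite opprD addrA.
apply: is_sum_fil T _ => -[|[|k]]; try exact: fil0.
rewrite /dpow -scalerBr; apply: filZ; apply: filW (D k.+1); by rewrite addSn ltnS leq_addl.
Qed.

End Exponential.

Ltac abel2 := apply: funext => ?; apply: funext => ?; rewrite !(ncsDE, ncsNE); ring.

Section TangentialAutomorphisms.
Variable K : fieldType.
Notation A := 'A[K].
Notation A2 := 'A2[K].
Implicit Types (a b c d p : A) (s t : A2) (i : 'I_2) (v : A -> A) (w u F G : 'I_2 -> A).

Lemma filA1 a : fil 1 a <-> a [::] = 0.
Proof.
split=> [/filA h|h]; first exact: h.
by apply/filA => -[].
Qed.

Lemma raising_deriv_of (y : 'I_2 -> A) m :
  (forall i, fil m.+1 (y i)) -> forall N a, fil N a -> fil (N + m) (deriv_of y a).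
Proof.
move=> h N a ha; apply: fil_sum => i _; apply: (flin_tmult K).2.
case: N ha => [|N] ha.
  by have := filA2M (filA2_0 (pder i a)) (fil_tens (h i) (filA_0 1)); rewrite add0n addn0; apply: filA2W.
by rewrite addSnnS -[m.+1]addn0; apply: filA2M (fil_pder i ha) (fil_tens (h i) (filA_0 1)).
Qed.

Lemma raising_rho w m : (forall i, fil m (w i)) ->
  forall N a, fil N a -> fil (N + m) (rho w a).
Proof. by move=> h; apply: raising_deriv_of => i; apply: fil_bracket_gen. Qed.

Lemma raising_rho1 w : (forall i, fil 1 (w i)) -> raising (rho w).
Proof. by move=> h N a ha; rewrite -addn1; apply: raising_rho. Qed.

Lemma rho_linear k u u' a : rho (fun i => k *: u i + u' i) a = k *: rho u a + rho u' a.
Proof.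
apply: (@deriv_eq _ (rho _) (fun a => k *: rho u a + rho u' a)).
- exact/flin_clin/flin_rho.
- by have h := flin_rho u; have h' := flin_rho u'; clin.
- exact: deriv_rho.
- move=> b c; rewrite !deriv_rho !scalerDr mulrDl mulrDr scalerAl scalerAr addrACA.
  by [].
by move=> i; rewrite !rho_gen mulrDl mulrDr -scalerAl -scalerAr scalerBr opprD addrACA.
Qed.

Lemma rhoZ k u a : rho (fun i => k *: u i) a = k *: rho u a.
Proof.
have := rho_linear k u (fun=> 0) a.
have -> : rho (fun=> 0) a = 0 :> A.
  apply: (@deriv_eq _ _ (fun=> 0)) => [||||i]; first exact/flin_clin/flin_rho.
  - exact: clin0.
  - exact: deriv_rho.
  - by move=> b c; rewrite mul0r mulr0 addr0.
  - by rewrite rho_gen mul0r mulr0 subrr.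
by under eq_fun do rewrite addr0; rewrite addr0.
Qed.

Lemma rhoB u u' a : rho (fun i => u i - u' i) a = rho u a - rho u' a.
Proof.
have := rho_linear (-1) u' u a; rewrite scaleN1r addrC => <-.
by congr (rho _ a); apply: funext => i; rewrite scaleN1r addrC.
Qed.

(** With a = w_i and v = rho(w), the exponential of this operator applied to 1 is the i-th component
    of exp(w) in TAut; with v = 0 it is the ordinary exponential of a. *)
Definition twist a v b : A := a * b + v b.

Lemma flin_twist a v : flin v -> flin (twist a v).
Proof. by move=> h; rewrite /twist; flin. Qed.

Lemma raising_twist a v : fil 1 a -> raising v -> raising (twist a v).
Proof. by move=> h rv N b hb; apply: filD; [rewrite -add1n; apply: filAM | apply: rv]. Qed.

Lemma twist_mul a v b c : derivation v -> twist a v (b * c) = twist a v b * c + b * v c.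
Proof. by move=> dv; rewrite /twist dv mulrDl mulrA addrA. Qed.

Lemma tmapl_twist a v t : flin v -> tmapl (twist a v) t = tens a 1 * t + tmapl v t.
Proof.
move=> hv; have h := flin_twist a hv.
move: t; apply: (A2_eq (@A2_sep K)) => [||b c]; [clin | clin |].
by rewrite !tmapl_tens // tens_mul mul1r tensDl.
Qed.

Lemma tmapr_twist a v t : flin v -> tmapr (twist a v) t = tens 1 a * t + tmapr v t.
Proof.
move=> hv; have h := flin_twist a hv.
move: t; apply: (A2_eq (@A2_sep K)) => [||b c]; [clin | clin |].
by rewrite !tmapr_tens // tens_mul mul1r tensDr.
Qed.

Lemma raising_tmapr v : raising v -> raising (tmapr v).
Proof.
move=> rv N t h u; apply/filA => x l.
have /filA := rv _ _ (h u); apply; lia.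
Qed.

Lemma raising_tswap (f : A2 -> A2) : raising f -> raising (fun t => tswap (f (tswap t))).
Proof. by move=> rf N t h; apply/(flin_tswap K).2/rf/(flin_tswap K).2. Qed.

Lemma raising_tder2 v : raising v -> raising (tder2 v).
Proof.
move=> rv N t h; apply: filD; last exact: raising_tmapr rv _ _ h.
exact: (raising_tswap (raising_tmapr rv)) h.
Qed.

Hypothesis charK0 : [pchar K] =i pred0.

Lemma expo_mul L v b c : flin L -> raising L -> flin v -> raising v ->
  (forall b c, L (b * c) = L b * c + b * v c) ->
  expo L (b * c) = expo L b * expo v c.
Proof.
move=> hL rL hv rv e; apply: (expo_leibniz charK0 (B := fun b c : A => b * c)) => //.
- by move=> d; case: (flin_mulrA d).
- by move=> d; case: (flin_mullA d).
- by move=> M N x y; apply: filAM.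
Qed.

Lemma expo_tens v b c : flin v -> raising v ->
  expo (tder2 v) (tens b c) = tens (expo v b) (expo v c).
Proof.
move=> hv rv; apply: (expo_leibniz charK0 (B := @tens K)) => //.
- by move=> d; case: (flin_tensl d).
- by move=> d; case: (flin_tensr d).
- by move=> M N x y; apply: fil_tens.
- exact: flin_tder2.
- by move=> x y; rewrite tder2_tens.
- exact: raising_tder2.
Qed.

Lemma expo1_nil L : raising L -> (expo L 1 : A) [::] = 1.
Proof.
move=> rL; have /filA1 := expo_fil rL (filA_0 1).
by rewrite ncsDE ncsNE ncs1E => /eqP; rewrite subr_eq0 => /eqP.
Qed.

Definition coderiv v := forall b, coprod (v b) = tder2 v (coprod b).

(** As a is primitive and v a coderivation, the coproduct intertwines [twist a v] with its extension
    [tder2] to A (x) A, hence also the exponentials. *)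
Lemma grouplike_expo a v : primitive a -> flin v -> raising v -> coderiv v ->
  grouplike (expo (twist a v) 1).
Proof.
move=> pa hv rv cv; have ht := flin_twist a hv.
have rt := raising_twist (fil_primitive pa) rv; split; last exact: expo1_nil.
rewrite -expo_tens //.
have e b : coprod (twist a v b) = tder2 (twist a v) (coprod b).
  rewrite (linD (flin_coprod K).1) coprodM cv pa mulrDl /tder2 tmapl_twist // tmapr_twist //.
  by rewrite addrACA.
have r2 := raising_tder2 rt; apply: is_sum_uniq (expo_sum r2 _); first exact: A2_sep.
apply: eq_is_sum (is_sum_flin (flin_coprod K) (expo_sum rt 1)) => n.
rewrite /dpow (linZ (flin_coprod K).1); congr (_ *: _).
by elim: n => [|n IH] /=; [rewrite tens11 coprod1 | rewrite e IH].
Qed.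

Lemma coderiv0 : coderiv (fun=> 0).
Proof.
move=> b; rewrite (lin0 (flin_coprod K).1) /tder2 /tmapl /tmapr.
by apply: funext => u; rewrite ncsDE /tswap; apply: funext => w; rewrite ncsDE addr0.
Qed.

Lemma primitive_bracket p q : primitive p -> primitive q -> primitive (p * q - q * p).
Proof.
move=> hp hq; rewrite /primitive (linB (flin_coprod K).1) !coprodM hp hq.
rewrite !mulrDl !mulrDr !tens_mul !mulr1 !mul1r tensBl tensBr.
by abel2.
Qed.

Lemma coderiv_rho w : (forall i, primitive (w i)) -> coderiv (rho w).
Proof.
move=> pw b; have hr := flin_rho w; have hc := flin_coprod K; have h2 := flin_tder2 hr.
apply: (@coprod_eq _ (fun b => coprod (rho w b)) (fun b => tder2 (rho w) (coprod b))).
- by flin.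
- by flin.
- by rewrite deriv1 ?coprod1 -?tens11 ?tder2_tens ?deriv1 ?(lin0 hc.1) ?(lin0 (flin_tensl _).1) ?(lin0 (flin_tensr _).1) ?addr0 //; apply: deriv_rho.
move=> i c e; rewrite deriv_rho (linD hc.1) !coprodM e tder2M //; last exact: deriv_rho.
congr (_ * _ + _); rewrite coprod_gen (linD h2.1) !tder2_tens // deriv1; last exact: deriv_rho.
rewrite (lin0 (flin_tensl _).1) (lin0 (flin_tensr _).1) addr0 add0r rho_gen.
apply: (primitive_bracket _ (pw i)); exact: primitive_gen.
Qed.

End TangentialAutomorphisms.

(** * Logarithms in TAut *)

Ltac abel1 := apply: funext => ?; rewrite !(ncsDE, ncsNE); ring.

Section Logarithm.
Variable K : fieldType.
Hypothesis charK0 : [pchar K] =i pred0.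
Notation A := 'A[K].
Notation A2 := 'A2[K].
Implicit Types (a b c d p g : A) (s t : A2) (i : 'I_2) (v : A -> A) (w u F G : 'I_2 -> A).

Lemma sexpE a : sexp a = expo (twist a (fun=> 0)) 1.
Proof.
rewrite /sexp ssumE; congr csum; apply: funext => k; congr (_ *: _).
by elim: k => //= k <-; rewrite exprS /twist addr0.
Qed.

Lemma texpE w i : texp w i = expo (twist (w i) (rho w)) 1.
Proof. exact: ssumE. Qed.

Lemma raising0 : raising (fun=> 0 : A).
Proof. by move=> N b _; apply: fil0. Qed.

Lemma grouplike_sexp a : primitive a -> grouplike (sexp a).
Proof.
by move=> h; rewrite sexpE; apply: grouplike_expo charK0 _ _ h (flin0 _ _) raising0 (@coderiv0 K).
Qed.

Lemma grouplike_texp w i : (forall i, primitive (w i)) -> grouplike (texp w i).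
Proof.
move=> h; rewrite texpE; apply: (grouplike_expo charK0 (h i) (flin_rho w)).
  by apply: raising_rho1 => k; apply: fil_primitive.
exact: coderiv_rho.
Qed.

Definition hdeg n a : A := fun x => if size x == n then a x else 0.
Definition hdeg2 n t : A2 := fun x y => if (size x + size y)%N == n then t x y else 0.

Lemma fil_hdeg n a : fil n (hdeg n a).
Proof. by apply/filA => x l; rewrite /hdeg ltn_eqF. Qed.

Lemma fil_sub_hdeg n a : fil n a -> fil n.+1 (a - hdeg n a).
Proof.
move=> /filA h; apply/filA => x; rewrite ltnS leq_eqVlt ncsDE ncsNE /hdeg.
by case: eqP => /= [_ _|_ l]; rewrite ?subrr // h // subr0.
Qed.

Lemma flin_hdeg n : flin (hdeg n).
Proof.
split=> [c a b|N a /filA h].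
  by apply: funext => x; rewrite /hdeg !(ncsDE, ncsZE); case: ifP => // _; rewrite scaler0 addr0.
by apply/filA => x l; rewrite /hdeg h ?if_same.
Qed.

Lemma flin_hdeg2 n : flin (hdeg2 n).
Proof.
split=> [c a b|N a /filA2 h].
  apply: funext => x; apply: funext => y; rewrite ncsDE ncsZE /hdeg2 !ncsDE !ncsZE.
  by case: ifP => // _; rewrite scaler0 addr0.
by apply/filA2 => x y l; rewrite /hdeg2 h ?if_same.
Qed.

Lemma hdegS_gen n i a : hdeg n.+1 (gen K i * a) = gen K i * hdeg n a.
Proof.
by apply: funext => -[|j x]; rewrite /hdeg !gen_mulE //= eqSS; case: ifP => //; rewrite mulr0.
Qed.

Lemma hdeg0_gen i a : hdeg 0 (gen K i * a) = 0.
Proof. by apply: funext => -[|j x]; rewrite /hdeg // gen_mulE. Qed.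

Lemma tswapM s t : tswap (s * t) = tswap s * tswap t.
Proof.
move: s; apply: (A2_eq (@A2_sep K)) => [||a b]; [clin | clin |].
move: t; apply: (A2_eq (@A2_sep K)) => [||c d]; [clin | clin |].
by rewrite !(tens_mul, tswap_tens).
Qed.

Lemma hdeg2_tswap n t : hdeg2 n (tswap t) = tswap (hdeg2 n t).
Proof. by apply: funext => x; apply: funext => y; rewrite /tswap /hdeg2 /= addnC. Qed.

Lemma hdeg2S_genl n i t : hdeg2 n.+1 (tens (gen K i) 1 * t) = tens (gen K i) 1 * hdeg2 n t.
Proof.
apply: funext => -[|j x]; apply: funext => y; rewrite /hdeg2 !gen_tens_mulE ?if_same //=.
by rewrite addSn eqSS !ncsZE; case: ifP => // _; rewrite scaler0.
Qed.

Lemma hdeg20_genl i t : hdeg2 0 (tens (gen K i) 1 * t) = 0.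
Proof.
apply: funext => -[|j x]; apply: funext => y; rewrite /hdeg2 ?gen_tens_mulE ?if_same //=.
Qed.

Lemma hdeg2S_genr n i t : hdeg2 n.+1 (tens 1 (gen K i) * t) = tens 1 (gen K i) * hdeg2 n t.
Proof.
rewrite -[LHS]tswapK -hdeg2_tswap tswapM tswap_tens hdeg2S_genl tswapM tswap_tens.
by rewrite -hdeg2_tswap.
Qed.

Lemma hdeg20_genr i t : hdeg2 0 (tens 1 (gen K i) * t) = 0.
Proof.
by rewrite -[LHS]tswapK -hdeg2_tswap tswapM tswap_tens hdeg20_genl (lin0 (flin_tswap K).1).
Qed.

Lemma coprod_hdeg n a : coprod (hdeg n a) = hdeg2 n (coprod a).
Proof.
have hc := flin_coprod K; have h1 := flin_hdeg; have h2 := flin_hdeg2.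
move: a n; apply: A_ind => [||i a IH n].
- split=> [c a b ha hb n|a h n].
    by rewrite (h1 n).1 !hc.1 ha hb (h2 n).1.
  apply: fil_eq => N; have [p hp e] := h N; apply: (fil_trans (v := coprod (hdeg n p))).
    by rewrite -(linB hc.1) -(linB (h1 n).1); apply/hc.2/(h1 n).2.
  rewrite hp -(linB (h2 n).1) -(linB hc.1); apply/(h2 n).2/hc.2; exact: fil_sub_sym.
- move=> n; rewrite coprod1 -tens11.
  have -> : hdeg n 1 = (n == 0%N)%:R *: (1 : A).
    apply: funext => x; rewrite /hdeg ncsZE !ncs1E.
    by case: x n => [|j x] [|n] //=; rewrite ?scale1r ?scale0r ?scaler0 ?if_same.
  rewrite (linZ hc.1) coprod1 -tens11; apply: funext => x; apply: funext => y.
  rewrite !ncsZE /hdeg2 /tens !ncs1E -!size_eq0.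
  case: (size x) => [|k]; case: (size y) => [|l]; rewrite ?mul0r ?mulr0 ?scaler0 ?if_same //.
  by rewrite mulr1 eq_sym; case: eqP; rewrite ?scale1r ?scale0r.
case: n => [|n].
  by rewrite hdeg0_gen (lin0 hc.1) coprodM coprod_gen mulrDl (linD (h2 0%N).1) hdeg20_genl hdeg20_genr addr0.
by rewrite hdegS_gen !coprodM IH coprod_gen !mulrDl (linD (h2 _).1) hdeg2S_genl hdeg2S_genr.
Qed.

(** The coproduct and both inclusions of A into A (x) A preserve the total degree, so components can
    be compared. *)
Lemma primitive_hdeg n a : fil n.+1 (coprod a - (tens a 1 + tens 1 a)) -> primitive (hdeg n a).
Proof.
move=> h; rewrite /primitive coprod_hdeg; have h2 := flin_hdeg2 n.
rewrite -[coprod a](subrK (tens a 1 + tens 1 a)) (linD h2.1).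
have -> : hdeg2 n (coprod a - (tens a 1 + tens 1 a)) = 0.
  move: h => /filA2 h; apply: funext => x; apply: funext => y; rewrite /hdeg2.
  by case: eqP => // e; rewrite h // e.
rewrite add0r (linD h2.1); congr (_ + _); apply: funext => x; apply: funext => y.
  rewrite /hdeg2 /tens /hdeg ncs1E; case: y => [|j y]; rewrite ?mulr0 ?if_same //.
  by rewrite addn0; case: ifP; rewrite ?mul0r.
rewrite /hdeg2 /tens /hdeg ncs1E; case: x => [|j x]; rewrite ?mul0r ?if_same //=.
by rewrite add0n; case: ifP; rewrite ?mulr0.
Qed.

Lemma primitive0 : primitive (0 : A).
Proof.
rewrite /primitive (lin0 (flin_coprod K).1) (lin0 (flin_tensl _).1) (lin0 (flin_tensr _).1).
by rewrite addr0.
Qed.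

Lemma primitiveZD (c : K) a b : primitive a -> primitive b -> primitive (c *: a + b).
Proof.
move=> ha hb; rewrite /primitive (flin_coprod K).1 ha hb (flin_tensl 1).1 (flin_tensr 1).1.
by rewrite scalerDr addrACA.
Qed.

Section Surjectivity.
Variable E : ('I_2 -> A) -> ('I_2 -> A).
Definition prim w := forall i, primitive (w i).
Hypothesis E_grouplike : forall w, prim w -> forall i, grouplike (E w i).
Hypothesis E_approx : forall m w u, prim w -> prim u ->
  (forall i, fil m.+1 (w i - u i)) -> forall i, fil m.+2 (E w i - E u i - (w i - u i)).
Variable G : 'I_2 -> A.
Hypothesis G_grouplike : forall i, grouplike (G i).

(** A logarithm for any exponential E that is linear to first order: each step adds the
    lowest-degree part of the error. It is used for [texp], to write G = exp(w), and for [sexp], to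
    place group-like pairs in TAut. *)
Fixpoint log_approx k : 'I_2 -> A := if k is k'.+1 then
  fun i => log_approx k' i + hdeg k (G i - E (log_approx k') i) else fun=> 0.

Lemma log_approxP k : prim (log_approx k) /\ forall i, fil k.+1 (G i - E (log_approx k) i).
Proof.
elim: k => [|k [pk hk]].
  have p0 : prim (fun=> 0) by move=> i; apply: primitive0.
  split=> // i; apply/filA1; rewrite ncsDE ncsNE (G_grouplike i).2 (E_grouplike p0 i).2.
  by rewrite subrr.
set e := fun i => G i - E (log_approx k) i.
have pe i : primitive (hdeg k.+1 (e i)).
  apply: primitive_hdeg; have [[gG G1] [gE E1]] := (G_grouplike i, E_grouplike pk i).
  rewrite /e (linB (flin_coprod K).1) gG gE.
  set g := E _ i in gE E1 *.
  (* Two group-like elements that agree below degree k + 1 have a difference that is primitive below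
     degree k + 2: each product on the right pairs that difference with a factor without constant
     term. *)
  have -> : tens (G i) (G i) - tens g g - (tens (G i - g) 1 + tens 1 (G i - g)) =
      tens (G i - g) (G i - 1) + tens (g - 1) (G i - g).
    by rewrite !tensBl !tensBr; abel2.
  apply: filD.
    by rewrite -addn1; apply: fil_tens (hk i) (fil_sub_sym (fil_sub1 G1)).
  by rewrite -add1n; apply: fil_tens (fil_sub_sym (fil_sub1 E1)) (hk i).
have pk1 : prim (log_approx k.+1).
  by move=> i /=; rewrite -[log_approx k i]scale1r; apply: primitiveZD (pk i) (pe i).
split=> // i; have hm j : fil k.+1 (log_approx k.+1 j - log_approx k j).
  by rewrite /= addrAC subrr add0r; apply: fil_hdeg.
have := E_approx pk1 pk hm i.
rewrite /= [X in _ - X]addrAC subrr add0r -/(e i) => h.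
have -> : G i - E (log_approx k.+1) i = e i - hdeg k.+1 (e i) -
    (E (log_approx k.+1) i - E (log_approx k) i - hdeg k.+1 (e i)).
  by rewrite {1}/e; abel1.
exact: (filB (fil_sub_hdeg (hk i)) h).
Qed.

(** Step k only changes coefficients of words of length k, so the coefficient at x is final after
    [size x] steps. *)
Definition log_limit i : A := fun x => log_approx (size x) i x.

Lemma log_limitP k i : fil k.+1 (log_limit i - log_approx k i).
Proof.
apply/filA => x; rewrite ltnS => le; rewrite ncsDE ncsNE /log_limit.
rewrite -(subnK le); elim: (k - size x)%N => [|l IH]; first by rewrite subrr.
rewrite addSn /= ncsDE opprD addrA IH /hdeg ltn_eqF ?oppr0 ?addr0 //.
by rewrite ltnS leq_addl.
Qed.

Lemma prim_log_limit : prim log_limit.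
Proof.
have hc := flin_coprod K.
have hd : flin (fun a : A => coprod a - (tens a 1 + tens 1 a)).
  apply: flin_add hc _; apply: flin_opp; apply: flin_add; first exact: flin_tensl.
  exact: flin_tensr.
move=> i; apply/eqP; rewrite -subr_eq0; apply/eqP/(@A2_sep K) => N.
have [pk _] := log_approxP N.
rewrite -[coprod _ - _](subrK (coprod (log_approx N i) - (tens (log_approx N i) 1 + tens 1 (log_approx N i)))).
rewrite -[_ - _ - _](linB hd.1 (log_limit i) (log_approx N i)).
by rewrite (pk i) subrr addr0; apply: hd.2; exact: (filW (leqnSn N) (@log_limitP N i)).
Qed.

Lemma exp_log_limit i : E log_limit i = G i.
Proof.
apply: fil_eq => N; have [pN gN] := log_approxP N.
apply: (@filW _ _ _ N.+1) => //; rewrite -opprB; apply: filN.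
apply: (fil_trans (gN i)); rewrite -opprB; apply: filN.
rewrite -[E _ i - E _ i](subrK (log_limit i - log_approx N i)).
apply: filD (@log_limitP N i); apply: filW (E_approx prim_log_limit pN _ i) => // k.
exact: log_limitP.
Qed.
End Surjectivity.

Lemma fil_sexp_approx m w u : prim w -> prim u ->
  (forall i, fil m.+1 (w i - u i)) -> forall i, fil m.+2 (sexp (w i) - sexp (u i) - (w i - u i)).
Proof.
move=> pw pu h i; rewrite !sexpE.
have e a : a = twist a (fun=> 0) 1 by rewrite /twist mulr1 addr0.
rewrite {2}[w i]e {2}[u i]e.
apply: expo_approx => // [||||N b hb].
- exact: flin_twist (flin0 _ _).
- exact: flin_twist (flin0 _ _).
- exact: raising_twist (fil_primitive (pw i)) raising0.
- exact: raising_twist (fil_primitive (pu i)) raising0.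
by rewrite /twist !addr0 -mulrBl addnC; apply: filAM.
Qed.

Lemma fil_texp_approx m w u : prim w -> prim u ->
  (forall i, fil m.+1 (w i - u i)) -> forall i, fil m.+2 (texp w i - texp u i - (w i - u i)).
Proof.
move=> pw pu h i; rewrite !texpE.
have e (v : 'I_2 -> A) : v i = twist (v i) (rho v) 1 by rewrite /twist mulr1 deriv1 ?addr0 //; apply: deriv_rho.
have r (v : 'I_2 -> A) : prim v -> raising (twist (v i) (rho v)).
  move=> pv; apply: raising_twist; first exact: fil_primitive.
  by apply: raising_rho1 => k; apply: fil_primitive.
rewrite {2}[w i]e {2}[u i]e; apply: expo_approx => // [||||N b hb].
- exact/flin_twist/flin_rho.
- exact/flin_twist/flin_rho.
- exact: r.
- exact: r.
rewrite /twist opprD addrACA -mulrBl -rhoB; apply: filD; first by rewrite addnC; apply: filAM.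
exact: raising_rho.
Qed.

Lemma grouplike_texp_ex G : (forall i, grouplike (G i)) ->
  exists2 w, prim w & forall i, texp w i = G i.
Proof.
move=> hG; exists (log_limit (@texp K) G); first apply: prim_log_limit => //.
- by move=> w pw i; apply: grouplike_texp.
- by move=> m w u; apply: fil_texp_approx.
move=> i; apply: exp_log_limit => // [w pw k|m w u]; first exact: grouplike_texp.
exact: fil_texp_approx.
Qed.

(** Gives access to the cocycle law of j, which is assumed on TAut only. *)
Lemma grouplike_TAut G : (forall i, grouplike (G i)) -> is_TAut G.
Proof.
move=> hG; pose E w i := sexp (w i : A).
have gE w : prim w -> forall i, grouplike (E w i) by move=> pw i; apply: grouplike_sexp.
have aE := fil_sexp_approx.
move=> i; exists (log_limit E G i); first exact: (prim_log_limit gE aE hG i).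
exact: esym (exp_log_limit gE aE hG i).
Qed.

End Logarithm.

(** * The action of TAut and the divergence cocycle on exponentials *)

Section TangentialAction.
Variable K : fieldType.
Hypothesis charK0 : [pchar K] =i pred0.
Notation A := 'A[K].
Notation A2 := 'A2[K].
Implicit Types (a b c d p g : A) (i : 'I_2) (w u F G : 'I_2 -> A).

Lemma fil2_conj g i : g [::] = 1 -> fil 2 (gen K i - sinv g * gen K i * g).
Proof.
move=> g1.
have -> : gen K i - sinv g * gen K i * g =
    (1 - sinv g) * gen K i + sinv g * gen K i * (1 - g).
  by rewrite mulrBl mulrBr mul1r mulr1 subrKA.
apply: filD; first by apply: (@filAM _ 1 1) (fil_sub1 _) (fil_gen K i); apply: sinv_nil.
rewrite -mulrA -[2%N]add0n; apply: filAM (filA_0 _) _.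
exact: (@filAM _ 1 1) (fil_gen K i) (fil_sub1 g1).
Qed.

Lemma fil1_conj g i : g [::] = 1 -> fil 1 (sinv g * gen K i * g).
Proof.
move=> g1; rewrite -[X in fil _ X](subKr (gen K i)); apply: filB (fil_gen K i) _.
exact: filW (fil2_conj i g1).
Qed.

Section Tact.
Variable F : 'I_2 -> A.
Hypothesis F1 : forall i, F i [::] = 1.

Let y i := sinv (F i) * gen K i * F i.

Lemma tactE a : tact F a = hsubst y a.
Proof. exact: ssumE. Qed.

Lemma ahom_tact : ahom (tact F).
Proof.
have y1 i : fil 1 (y i) by apply: fil1_conj.
have [[l f] h1 hM] := ahom_hsubst y1; split=> [|| a b]; rewrite ?tactE //.
by split=> [c a b|N a h]; rewrite !tactE; [apply: l | apply: f].
Qed.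

Lemma tact_gen i : tact F (gen K i) = sinv (F i) * gen K i * F i.
Proof. by rewrite tactE hsubst_gen // => k; apply: fil1_conj. Qed.

Lemma raising_tact : raising (fun b => b - tact F b).
Proof. by apply: ahom_unipotent ahom_tact _ => i; rewrite tact_gen; apply: fil2_conj. Qed.

Lemma tact_invE a : tact_inv F a = uinv (tact F) a.
Proof. exact: ssumE. Qed.
End Tact.

Lemma grouplike_tinv F : (forall i, grouplike (F i)) -> forall i, grouplike (tinv F i).
Proof.
move=> gF; have F1 i := (gF i).2; have hF := ahom_tact F1; have [fF _ _] := hF.
have rF := raising_tact F1; have hu := ahom_uinv fF rF hF; have [fu u1 uM] := hu.
have cF : forall a, coprod (tact F a) = tmap2 (tact F) (coprod a).
  apply: coprod_ahom hF _ => i; rewrite tact_gen //; apply: primitive_conj (gF i) _.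
  exact: primitive_gen.
have cu a : coprod (uinv (tact F) a) = tmap2 (uinv (tact F)) (coprod a).
  rewrite -{2}[a](uinvK fF rF) cF tmap2K //; exact: uinvK'.
move=> i; rewrite /tinv tact_invE; have [gi g1] := grouplikeV (gF i); split.
  by rewrite cu gi tmap2_tens.
have: fil 1 (sinv (F i) - 1) by apply/fil_sub_sym/fil_sub1.
by move/fu.2; rewrite (linB fu.1) u1 => /filA1; rewrite ncsDE ncsNE ncs1E => /eqP; rewrite subr_eq0 => /eqP.
Qed.

Section Texp.
Variable w : 'I_2 -> A.
Hypothesis pw : prim w.

Lemma raising_rho_prim : raising (rho w).
Proof. by apply: raising_rho1 => i; apply: fil_primitive. Qed.

Let rw := raising_rho_prim.
Let fw := flin_rho w.
Notation L i := (twist (w i) (rho w)).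

Let flinL i : flin (L i). Proof. exact: flin_twist. Qed.
Let raisingL i : raising (L i).
Proof. exact: raising_twist (fil_primitive (pw i)) rw. Qed.

Lemma ahom_expo_rho : ahom (expo (rho w)).
Proof.
split=> [||a b]; first exact: flin_expo.
  have e : is_sum (fun n => dpow (rho w) n 1) (1 : A).
    case=> [|N]; first exact: filA_0.
    rewrite big_ord_recl dpow0 big1 ?addr0 ?subrr => [|k _]; first exact: fil0.
    rewrite /dpow iterSr deriv1; last exact: deriv_rho.
    by rewrite (lin0 (flin_iter _ fw).1) scaler0.
  exact: is_sum_uniq (@A_sep K) (expo_sum rw _) e.
by apply: expo_mul => // b' c; apply: deriv_rho.
Qed.

Lemma expo_twist i b : expo (L i) b = texp w i * expo (rho w) b.
Proof.
rewrite texpE -[in LHS](mul1r b); apply: expo_mul => // c d.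
by apply: twist_mul; apply: deriv_rho.
Qed.

Lemma texp_nil i : texp w i [::] = 1.
Proof. by rewrite texpE expo1_nil. Qed.

(** Because rho(w) x_i = [x_i, w_i], the operator b -> w_i b + rho(w) b commutes with left
    multiplication by x_i. Its exponential is then compared at 1 and at x_i. *)
Lemma expo_rho_gen i : expo (rho w) (gen K i) = sinv (texp w i) * gen K i * texp w i.
Proof.
have e : texp w i * expo (rho w) (gen K i) = gen K i * texp w i.
  rewrite -expo_twist texpE.
  apply: is_sum_uniq (@A_sep K) (expo_sum (raisingL i) _) _.
  apply: eq_is_sum (is_sum_flin (flin_mullA (gen K i)) (expo_sum (raisingL i) 1)) => n.
  rewrite /dpow -scalerAr; congr (_ *: _); elim: n => [|n IH] /=; first by rewrite mulr1.
  by rewrite -IH /twist deriv_rho rho_gen mulrDr mulrBl !mulrA; abel1.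
by rewrite -mulrA -e mulrA mul_sinvl ?mul1r //; apply: texp_nil.
Qed.

Lemma tact_texp a : tact (texp w) a = expo (rho w) a.
Proof.
have t1 := texp_nil; apply: ahom_eq (ahom_tact t1) ahom_expo_rho _ => i.
by rewrite tact_gen // expo_rho_gen.
Qed.

Lemma prim_scale t : prim (fun i => t *: w i).
Proof. by move=> i; rewrite -[_ *: _]addr0; apply: primitiveZD (pw i) (primitive0 K). Qed.

End Texp.

Lemma twist_scale w t i :
  twist (t *: w i) (rho (fun k => t *: w k)) = fun b => t *: twist (w i) (rho w) b.
Proof. by apply: funext => b; rewrite /twist rhoZ scalerDr scalerAl. Qed.

Lemma tmul_texp w s t : prim w ->
  tmul (texp (fun i => s *: w i)) (texp (fun i => t *: w i)) = texp (fun i => (s + t) *: w i).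
Proof.
move=> pw; have ps := prim_scale pw s; apply: funext => i.
rewrite /tmul tact_texp // -expo_twist // !texpE !twist_scale expo_add //.
  exact/flin_twist/flin_rho.
exact: raising_twist (fil_primitive (pw i)) (raising_rho_prim pw).
Qed.

(** Instead of a Vandermonde determinant: p(2t) - 2^M p(t) has no term of degree M, so induction
    treats the lower coefficients, and p(1) then yields the top one. *)
Lemma vandermonde_fil (V : filtModType K) N M (v : nat -> V) :
  (forall t : K, fil N (\sum_(k < M) t ^+ k *: v k)) ->
  forall k, (k < M)%N -> fil N (v k).
Proof.
elim: M v => // M IH v h.
have hlow k : (k < M)%N -> fil N (v k).
  move=> lt; suff : fil N ((2 ^+ k - 2 ^+ M : K) *: v k).
    move/(filZ (2 ^+ k - 2 ^+ M : K)^-1); rewrite scalerK //.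
    rewrite subr_eq0 -!natrX; apply/eqP => e.
    have /eqP : ((2 ^ M - 2 ^ k)%:R : K) = 0.
      by rewrite natrB ?e ?subrr // leq_exp2l // ltnW.
    by rewrite ((GRing.pcharf0P K).1 charK0) subn_eq0 leq_exp2l // leqNgt lt.
  apply: (IH (fun k => (2 ^+ k - 2 ^+ M : K) *: v k)) lt => t.
  have -> : \sum_(l < M) t ^+ l *: ((2 ^+ l - 2 ^+ M : K) *: v l) =
      \sum_(l < M.+1) (2 * t) ^+ l *: v l - 2 ^+ M *: \sum_(l < M.+1) t ^+ l *: v l.
    rewrite scaler_sumr -sumrB big_ord_recr /= exprMn scalerA subrr addr0.
    by apply: eq_bigr => i _; rewrite exprMn !scalerA -scalerBl; congr (_ *: _); ring.
  exact: filB (h _) (filZ _ (h t)).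
move=> k; rewrite ltnS leq_eqVlt => /orP[/eqP ->|]; last exact: hlow.
have -> : v M = \sum_(l < M.+1) 1 ^+ l *: v l - \sum_(l < M) v l.
  rewrite big_ord_recr /= expr1n scale1r (eq_bigr (fun l : 'I_M => v l)) => [|l _].
    by rewrite addrAC subrr add0r.
  by rewrite expr1n scale1r.
by apply: filB (h 1) _; apply: fil_sum => l _; apply: hlow.
Qed.

Lemma bin_div n m : (m <= n)%N ->
  'C(n, m)%:R / n`!%:R = ((n - m)`!%:R)^-1 * (m`!%:R)^-1 :> K.
Proof.
move=> le; have f0 := fact_neq0 charK0.
rewrite -(bin_fact le) !natrM; have : 'C(n, m)%:R != 0 :> K.
  by rewrite ((GRing.pcharf0P K).1 charK0) -lt0n bin_gt0.
by move=> b0; field; rewrite b0 !f0.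
Qed.

Lemma binom_div (s t : K) n :
  ((s + t) ^+ n.+1 - s ^+ n.+1) / n.+1`!%:R =
  \sum_(b < n.+1) s ^+ (n - b) / (n - b)`!%:R * (t ^+ b.+1 / b.+1`!%:R).
Proof.
rewrite exprDn big_ord_recl subn0 expr0 mulr1 bin0 mulr1n addrAC subrr add0r mulr_suml.
apply: eq_bigr => b _; rewrite -[nat_of_ord _]/(b.+1) subSS -mulr_natr -!mulrA bin_div.
  by rewrite subSS; ring.
by rewrite ltnS -ltnS.
Qed.

Section PrimitiveIntegral.
Variables (w : 'I_2 -> A) (c : A).
Hypothesis pw : prim w.
Let rw := raising_rho_prim pw.
Let fw := flin_rho w.

(* The integral of exp(s rho w) c over s from 0 to t *)
Definition exp_int (t : K) := csum (fun n => (t ^+ n.+1 / n.+1`!%:R) *: iter n (rho w) c).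

Lemma exp_int_sum t : is_sum (fun n => (t ^+ n.+1 / n.+1`!%:R) *: iter n (rho w) c) (exp_int t).
Proof.
apply: csumP => k; apply: filZ; rewrite -[k in fil k _]addn0.
exact: raising_iter rw (filA_0 c).
Qed.

(** The same cocycle law as that of t -> j(exp(tw)), which is what makes the two comparable. *)
Lemma exp_int_add s t :
  exp_int (s + t) = exp_int s + expo (fun v => s *: rho w v) (exp_int t).
Proof.
have rs := raising_scale s rw; have fs := flin_cscale s fw.
have := exp_conv_sum fs rs
  (e := fun m => m`!%:R *: ((t ^+ m.+1 / m.+1`!%:R) *: iter m (rho w) c)) (s := exp_int t).
have F m : fil m (m`!%:R *: ((t ^+ m.+1 / m.+1`!%:R) *: iter m (rho w) c)).
  apply/filZ/filZ; rewrite -[m in fil m _]addn0; exact: raising_iter rw (filA_0 c).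
move/(_ F); have e : (fun m => m`!%:R^-1 *: (m`!%:R *: ((t ^+ m.+1 / m.+1`!%:R) *: iter m (rho w) c))) =
    fun m => (t ^+ m.+1 / m.+1`!%:R) *: iter m (rho w) c.
  by apply: funext => m; rewrite scalerK // fact_neq0.
rewrite e => /(_ (exp_int_sum t)) S.
apply: is_sum_uniq (@A_sep K) (exp_int_sum _) _.
apply: eq_is_sum (is_sumD (exp_int_sum s) S) => n.
have -> : exp_conv (fun v => s *: rho w v)
    (fun m => m`!%:R *: ((t ^+ m.+1 / m.+1`!%:R) *: iter m (rho w) c)) n =
    (((s + t) ^+ n.+1 - s ^+ n.+1) / n.+1`!%:R) *: iter n (rho w) c.
  rewrite binom_div scaler_suml; apply: eq_bigr => m _.
  rewrite scalerK ?fact_neq0 // (linZ (flin_dpow fs _).1) dpow_scale // /dpow !scalerA -iterD.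
  by rewrite subnK -1?ltnS //; congr (_ *: _); ring.
by rewrite -scalerDl; congr (_ *: _); ring.
Qed.
End PrimitiveIntegral.

Lemma tact_cycE F a : (forall i, F i [::] = 1) -> tact_cyc F (cp a) = cp (tact F a).
Proof.
move=> F1; have [fF _ FM] := ahom_tact F1.
apply: (cp_factor (f := fun a => cp (tact F a)) (@cyc_sep K)) => [|b d|]; first by clin.
  by rewrite !FM; exact: cpC.
exact: cprojK.
Qed.

(** Comparing z(2t) with 2z(t) multiplies e_k by 2^k - 2. In characteristic 0 this is zero only for
    k = 1, where e_k vanishes by assumption. *)
Lemma additive_poly_fil (V : filtModType K) N M (z : K -> V) (e : nat -> V) :
  e 1%N = 0 -> (forall t, fil N (z (t + t) - z t - z t)) ->
  (forall t, fil N (z t - \sum_(k < M) t ^+ k *: e k)) -> forall t, fil N (z t).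
Proof.
move=> e1 hadd hz t.
have h2 k : (k < M)%N -> fil N ((2 ^+ k - 2 : K) *: e k).
  move=> lt; apply: (@vandermonde_fil V N M (fun k => (2 ^+ k - 2 : K) *: e k)) lt => x.
  have -> : \sum_(l < M) x ^+ l *: ((2 ^+ l - 2 : K) *: e l) =
      \sum_(l < M) (x + x) ^+ l *: e l - (\sum_(l < M) x ^+ l *: e l + \sum_(l < M) x ^+ l *: e l).
    rewrite -big_split -sumrB; apply: eq_bigr => l _ /=.
    rewrite -scalerDl -scalerBl scalerA; congr (_ *: _).
    by rewrite (_ : x + x = 2 * x) ?exprMn; ring.
  apply: (fil_trans (v := z (x + x))); first exact/fil_sub_sym/hz.
  apply: (fil_trans (v := z x + z x)); first by rewrite opprD addrA; apply: hadd.
  by rewrite opprD addrACA; apply: filD; apply: hz.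
have he k : (k < M)%N -> fil N (e k).
  case: k => [|[|k]] lt; last first.
  - have := filZ (2 ^+ k.+2 - 2 : K)^-1 (h2 _ lt); rewrite scalerK //.
    rewrite subr_eq0 -natrX -subr_eq0 -natrB ?((GRing.pcharf0P K).1 charK0) ?subn_eq0.
      by rewrite leqNgt -{1}[2%N]expn1 ltn_exp2l.
    by rewrite -{1}[2%N]expn1 leq_exp2l.
  - by rewrite e1; apply: fil0.
  have := filZ (-1 : K) (h2 _ lt); rewrite scalerA.
  by rewrite (_ : -1 * _ = 1 :> K) ?scale1r // expr0; ring.
rewrite -[z t](subrK (\sum_(k < M) t ^+ k *: e k)); apply: filD => //.
by apply: fil_sum => k _; apply/filZ/he.
Qed.

(** Let z(t) be the difference of j(exp(tw)) and the integral; it satisfies z(s + t) = z(s) + exp(s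
    rho(w)) z(t). If z has values in [fil N], it is additive modulo [fil N.+1], since the action is
    unipotent. Its derivative at 0 vanishes, so its values lie in [fil N.+1]. *)
Lemma div_cocycle_texp j w c : is_div_cocycle j -> prim w -> cp c = div w ->
  j (texp w) = cp (exp_int w c 1).
Proof.
move=> [jM jD] pw cw; have ps := prim_scale pw; have rw := raising_rho_prim pw.
pose f t := j (texp (fun i => t *: w i)); pose z t := f t - cp (exp_int w c t).
pose phi s := tact (texp (fun i => s *: w i)).
have t1 t := texp_nil (ps t); have hphi s := ahom_tact (t1 s).
have phiE s a : phi s a = expo (fun b => s *: rho w b) a.
  rewrite /phi (tact_texp (ps s)).
  have -> : rho (fun i => s *: w i) = (fun b => s *: rho w b).
    by apply: funext => b; apply: rhoZ.
  by [].
have fM s t : f (s + t) = f s + tact_cyc (texp (fun i => s *: w i)) (f t).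
  rewrite /f -tmul_texp // jM //; apply: (grouplike_TAut charK0) => i.
    exact: (grouplike_texp charK0 _ (ps s)).
  exact: (grouplike_texp charK0 _ (ps t)).
have zM s t v : cp v = z t -> z (s + t) = z s + cp (phi s v).
  move=> e; have -> : z (s + t) = f (s + t) - cp (exp_int w c (s + t)) by [].
  have ft : f t = cp (v + exp_int w c t).
    by rewrite (linD (flin_cp K).1) e subrK.
  rewrite fM ft tact_cycE // exp_int_add // -phiE -/(phi s).
  have [[lphi _] _ _] := hphi s.
  rewrite /phi (linD lphi) (linD (flin_cp K).1 (tact _ v)) (linD (flin_cp K).1 (exp_int w c s)).
  by rewrite opprD addrACA addrK.
suff key N t : fil N (z t).
  apply/eqP; rewrite -subr_eq0; apply/eqP/(@cyc_sep K) => N; have := key N 1.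
  by rewrite /z /f; under eq_fun do rewrite scale1r.
elim: N t => [|N IH] t; first by exists (repr (z t)); [exact: filA_0 | exact: cprojK].
have [cc cc1 hcc] := jD w pw; have {hcc} [M hM] := hcc N.+1.
(* The expansion of j needs at least M terms and that of the integral at least N + 1 to be exact
   modulo [fil N.+1]. *)
pose m := (M + N.+1)%N.
pose e k := cc k - (if k is n.+1 then (n.+1`!%:R : K)^-1 *: cp (iter n (rho w) c) else 0).
apply: (@additive_poly_fil _ N.+1 m.+1 z e) t => [|t|t].
- by rewrite /e cc1 invr1 scale1r cw subrr.
- have [v hv ev] := IH t; rewrite (zM t t v ev) -ev [_ + cp (phi t v)]addrC addrK.
  rewrite -(linB (flin_cp K).1); apply: (flin_cp K).2; apply: fil_sub_sym.
  by apply: raising_tact.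
have eS : \sum_(k < m.+1) t ^+ k *: e k = \sum_(k < m.+1) t ^+ k *: cc k -
    cp (\sum_(n < m) (t ^+ n.+1 / n.+1`!%:R) *: iter n (rho w) c).
  rewrite (lin_sum (flin_cp K).1) [LHS]big_ord_recl [X in _ = X - _]big_ord_recl /e subr0.
  rewrite -addrA; congr (_ + _); rewrite -sumrB; apply: eq_bigr => k _.
  by rewrite scalerBr (linZ (flin_cp K).1) scalerA.
have -> : z t - \sum_(k < m.+1) t ^+ k *: e k = (f t - \sum_(k < m.+1) t ^+ k *: cc k) -
    cp (exp_int w c t - \sum_(n < m) (t ^+ n.+1 / n.+1`!%:R) *: iter n (rho w) c).
  rewrite eS (linB (flin_cp K).1) /z !opprB addrACA [RHS]addrACA; congr (_ + _).
  exact: addrC.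
apply: filB; first by apply: hM; rewrite /m; lia.
apply: (flin_cp K).2; exact: (filW (leq_addl M N.+1) (@exp_int_sum w c pw t m)).
Qed.

End TangentialAction.

(** * The cocycle tDiv *)

Section Divergence.
Variable K : fieldType.
Notation A := 'A[K].
Notation A2 := 'A2[K].
Implicit Types (a b c d p g : A) (s t : A2) (i j : 'I_2) (w u : 'I_2 -> A) (v : A -> A).

Lemma mul_genE a i x j : (a * gen K i) (rcons x j) = (j == i)%:R * a x.
Proof.
rewrite ncsME size_rcons big_ord_recr big_ord_recr /= big1 ?add0r => [|k _]; last first.
  rewrite /gen.
  case E: (drop k (rcons x j) == [:: i]); last by rewrite mulr0.
  have := size_drop k (rcons x j); rewrite (eqP E) size_rcons /= => e.
  by have := ltn_ord k; lia.
rewrite -{1}cats1 take_size_cat // -{1}cats1 drop_size_cat // /gen eqseq_cons andbT.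
by rewrite drop_oversize ?size_rcons // mulr0 addr0 mulrC.
Qed.

Lemma mul_gen_nil a i : (a * gen K i) [::] = 0.
Proof. by rewrite ncs_nilE mulr0. Qed.

Lemma A_decomp_r a : a = a [::] *: 1 + \sum_i rquo i a * gen K i.
Proof.
apply: funext => x; rewrite ncsDE ncsZE ncs_sumE ncs1E; case/lastP: x => [|x j].
  by rewrite big1 ?addr0 => [|i _]; [rewrite [_ *: _]mulr1 | rewrite mul_gen_nil].
rewrite -size_eq0 size_rcons [_ *: _]mulr0 add0r (bigD1 j) //= mul_genE eqxx mul1r.
by rewrite big1 ?addr0 // => i /negbTE h; rewrite mul_genE eq_sym h mul0r.
Qed.

Lemma fil_tdif N a : fil N a -> fil N (tdif a).
Proof. exact: (flin_tdif K).2. Qed.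

Lemma omul_gen_tens i t x j : (t ** tens (gen K i) 1) (rcons x j) = (j == i)%:R *: t x.
Proof.
rewrite omulE size_rcons big_ord_recr big_ord_recr /= big1 ?add0r => [|k _]; last first.
  rewrite tensE /gen.
  case E: (drop k (rcons x j) == [:: i]); last by rewrite scale0r mul0r.
  have := size_drop k (rcons x j); rewrite (eqP E) size_rcons /= => e.
  by have := ltn_ord k; lia.
rewrite -{1}cats1 drop_size_cat // -{1}cats1 take_size_cat // !tensE /gen eqseq_cons andbT.
by rewrite drop_oversize ?size_rcons // scale0r mul0r addr0 -scalerAl mul1r.
Qed.

Lemma omul_tens_gen i t x : (t ** tens 1 (gen K i)) x = gen K i * t x.
Proof.
rewrite omulE big_ord_recr /= take_size drop_size big1 ?add0r => [|k _]; last first.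
  rewrite tensE ncs1E -size_eq0 size_drop subn_eq0 leqNgt ltn_ord scale0r.
  by rewrite mul0r.
by rewrite tensE ncs1E scale1r.
Qed.

(** The coefficient at (xj, y) expresses t_j(x, y) through values of the t_i whose second word is y
    without its first letter; for empty y it gives 0. *)
Lemma tdif_gen_free (t : 'I_2 -> A2) : \sum_i t i ** tdif (gen K i) = 0 -> forall i, t i = 0.
Proof.
move=> h.
have E x j y : t j x y = \sum_i (gen K i * t i (rcons x j)) y.
  have := congr1 (fun s : A2 => s (rcons x j) y) h.
  rewrite !ncs_sumE.
  under eq_bigr => i _ do rewrite tdifE omulBr ncsDE ncsNE ncsDE ncsNE omul_gen_tens omul_tens_gen ncsZE.
  rewrite sumrB (bigD1 j) //= eqxx scale1r [X in _ + X - _]big1 ?addr0 => [|i /negbTE ne].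
    by move/eqP; rewrite subr_eq0 => /eqP.
  by rewrite eq_sym ne scale0r.
move=> j; apply: funext => x; apply: funext => y; elim: y x j => [|l y IH] x j; rewrite E.
  by rewrite big1 // => i _; rewrite gen_mulE.
by rewrite big1 // => i _; rewrite gen_mulE IH mulr0.
Qed.

Lemma tdif_expand a : tdif a = \sum_i pder i a ** tdif (gen K i).
Proof. exact: dder_expand (flin_clin (flin_tdif K)) (@dder_tdif K). Qed.

(** Dt applied to p = sum of p^i x_i is a second expansion of [tdif p] in the [tdif (gen K i)], and
    such expansions are unique by [tdif_gen_free]. *)
Lemma pder_primitive p i : primitive p -> pder i p = tcop (rquo i p).
Proof.
move=> hp; apply/eqP; rewrite -subr_eq0; apply/eqP.
apply: (tdif_gen_free (t := fun i => pder i p - tcop (rquo i p))).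
under eq_bigr do rewrite omulBl.
rewrite sumrB -tdif_expand -(tcop_primitive hp) {1}[p]A_decomp_r.
have h := flin_tcop K.
rewrite primitive_nil // scale0r add0r (lin_sum h.1) -sumrB big1 // => j _.
by rewrite tcopM tcop_gen subrr.
Qed.

(** A representative of tDiv(u) in A (x) A. In the double derivative of [x_i, u_i], the two terms
    where x_i itself is differentiated cancel against the correction |u_i| (x) 1 - 1 (x) |u_i|. *)
Definition tdL u : A2 := \sum_i pder i (u i) ** tdif (gen K i).

Lemma tDivE u : tDiv u = cp2 (tdL u).
Proof.
have hc := flin_cp2 K.
rewrite /tDiv /Div /tdL (lin_sum hc.1) -big_split; apply: eq_bigr => i _ /=.
rewrite rho_gen (linB (clin_pder K i).1) !pderM pder_gen eqxx mul1r mulr1 cp2_omulC.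
rewrite -!(linB hc.1) -(linD hc.1) !tdifE omulBl omul_1tens omul_tens1; congr cp2.
by abel2.
Qed.

Lemma tDiv_primitive w : prim w ->
  tDiv w = cp2 (tcop (\sum_i gen K i * rquo i (w i))).
Proof.
move=> pw; have hc := flin_cp2 K; have ht := flin_tcop K.
rewrite tDivE /tdL (lin_sum ht.1) !(lin_sum hc.1); apply: eq_bigr => i _.
by rewrite pder_primitive // tcopM tcop_gen cp2_omulC.
Qed.

Lemma tder2_cp2 v s t : flin v -> derivation v -> cp2 s = cp2 t ->
  cp2 (tder2 v s) = cp2 (tder2 v t).
Proof.
move=> hv dv; have h2 := flin_tder2 hv; have hc := flin_cp2 K.
apply: (cp2_factor (f := fun t => cp2 (tder2 v t)) (@cyc2_sep K)) => [|a b c|a b c].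
- exact: clin_comp (flin_clin hc) (flin_clin h2).
- rewrite !tder2_tens // !dv !tensDl !(linD hc.1); rewrite [cp2 (tens (v a * b) c)]cp2_comml.
  rewrite [cp2 (tens (a * v b) c)]cp2_comml [cp2 (tens (a * b) (v c))]cp2_comml.
  by congr (_ + _); apply: addrC.
rewrite !tder2_tens // !dv !tensDr !(linD hc.1); rewrite [cp2 (tens c (v a * b))]cp2_commr.
rewrite [cp2 (tens c (a * v b))]cp2_commr [cp2 (tens (v c) (a * b))]cp2_commr.
by congr (_ + _); apply: addrC.
Qed.

Lemma tder2_1 v : flin v -> derivation v -> tder2 v 1 = 0.
Proof.
move=> hv dv; rewrite -tens11 tder2_tens // deriv1 //.
by rewrite (lin0 (flin_tensl _).1) (lin0 (flin_tensr _).1) addr0.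
Qed.

(** The commutator of [pder i] with v is again a double derivation, so its values on generators
    determine it. *)
Lemma pder_deriv v i a : flin v -> derivation v ->
  pder i (v a) = tder2 v (pder i a) + \sum_j pder j a ** pder i (v (gen K j)).
Proof.
move=> hv dv; have h2 := flin_tder2 hv; apply/eqP; rewrite addrC -subr_eq; apply/eqP.
have lp : linear (@pder K i) := linear_pder i.
rewrite (dder_expand a (D := fun a => pder i (v a) - tder2 v (pder i a))).
- apply: eq_bigr => j _; rewrite pder_gen; congr (_ ** _).
  case: (i == j); first by rewrite mulr1n tder2_1 // subr0.
  by rewrite mulr0n (lin0 h2.1) subr0.
- apply: clin_add; first exact: clin_comp (clin_pder K i) (flin_clin hv).
  by apply: clin_opp; apply: clin_comp (flin_clin h2) (clin_pder K i).
move=> b c; rewrite dv (linD lp) !pderM (linD h2.1) !tder2M // !tder2_tens // deriv1 //.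
rewrite (lin0 (flin_tensl _).1) (lin0 (flin_tensr _).1) addr0 add0r !mulrBl !mulrBr.
by abel2.
Qed.

Lemma tder2_tdif v a : flin v -> derivation v -> tder2 v (tdif a) = tdif (v a).
Proof.
move=> hv dv; rewrite !tdifE (linB (flin_tder2 hv).1) !tder2_tens // deriv1 //.
by rewrite (lin0 (flin_tensl _).1) (lin0 (flin_tensr _).1) addr0 add0r.
Qed.

Lemma cp2_tdifC a b : cp2 (tdif (a * b)) = cp2 (tdif (b * a)).
Proof. by rewrite !tdifE !(linB (flin_cp2 K).1) cp2_comml cp2_commr. Qed.

Definition divL v : A2 := \sum_i pder i (v (gen K i)).

(** The terms containing a derivative of v and a derivative of v' are exchanged with each other by
    [cp2_omulC], hence cancel. *)
Lemma divL_bracket v v' : flin v -> derivation v -> flin v' -> derivation v' ->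
  cp2 (divL (fun a => v (v' a) - v' (v a))) =
  cp2 (tder2 v (divL v')) - cp2 (tder2 v' (divL v)).
Proof.
move=> hv dv hv' dv'; have hc := flin_cp2 K; have h2 := flin_tder2 hv; have h2' := flin_tder2 hv'.
rewrite /divL (lin_sum h2.1) (lin_sum h2'.1).
have e x y : flin x -> derivation x -> \sum_i pder i (x (y (gen K i))) =
    \sum_i tder2 x (pder i (y (gen K i))) +
    \sum_i \sum_j pder j (y (gen K i)) ** pder i (x (gen K j)).
  by move=> hx dx; rewrite -big_split; apply: eq_bigr => i _; apply: pder_deriv.
under eq_bigr do rewrite (linB (clin_pder K _).1).
rewrite sumrB (e v v') // (e v' v) // opprD addrACA (linD hc.1) (linB hc.1).
rewrite [X in _ + X](_ : _ = 0) ?addr0 // (linB hc.1) exchange_big /=.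
apply/eqP; rewrite subr_eq0 !(lin_sum hc.1); apply/eqP; apply: eq_bigr => i _.
by rewrite !(lin_sum hc.1); apply: eq_bigr => j _; apply: cp2_omulC.
Qed.

Definition tad w u i : A := rho w (u i) - rho u (w i) + (w i * u i - u i * w i).

Lemma rho_tad w u a : rho (tad w u) a = rho w (rho u a) - rho u (rho w a).
Proof.
have hw := flin_rho w; have hu := flin_rho u.
apply: (@deriv_eq _ _ (fun a => rho w (rho u a) - rho u (rho w a))).
- exact/flin_clin/flin_rho.
- by clin.
- exact: deriv_rho.
- move=> b c; rewrite !deriv_rho (linD hw.1) (linD hu.1) !deriv_rho !mulrBl !mulrBr.
  by abel1.
move=> i; rewrite !rho_gen (linB hw.1) (linB hu.1) !deriv_rho !rho_gen /tad.
rewrite !(mulrBl, mulrBr, mulrDl, mulrDr) !mulrA.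
by abel1.
Qed.

Lemma twist_tad w u i a :
  twist (tad w u i) (rho (tad w u)) a =
  twist (w i) (rho w) (twist (u i) (rho u) a) - twist (u i) (rho u) (twist (w i) (rho w) a).
Proof.
have hw := flin_rho w; have hu := flin_rho u.
rewrite /twist rho_tad /tad (linD hw.1) (linD hu.1) !deriv_rho.
rewrite !(mulrBl, mulrBr, mulrDl, mulrDr) !mulrA.
by abel1.
Qed.

Lemma fil_tad w u N : (forall i, fil 1 (w i)) -> (forall i, fil N (u i)) ->
  forall i, fil N.+1 (tad w u i).
Proof.
move=> hw hu i; apply: filD; apply: filB.
- exact: raising_rho1.
- by rewrite -add1n; apply: raising_rho.
- by rewrite -add1n; apply: filAM.
- by rewrite -addn1; apply: filAM.
Qed.

(** The 1-cocycle identity. It holds for Div by [divL_bracket] and for the correction terms because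
    |tdif [w_i, u_i]| = 0. *)
Lemma tDiv_tad w u :
  tDiv (tad w u) = cp2 (tder2 (rho w) (tdL u)) - cp2 (tder2 (rho u) (tdL w)).
Proof.
have hc := flin_cp2 K; have hw := flin_rho w; have hu := flin_rho u.
pose e (x : 'I_2 -> A) : A2 := \sum_i tdif (x i).
have tE x : cp2 (tdL x) = cp2 (divL (rho x) + e x).
  rewrite -tDivE /tDiv /Div (linD hc.1) !(lin_sum hc.1); congr (_ + _).
  by apply: eq_bigr => i _; rewrite tdifE (linB hc.1).
rewrite (tder2_cp2 hw (@deriv_rho _ w) (tE u)) (tder2_cp2 hu (@deriv_rho _ u) (tE w)).
rewrite tDivE tE (linD (flin_tder2 hw).1) (linD (flin_tder2 hu).1) (linD hc.1 (divL _)).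
rewrite !(linD hc.1 (tder2 _ _) (tder2 _ _)).
rewrite opprD addrACA -divL_bracket //; try exact: deriv_rho.
congr (_ + _); first by congr (cp2 _); apply: eq_bigr => i _; rewrite rho_tad.
rewrite -(linB hc.1) /e (lin_sum (flin_tder2 hw).1) (lin_sum (flin_tder2 hu).1) -sumrB.
rewrite !(lin_sum hc.1); apply: eq_bigr => i _.
rewrite !tder2_tdif //; try exact: deriv_rho.
have ct : flin (fun a => cp2 (tdif a)) by have h := flin_tdif K; flin.
rewrite (linB hc.1 (tdif _) (tdif _)) /tad (linD ct.1) (linB ct.1 (rho w _)) (linB ct.1 (_ * _)).
by rewrite cp2_tdifC subrr addr0.
Qed.

End Divergence.

(** * Change of tDiv under conjugation by exp(w) *)

Section Conjugation.
Variable K : fieldType.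
Hypothesis charK0 : [pchar K] =i pred0.
Notation A := 'A[K].
Notation A2 := 'A2[K].
Implicit Types (a c d p g : A) (s t : A2) (i j : 'I_2) (u : 'I_2 -> A) (v : A -> A).

Variable w : 'I_2 -> A.
Hypothesis pw : prim w.

Let rw := raising_rho_prim pw.
Let fw := flin_rho w.
Let w1 i : fil 1 (w i) := fil_primitive (pw i).

Definition tad_iter u b : 'I_2 -> A := iter b (tad w) u.

Lemma fil_tad_iter u b i : fil b (tad_iter u b i).
Proof.
elim: b i => [|b IH] i; first exact: filA_0.
exact: (@fil_tad _ w (tad_iter u b)).
Qed.

(* exp(- ad w) u *)
Definition conj_tuple u i : A := csum (fun b => (b`!%:R)^-1 *: ((-1) ^+ b *: tad_iter u b i)).

Lemma conj_tuple_sum u i :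
  is_sum (fun b => (b`!%:R)^-1 *: ((-1) ^+ b *: tad_iter u b i)) (conj_tuple u i).
Proof. by apply: csumP => b; apply/filZ/filZ/fil_tad_iter. Qed.

Lemma tad_iterS (V : lmodType K) (f : ('I_2 -> A) -> V) u :
  (fun b => (-1) ^+ b.+1 *: f (tad_iter u b.+1)) =
  fun b => - ((-1) ^+ b *: f (tad_iter (tad w u) b)).
Proof.
by apply: funext => b; rewrite /tad_iter iterSr exprS mulN1r scaleNr.
Qed.

Lemma exp_convN (V : complModType K) (L : V -> V) e n : flin L ->
  exp_conv L (fun b => - e b) n = - exp_conv L e n.
Proof.
move=> hL; rewrite /exp_conv -sumrN; apply: eq_bigr => b _.
by rewrite scalerN (linN (flin_dpow hL _).1).
Qed.

(** This is e^W U' = U e^W applied to 1, where W, U, U' are the operators [twist] of w, u and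
    exp(-ad w)u; they form a representation by [twist_tad]. The induction on the degree is over all
    u, as its step replaces u by [w, u]. *)
Lemma conj_tuple_texp u i :
  texp w i * expo (rho w) (conj_tuple u i) = u i * texp w i + rho u (texp w i).
Proof.
have hL := flin_twist (w i) fw; have rL := raising_twist (w1 i) rw.
rewrite -expo_twist // -[RHS]/(twist (u i) (rho u) (texp w i)) texpE.
have F b : fil b ((-1) ^+ b *: tad_iter u b i) by apply/filZ/fil_tad_iter.
apply: is_sum_uniq (@A_sep K) (exp_conv_sum hL rL F (conj_tuple_sum u i)) _.
have hu := flin_twist (u i) (flin_rho u).
apply: eq_is_sum (is_sum_flin hu (expo_sum rL 1)) => n.
elim: n u {F hu} => [|n IH] u.
  rewrite /exp_conv big_ord1 !dpow0 /twist mulr1 deriv1 ?addr0; last exact: deriv_rho.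
  by rewrite invr1 !scale1r.
apply: (@scale_natS_inj _ charK0 _ n); rewrite (exp_convS charK0) //.
rewrite (tad_iterS (fun u => u i)) exp_convN // -!IH.
have h := flin_twist (u i) (flin_rho u).
by rewrite -(linZ h.1) (dpowS charK0) // twist_tad opprB addrC subrK.
Qed.

Let R2 := tder2 (rho w).
Let hR2 : flin R2 := flin_tder2 fw.
Let rR2 : raising R2 := raising_tder2 rw.

Lemma tmap2_expo t : tmap2 (expo (rho w)) t = expo R2 t.
Proof.
have [he _ _] := ahom_expo_rho charK0 pw; have h2 := flin_tmap2 he.
have h3 := flin_expo hR2 rR2.
move: t; apply: (A2_eq (@A2_sep K)) => [||a b]; [clin | clin |].
by rewrite tmap2_tens // expo_tens.
Qed.

Lemma tcop_rho a : tcop (rho w a) = R2 (tcop a).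
Proof.
have ht := flin_tcop K.
apply: (@coprod_eq _ (fun a => tcop (rho w a)) (fun a => R2 (tcop a))) => [|||i b e].
- by flin.
- by flin.
- rewrite deriv1 ?tcop1 /R2 ?tder2_1 ?(lin0 ht.1) //; exact: deriv_rho.
rewrite deriv_rho (linD ht.1) !tcopM e /R2 tder2_omul //; last exact: deriv_rho.
congr (_ ** _ + _); rewrite rho_gen tcop_primitive; last first.
  by apply: primitive_bracket (pw i); apply: primitive_gen.
by rewrite tcop_gen tder2_tdif ?rho_gen //; apply: deriv_rho.
Qed.

Definition div_lift := \sum_i gen K i * rquo i (w i).

Lemma cp_div_lift : cp div_lift = div w.
Proof. exact: (lin_sum (flin_cp K).1). Qed.

Lemma is_sum_tdL (c : nat -> 'I_2 -> A) u : (forall i, is_sum (c^~ i) (u i)) ->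
  is_sum (fun n => tdL (c n)) (tdL u).
Proof.
move=> h N; rewrite /tdL exchange_big -sumrB; apply: fil_sum => i _.
have hp : flin (fun a => pder i a ** tdif (gen K i)).
  split=> [k a b|M a ha].
    by rewrite (clin_pder K i).1 (flin_omulr _).1.
  case: M ha => [|M] ha; first exact: filA2_0.
  by rewrite -addn1; apply: fil_omul (fil_pder i ha) (fil_tdif (fil_gen K i)).
exact: (is_sum_flin hp (h i)).
Qed.

Lemma tdL_linear k u u' : tdL (fun i => k *: u i + u' i) = k *: tdL u + tdL u'.
Proof.
rewrite /tdL scaler_sumr -big_split; apply: eq_bigr => i _.
by rewrite (clin_pder K i).1 (flin_omulr _).1.
Qed.

Lemma tdL0 : tdL (fun=> 0 : A) = 0.
Proof.
rewrite /tdL big1 // => i _; rewrite (lin0 (clin_pder K i).1).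
exact: (lin0 (flin_omulr _).1).
Qed.

Lemma tdLZ k u : tdL (fun i => k *: u i) = k *: tdL u.
Proof.
have := tdL_linear k u (fun=> 0); rewrite tdL0 addr0 => <-.
by congr tdL; apply: funext => i; rewrite addr0.
Qed.

Lemma tder2_tad u t :
  tder2 (rho (tad w u)) t = R2 (tder2 (rho u) t) - tder2 (rho u) (R2 t).
Proof.
have hv := flin_tder2 (flin_rho (tad w u)); have hu := flin_tder2 (flin_rho u).
have f1 := flin_rho u; have f2 := flin_rho (tad w u).
move: t; apply: (A2_eq (@A2_sep K)) => [||a b]; [clin | clin |].
rewrite /R2 !tder2_tens // !(linD (flin_tder2 _).1) // !tder2_tens //.
by rewrite !rho_tad tensBl tensBr; abel2.
Qed.

(** Coefficientwise form of d/ds (e^{sw} tDiv(e^{-s ad w} u)) = u . e^{sw} tDiv(w), a consequence of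
    the cocycle identity [tDiv_tad]. *)
Lemma exp_conv_tdL u n : n.+1%:R *:
  cp2 (exp_conv R2 (fun b => (-1) ^+ b *: tdL (tad_iter u b)) n.+1) =
  (n`!%:R)^-1 *: cp2 (tder2 (rho u) (iter n R2 (tdL w))).
Proof.
have hc := flin_cp2 K.
elim: n u => [|n IH] u.
  rewrite -(linZ hc.1) (exp_convS charK0) // (tad_iterS (@tdL K)) exp_convN //.
  rewrite /exp_conv !big_ord1 !dpow0 invr1 !scale1r (linB hc.1) -tDivE tDiv_tad.
  by rewrite opprB addrC subrK.
have {}IH u' : cp2 (exp_conv R2 (fun b => (-1) ^+ b *: tdL (tad_iter u' b)) n.+1) =
    cp2 (((n.+1`!%:R)^-1) *: tder2 (rho u') (iter n R2 (tdL w))).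
  apply: (@scale_natS_inj _ charK0 _ n); rewrite IH (linZ hc.1) scalerA; congr (_ *: _).
  by rewrite (factS_inv charK0).
have hu := flin_tder2 (flin_rho u).
rewrite -(linZ hc.1) (exp_convS charK0) // (tad_iterS (@tdL K)) exp_convN //.
rewrite (linB hc.1) (tder2_cp2 fw (@deriv_rho _ w) (IH u)) (IH (tad w u)).
rewrite -(linB hc.1) -/(R2 _) (linZ hR2.1) -scalerBr (linZ hc.1); congr (_ *: cp2 _).
by rewrite iterS tder2_tad -/R2 opprB addrC subrK.
Qed.

(** Integrates [exp_conv_tdL] from s = 0 to 1. As w is primitive, tDiv(w) is the class of Dt of
    [div_lift], and Dt commutes with rho(w), so the integral becomes Dt of a representative of j(exp
    w). *)
Lemma tDiv_conj_tuple u : cp2 (tmap2 (expo (rho w)) (tdL (conj_tuple u))) =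
  tDiv u + cp2 (tder2 (rho u) (tcop (exp_int w div_lift 1))).
Proof.
have hc := flin_cp2 K; have hu := flin_tder2 (flin_rho u); have ht := flin_tcop K.
pose e b := (-1) ^+ b *: tdL (tad_iter u b).
have fe b : fil b (e b).
  apply: filZ; apply: fil_sum => i _; case: b => [|b]; first exact: filA2_0.
  by rewrite -[X in fil X _]addn1; exact: (fil_omul (fil_pder i (@fil_tad_iter u b.+1 i)) (fil_tdif (fil_gen K i))).
have S0 : is_sum (fun b => (b`!%:R)^-1 *: e b) (tdL (conj_tuple u)).
  have := is_sum_tdL (conj_tuple_sum u); apply: eq_is_sum => b.
  by rewrite !tdLZ.
have S1 := is_sum_flin hc (exp_conv_sum hR2 rR2 fe S0).
have S2 := is_sum_flin hc (is_sum_flin hu (is_sum_flin ht (@exp_int_sum _ w div_lift pw 1))).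
have T0 : cp2 (exp_conv R2 e 0) = tDiv u.
  by rewrite tDivE /exp_conv big_ord1 /e !dpow0 invr1 !scale1r.
have T n : cp2 (exp_conv R2 e n.+1) =
    cp2 (tder2 (rho u) (tcop ((1 ^+ n.+1 / n.+1`!%:R) *: iter n (rho w) div_lift))).
  apply: (@scale_natS_inj _ charK0 _ n); rewrite exp_conv_tdL.
  rewrite (linZ ht.1) (linZ hu.1) (linZ hc.1) scalerA expr1n div1r (factS_inv charK0).
  congr (_ *: _); apply: (tder2_cp2 (flin_rho u) (@deriv_rho _ u)).
  elim: n => [|n IH]; first by rewrite -tDivE tDiv_primitive.
  by rewrite /= tcop_rho; apply: (tder2_cp2 fw (@deriv_rho _ w)).
rewrite tmap2_expo; apply: (sep_eq (@cyc2_sep K)) => N.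
have := filB (cyc2_filW (leqnSn N) (S1 N.+1)) (S2 N).
rewrite big_ord_recl T0 (eq_bigr (fun k : 'I_N => cp2 (tder2 (rho u)
  (tcop ((1 ^+ k.+1 / k.+1`!%:R) *: iter k (rho w) div_lift))))) => [|k _]; last exact: T.
by rewrite opprB !opprD !addrA subrK.
Qed.

End Conjugation.

(** * The coordinates Gam *)

Section ClosedSubspaces.
Variable K : fieldType.
Notation A := 'A[K].
Implicit Types (a b c : A) (i : 'I_2).

Lemma closed_sub0 (V : filtModType K) (P : V -> Prop) u : closed_sub P -> P u -> P 0.
Proof. by move=> [lP _] Pu; have := lP (-1) u u Pu Pu; rewrite scaleN1r addNr. Qed.

Lemma closed_subD (V : filtModType K) (P : V -> Prop) u v :
  closed_sub P -> P u -> P v -> P (u + v).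
Proof. by move=> [lP _] Pu Pv; rewrite -[u]scale1r; apply: lP. Qed.

Lemma closed_subZ (V : filtModType K) (P : V -> Prop) (k : K) u :
  closed_sub P -> P u -> P (k *: u).
Proof. by move=> cP Pu; rewrite -[_ *: _]addr0; apply: cP.1 => //; apply: closed_sub0 cP Pu. Qed.

Lemma closed_sub_sum (V : filtModType K) (P : V -> Prop) (c : nat -> V) s :
  closed_sub P -> (forall n, P (c n)) -> is_sum c s -> P s.
Proof.
move=> cP Pc h; apply: cP.2 => N; exists (\sum_(k < N) c k); last exact: h.
elim/big_rec: _ => [|k v _ Pv]; first exact: closed_sub0 cP (Pc 0%N).
exact: closed_subD.
Qed.

Lemma closed_sub_all (I : Type) (V : filtModType K) (P : I -> V -> Prop) :
  (forall x, closed_sub (P x)) -> closed_sub (fun v => forall x, P x v).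
Proof.
move=> h; split=> [k u v hu hv x|v hv x]; first by apply: (h x).1.
by apply: (h x).2 => N; have [p hp e] := hv N; exists p.
Qed.

Lemma closed_sub_preim (U : complModType K) (V : filtModType K) (f : U -> V) (P : V -> Prop) :
  clin f -> closed_sub P -> closed_sub (fun u => P (f u)).
Proof.
move=> [lf cf] [lP cP]; split=> [k u v hu hv|u hu]; first by rewrite lf; apply: lP.
apply: cP => N; have [M hM] := cf N; have [p hp e] := hu M; exists (f p) => //.
by rewrite -linB //; apply: hM.
Qed.

Lemma commute_gen_nil a i j x : gen K i * a = a * gen K i -> j != i -> a (rcons x j) = 0.
Proof.
move=> h ne; have := congr1 (fun b : A => b (i :: rcons x j)) h.
by rewrite gen_mulE eqxx mul1r -rcons_cons mul_genE (negbTE ne) mul0r.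
Qed.

Lemma commute_gen_rot a i x : gen K i * a = a * gen K i -> a (i :: x) = a (rcons x i).
Proof.
move=> h; have := congr1 (fun b : A => b (i :: rcons x i)) h.
by rewrite gen_mulE -rcons_cons mul_genE eqxx !mul1r.
Qed.

Lemma genXE i n x : (gen K i ^+ n) x = (x == nseq n i)%:R.
Proof.
elim: n x => [|n IH] x; first by rewrite expr0 ncs1E.
rewrite exprS gen_mulE; case: x => [|j x] //=.
by rewrite IH eqseq_cons -natrM mulnb.
Qed.

Lemma nseqSr n i : nseq n.+1 i = rcons (nseq n i) i.
Proof. by rewrite -cats1 -(nseqD n 1) addn1. Qed.

Lemma commute_gen_cat a i n x : gen K i * a = a * gen K i ->
  a (x ++ nseq n i) = a (nseq n i ++ x).
Proof.
move=> h; elim: n x => [|n IH] x; first by rewrite cats0.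
have e y : y ++ nseq n.+1 i = rcons (y ++ nseq n i) i.
  by rewrite nseqSr rcons_cat.
by rewrite e -commute_gen_rot // -cat_cons IH -cat_rcons nseqSr.
Qed.

Lemma nseq_or_rcons i (x : seq 'I_2) : x = nseq (size x) i \/
  exists y j n, j != i /\ x = rcons y j ++ nseq n i.
Proof.
elim/last_ind: x => [|x j IH]; first by left.
have [->|ne] := eqVneq j i; last by right; exists x, j, 0%N; rewrite cats0.
case: IH => [e|[y [k [n [ne ->]]]]].
  by left; rewrite size_rcons nseqSr -e.
by right; exists y, k, n.+1; rewrite nseqSr rcons_cat.
Qed.

(** Coefficients of a do not change when a letter i is rotated around the word, and they vanish on
    words ending in another letter. Rotating trailing letters i to the front leaves only the powers
    of x_i. *)
Lemma commute_gen_sum a i : gen K i * a = a * gen K i ->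
  is_sum (fun n => a (nseq n i) *: gen K i ^+ n) a.
Proof.
move=> h N; apply/filA => x l; rewrite ncsDE ncsNE ncs_sumE.
have [e|[y [j [n [ne e]]]]] := nseq_or_rcons i x; last first.
  rewrite {1}e commute_gen_cat // -rcons_cat (commute_gen_nil _ h ne) sub0r big1 ?oppr0 // => k _.
  rewrite ncsZE genXE [x == _](_ : _ = false) ?scaler0 // e; apply/eqP => /(congr1 (fun s => j \in s)).
  by rewrite mem_cat mem_rcons mem_head !mem_nseq (negbTE ne) !andbF.
rewrite (bigD1 (Ordinal l)) //= ncsZE genXE -e eqxx [_ *: _]mulr1 opprD addrA subrr sub0r.
rewrite big1 ?oppr0 // => k; rewrite -val_eqE /= => ne.
rewrite ncsZE genXE [x == _](_ : _ = false) ?scaler0 //; apply/eqP => /(congr1 size).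
by rewrite size_nseq => E; rewrite E eqxx in ne.
Qed.

End ClosedSubspaces.

Section Coordinates.
Variable K : fieldType.
Hypothesis charK0 : [pchar K] =i pred0.
Notation A := 'A[K].
Notation A2 := 'A2[K].
Implicit Types (a b c : A) (s t : A2) (i j : 'I_2).
Variable G : 'I_2 -> A.
Hypothesis gG : forall i, grouplike (G i).

Let G1 i : G i [::] = 1 := (gG i).2.

Definition phi := tact G.
Lemma ahom_phi : ahom phi. Proof. exact: ahom_tact. Qed.
Let fphi : flin phi. Proof. by case: ahom_phi. Qed.
Let rphi : raising (fun a => a - phi a). Proof. exact: raising_tact. Qed.

Definition Gam : 'I_2 -> A := locked (fun i => phi (sexp (gen K i))).
Lemma GamE i : Gam i = phi (sexp (gen K i)). Proof. by rewrite /Gam -lock. Qed.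

Lemma grouplike_Gam i : grouplike (Gam i).
Proof.
rewrite GamE.
have pphi : forall j, primitive (phi (gen K j)).
  by move=> j; rewrite /phi tact_gen //; apply: primitive_conj (gG j) (primitive_gen K j).
have [ge e1] := grouplike_sexp charK0 (primitive_gen K i); split.
  by rewrite (coprod_ahom ahom_phi pphi) ge tmap2_tens.
have: fil 1 (sexp (gen K i) - 1) by apply/fil_sub_sym/fil_sub1.
have [_ p1 _] := ahom_phi.
move/fphi.2; rewrite (linB fphi.1) p1 => /filA1; rewrite ncsDE ncsNE ncs1E => /eqP.
by rewrite subr_eq0 => /eqP.
Qed.

Lemma Gam_nil i : Gam i [::] = 1. Proof. exact: (grouplike_Gam i).2. Qed.

Lemma fil2_sexp a : fil 1 a -> fil 2 (sexp a - 1 - a).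
Proof.
move=> h; rewrite sexpE.
have r : raising (twist a (fun=> 0)) by apply: raising_twist h (@raising0 K).
have := expo_sum r 1 2; rewrite !big_ord_recl big_ord0 addr0 dpow0 /dpow /= invr1 scale1r.
by rewrite /twist mulr1 addr0 opprD addrA.
Qed.

(** Since Gam_i - 1 = x_i + higher terms, psi is a unipotent automorphism and the Gam_i - 1 are free
    topological generators. Calculus in the coordinates Gam is transported along psi. *)
Definition psi : A -> A := hsubst (fun i => Gam i - 1).

Lemma fil_Gam1 i : fil 1 (Gam i - 1).
Proof. exact/fil_sub_sym/fil_sub1/Gam_nil. Qed.

Lemma ahom_psi : ahom psi.
Proof. exact/ahom_hsubst/fil_Gam1. Qed.
Let fpsi : flin psi. Proof. by case: ahom_psi. Qed.

Lemma psi_gen i : psi (gen K i) = Gam i - 1.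
Proof. exact/hsubst_gen/fil_Gam1. Qed.

Lemma raising_psi : raising (fun a => a - psi a).
Proof.
apply: ahom_unipotent ahom_psi _ => i; rewrite psi_gen; apply: fil_sub_sym.
have [_ p1 _] := ahom_phi.
have -> : Gam i - 1 - gen K i = phi (sexp (gen K i) - 1 - gen K i) - (gen K i - phi (gen K i)).
  by rewrite (linB fphi.1 (_ - _)) (linB fphi.1 (sexp _)) p1 GamE; abel1.
apply: filB; first exact/fphi.2/fil2_sexp/fil_gen.
by rewrite /phi tact_gen //; apply: fil2_conj.
Qed.

Definition psiV := uinv psi.
Lemma psiVK : cancel psiV psi. Proof. exact: uinvK fpsi raising_psi. Qed.
Lemma psiK : cancel psi psiV. Proof. exact: uinvK' fpsi raising_psi. Qed.
Lemma ahom_psiV : ahom psiV. Proof. exact: ahom_uinv fpsi raising_psi ahom_psi. Qed.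
Let fpsiV : flin psiV. Proof. by case: ahom_psiV. Qed.

Lemma psiV_Gam i : psiV (Gam i) = 1 + gen K i.
Proof.
have [_ p1 _] := ahom_psi.
by rewrite -[RHS]psiK (linD fpsi.1) p1 psi_gen addrC subrK.
Qed.

Lemma Gam_ind (P : A -> Prop) : closed_sub P -> P 1 ->
  (forall i a, P a -> P (Gam i * a)) -> forall a, P a.
Proof.
move=> cP P1 PG a; rewrite -[a]psiVK; move: (psiV a); have [_ p1 pM] := ahom_psi.
apply: A_ind => [||i b Pb].
- split=> [k x y hx hy|x hx]; first by rewrite fpsi.1; apply: cP.1.
  apply: cP.2 => N; have [p hp e] := hx N; exists (psi p) => //.
  by rewrite -(linB fpsi.1); apply: fpsi.2.
- by rewrite p1.
rewrite pM psi_gen mulrBl mul1r; apply: closed_subD => //; first exact: PG.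
by rewrite -scaleN1r; apply: closed_subZ.
Qed.

Definition Gword (w : seq 'I_2) : A := \prod_(i <- w) Gam i.

Lemma Gword_cons i w : Gword (i :: w) = Gam i * Gword w.
Proof. by rewrite /Gword big_cons. Qed.
Lemma Gword_nil : Gword [::] = 1.
Proof. by rewrite /Gword big_nil. Qed.

(** Positive words are already dense, so kappa, mu and delta are tested on products of the gamma_i
    only. *)
Lemma Gword_dense (P : A -> Prop) : closed_sub P -> (forall w, P (Gword w)) -> forall a, P a.
Proof.
move=> cP Pw a; move: a P cP Pw; apply: Gam_ind => [|P cP Pw|i a Qa P cP Pw].
- split=> [k x y hx hy P cP Pw|x hx P cP Pw]; first by apply: cP.1; [apply: hx | apply: hy].
  by apply: cP.2 => N; have [p hp e] := hx N; exists p => //; apply: hp.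
- by rewrite -Gword_nil.
apply: (Qa (fun x => P (Gam i * x))); first by apply: closed_sub_preim => //; clin.
by move=> w; rewrite -Gword_cons.
Qed.

(** The double partial derivative with respect to Gam_i; the constant 1 in Gam_i - 1 is killed by
    any double derivation. *)
Definition dG : 'I_2 -> A -> A2 := locked (fun i a => tmap2 psi (pder i (psiV a))).
Lemma dGE i a : dG i a = tmap2 psi (pder i (psiV a)). Proof. by rewrite /dG -lock. Qed.

Lemma clin_dG i : clin (dG i).
Proof.
have h2 := flin_tmap2 fpsi; rewrite (_ : dG i = fun a => tmap2 psi (pder i (psiV a))).
  apply: clin_comp (flin_clin h2) _.
  exact: clin_comp (clin_pder K i) (flin_clin fpsiV).
by apply: funext => a; rewrite dGE.
Qed.

Lemma dder_dG i : dder (dG i).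
Proof.
move=> a b; have [_ p1 pM] := ahom_psiV; have h2 := flin_tmap2 fpsi; have [_ q1 _] := ahom_psi.
by rewrite !dGE pM pderM (linD h2.1) !(tmap2M _ _ ahom_psi) !tmap2_tens // !psiVK q1.
Qed.

Lemma dG_Gam i j : dG i (Gam j) = (i == j)%:R.
Proof.
have h2 := flin_tmap2 fpsi; have [_ q1 _] := ahom_psi.
rewrite dGE psiV_Gam (linD (clin_pder K i).1) (dder1 (@dder_pder K i)) add0r pder_gen.
case: (i == j); rewrite ?mulr0n ?(lin0 h2.1) //.
by rewrite mulr1n -tens11 tmap2_tens // q1.
Qed.

Lemma dder_eqG (D D' : A -> A2) a : clin D -> clin D' -> dder D -> dder D' ->
  (forall i, D (Gam i) = D' (Gam i)) -> D a = D' a.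
Proof.
move=> cD cD' dD dD' e; apply: (Gam_ind (closed_sub_eq (@A2_sep K) cD cD')) a => [|i a ea].
  by rewrite !dder1.
by rewrite dD dD' e ea.
Qed.

Lemma dder_expandG (D : A -> A2) a : clin D -> dder D ->
  D a = \sum_i dG i a ** D (Gam i).
Proof.
move=> cD dD; apply: (dder_eqG (D' := fun a => \sum_i dG i a ** D (Gam i))) => // [||j].
- by apply: clin_sum => i; apply: clin_comp (flin_clin (flin_omulr _)) (clin_dG i).
- by apply: dder_sum => i; apply/dder_omulr/dder_dG.
rewrite (bigD1 j) //= big1 => [|i /negbTE iNj]; rewrite dG_Gam ?eqxx ?iNj.
  by rewrite addr0 omul1r.
exact: (lin0 (flin_omulr _).1).
Qed.

Lemma deriv_expandG (v : A -> A) a : clin v -> derivation v ->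
  v a = \sum_i sand (dG i a) (v (Gam i)).
Proof.
move=> cv dv.
have cs : clin (fun a => \sum_i sand (dG i a) (v (Gam i))).
  by apply: clin_sum => i; apply: clin_comp (flin_clin (flin_sandl _)) (clin_dG i).
apply: (Gam_ind (closed_sub_eq (@A_sep K) cv cs)) a => [|i a ea].
  rewrite deriv1 // big1 // => i _.
  by rewrite (dder1 (@dder_dG i)) (lin0 (flin_sandl _).1).
rewrite dv ea mulr_sumr.
under [RHS]eq_bigr => k _ do rewrite dder_dG (linD (flin_sandl _).1) dG_Gam.
rewrite big_split; congr (_ + _); last first.
  by apply: eq_bigr => k _; rewrite -omul_tens1 sand_omul sand_tens mulr1.
rewrite (bigD1 i) //= big1 => [|k /negbTE ne]; last first.
  by rewrite ne mulr0n mul0r (lin0 (flin_sandl _).1).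
by rewrite eqxx mulr1n mul1r addr0 sand_tens mul1r.
Qed.

(** The series e^{x_j} involves only x_j, so the expansion of [tdif (sexp (gen K j))] has a single
    term. *)
Lemma pder_sexp i j : pder i (sexp (gen K j)) ** tdif (gen K i) =
  if i == j then tdif (sexp (gen K j)) else 0.
Proof.
have z k : k != j -> pder k (sexp (gen K j)) = 0.
  move=> ne.
  have cP := closed_sub_eq (@A2_sep K) (clin_pder K k) (@clin0 _ _ 'A2[K]).
  have r : raising (twist (gen K j) (fun=> 0)) by apply: raising_twist (fil_gen K j) (@raising0 K).
  rewrite sexpE; apply: (closed_sub_sum cP _ (expo_sum r 1)) => n; apply: (closed_subZ _ cP).
  elim: n => [|n IH]; first exact: (dder1 (@dder_pder K k)).
  rewrite iterS /twist addr0 pderM IH pder_gen (negbTE ne) mulr0n mul0r mulr0.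
  exact: addr0.
case: eqP => [->|/eqP ne]; last by rewrite z // (lin0 (flin_omulr _).1).
rewrite [RHS]tdif_expand (bigD1 j) //= big1 ?addr0 // => k ne.
by rewrite z // (lin0 (flin_omulr _).1).
Qed.

Definition phiV := uinv phi.
Lemma phiVK : cancel phiV phi. Proof. exact: uinvK fphi rphi. Qed.
Lemma phiK : cancel phi phiV. Proof. exact: uinvK' fphi rphi. Qed.
Lemma ahom_phiV : ahom phiV. Proof. exact: ahom_uinv fphi rphi ahom_phi. Qed.

(** Under phi the operators [pder i] and [dG i] do not correspond, but their products with [tdif]
    do: both sides are double derivations and agree on Gam_j by [pder_sexp]. *)
Lemma tmap2_phi_pder i a :
  tmap2 phi (pder i (phiV a) ** tdif (gen K i)) = dG i a ** tdif (Gam i).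
Proof.
have [fV V1 VM] := ahom_phiV; have h2 := flin_tmap2 fphi; have [_ p1 _] := ahom_phi.
apply: (dder_eqG (D := fun a => tmap2 phi (pder i (phiV a) ** tdif (gen K i)))
  (D' := fun a => dG i a ** tdif (Gam i))) => [||b c||j].
- apply: clin_comp (flin_clin h2) _; apply: clin_comp (flin_clin (flin_omulr _)) _.
  exact: clin_comp (clin_pder K i) (flin_clin fV).
- exact: clin_comp (flin_clin (flin_omulr _)) (clin_dG i).
- rewrite VM dderE; last exact: dder_pder.
  rewrite omulDl -!omulA (linD h2.1) !(tmap2_omul _ _ ahom_phi) !tmap2_tens // !phiVK p1.
  by rewrite omul_1tens omul_tens1.
- exact/dder_omulr/dder_dG.
rewrite GamE phiK pder_sexp -GamE dG_Gam eq_sym.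
case: eqP => [->|_]; last by rewrite (lin0 h2.1) mulr0n (lin0 (flin_omulr _).1).
by rewrite GamE tmap2_tdif ?mulr1n ?omul1r //; apply: ahom_phi.
Qed.

Lemma commute_Gam_sum a i : Gam i * a = a * Gam i ->
  is_sum (fun n => (psiV a) (nseq n i) *: (Gam i - 1) ^+ n) a.
Proof.
move=> h; have [_ p1 pM] := ahom_psi; have [_ q1 qM] := ahom_psiV.
have : gen K i * psiV a = psiV a * gen K i.
  have := congr1 psiV h; rewrite !qM psiV_Gam (mulrDl 1) (mulrDr _ 1) mul1r mulr1.
  exact: addrI.
move/commute_gen_sum/(is_sum_flin fpsi); rewrite psiVK; apply: eq_is_sum => n.
rewrite (linZ fpsi.1); congr (_ *: _); elim: n => [|n IH]; first by rewrite !expr0 p1.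
by rewrite !exprS pM IH psi_gen.
Qed.

End Coordinates.

(** * The Hamiltonian derivation *)

Lemma sum_I2 (V : nmodType) (F : 'I_2 -> V) : \sum_i F i = F ord0 + F ord_max.
Proof.
rewrite big_ord_recr big_ord1; congr (F _ + _); exact: val_inj.
Qed.

Lemma I2_cases (i : 'I_2) : i = ord0 \/ i = ord_max.
Proof. by case: i => [[|[|//]] h]; [left | right]; apply: val_inj. Qed.

Section TensorValues.
Variable K : fieldType.
Implicit Types a b : 'A[K].

Lemma kap_diag_tswap a : tswap (tens 1 (a * a) - tens a a) = tens a 1 ** tdif a.
Proof.
have ht := flin_tswap K.
by rewrite (linB ht.1) !tswap_tens !tdifE omulBr !omul_tens !mulr1.
Qed.

Lemma kap_off_tswap a b :
  tswap (tens 1 (b * a) + tens (a * b) 1 - tens b a - tens a b) = tdif b ** tdif a.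
Proof.
have ht := flin_tswap K.
rewrite !(linB ht.1) (linD ht.1) !tswap_tens !tdifE omulBl !omulBr !omul_tens.
by rewrite !mulr1 !mul1r; abel2.
Qed.
End TensorValues.

(** What is retained of kappa_theta: product rules on positive words and values on generators. By
    density [dder_kap] and [dder_kapl] extend the rules to A. *)
Record intersection_op (K : fieldType) (G : 'I_2 -> 'A[K]) (kap : 'A2[K] -> 'A2[K]) : Prop := {
  ik_clin : clin kap;
  ik_mulr : forall u v w, kap (tens (Gword G u) (Gword G v * Gword G w)) =
    kap (tens (Gword G u) (Gword G v)) * tens 1 (Gword G w)
    + tens (Gword G v) 1 * kap (tens (Gword G u) (Gword G w));
  ik_mull : forall u v w, kap (tens (Gword G u * Gword G v) (Gword G w)) =
    kap (tens (Gword G u) (Gword G w)) * tens (Gword G v) 1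
    + tens 1 (Gword G u) * kap (tens (Gword G v) (Gword G w));
  ik_diag : forall i, kap (tens (Gam G i) (Gam G i)) =
    tens 1 (Gam G i * Gam G i) - tens (Gam G i) (Gam G i);
  ik_01 : kap (tens (Gam G ord0) (Gam G ord_max)) = 0;
  ik_10 : kap (tens (Gam G ord_max) (Gam G ord0)) =
    tens 1 (Gam G ord_max * Gam G ord0) + tens (Gam G ord0 * Gam G ord_max) 1
    - tens (Gam G ord_max) (Gam G ord0) - tens (Gam G ord0) (Gam G ord_max)
}.

Section Intersection.
Variable K : fieldType.
Hypothesis charK0 : [pchar K] =i pred0.
Notation A := 'A[K].
Notation A2 := 'A2[K].
Implicit Types (a b c : A) (s t : A2) (i j : 'I_2).
Variable G : 'I_2 -> A.
Hypothesis gG : forall i, grouplike (G i).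
Let G1 i : G i [::] = 1 := (gG i).2.

Notation Gam := (Gam G).
Notation Gword := (Gword G).
Notation dG := (dG G).
Notation phi := (phi G).

Variable kap : A2 -> A2.
Hypothesis ik : intersection_op G kap.
Let ckap := ik_clin ik.
Let kap_mulr := ik_mulr ik.
Let kap_mull := ik_mull ik.
Let kap_diag := ik_diag ik.
Let kap01 := ik_01 ik.
Let kap10 := ik_10 ik.

Let ckr a : clin (fun b => kap (tens a b)).
Proof. by clin. Qed.
Let ckl b : clin (fun a => kap (tens a b)).
Proof. by clin. Qed.

Lemma dder_kap a : dder (fun b => kap (tens a b)).
Proof.
move=> b c; have dense := Gword_dense charK0 gG.
move: a; apply: (dense) => [|u].
  apply: closed_sub_eq (@A2_sep K) (ckl _) _.
  by have h1 := ckl b; have h2 := ckl c; clin.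
move: b; apply: (dense) => [|v].
  apply: closed_sub_eq (@A2_sep K) _ _.
    by apply: clin_comp (ckr _) _; clin.
  by have h := ckr (Gword u); clin.
move: c; apply: (dense) => [|w]; last exact: kap_mulr.
apply: closed_sub_eq (@A2_sep K) _ _.
  by apply: clin_comp (ckr _) _; clin.
by have h := ckr (Gword u); clin.
Qed.

Lemma dder_kapl c : dder (fun a => tswap (kap (tens a c))).
Proof.
move=> a b; have dense := Gword_dense charK0 gG; have ht := flin_tswap K.
have e : kap (tens (a * b) c) = kap (tens a c) * tens b 1 + tens 1 a * kap (tens b c).
  move: a; apply: (dense) => [|u].
    apply: closed_sub_eq (@A2_sep K) _ _.
      by apply: clin_comp (ckl _) _; clin.
    by have h := ckl c; clin.
  move: b; apply: (dense) => [|v].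
    apply: closed_sub_eq (@A2_sep K) _ _.
      by apply: clin_comp (ckl _) _; clin.
    by have h := ckl c; clin.
  move: c; apply: (dense) => [|w]; last exact: kap_mull.
  apply: closed_sub_eq (@A2_sep K) (ckr _) _.
  by have h1 := ckr (Gword u); have h2 := ckr (Gword v); clin.
by rewrite e (linD ht.1) !tswapM !tswap_tens.
Qed.

(** Solves [kap_Gam]. The indices behave differently because kappa(gamma_0, gamma_1) = 0 while
    kappa(gamma_1, gamma_0) is not: for j = 0 the term dG_1 a ** tdif Gam_1 is replaced by tdif a -
    dG_0 a ** tdif Gam_0. *)
Definition ham_t : 'I_2 -> A -> A2 := locked (fun j a => if j == ord0 then tdif a + dG ord0 a ** tens 1 (Gam ord0)
  else dG ord_max a ** tens (Gam ord_max) 1).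
Lemma ham_t0 a : ham_t ord0 a = tdif a + dG ord0 a ** tens 1 (Gam ord0).
Proof. by rewrite /ham_t -lock. Qed.
Lemma ham_t1 a : ham_t ord_max a = dG ord_max a ** tens (Gam ord_max) 1.
Proof. by rewrite /ham_t -lock. Qed.

Lemma tdif_expandG a :
  tdif a = dG ord0 a ** tdif (Gam ord0) + dG ord_max a ** tdif (Gam ord_max).
Proof.
rewrite (dder_expandG charK0 gG a (flin_clin (flin_tdif K)) (@dder_tdif K)).
exact: sum_I2.
Qed.

Lemma clin_ham_t j : clin (ham_t j).
Proof.
have h0 := clin_dG charK0 gG ord0; have h1 := clin_dG charK0 gG ord_max.
have ht := flin_tdif K.
case: (I2_cases j) => ->.
  by rewrite (funext ham_t0); clin.
by rewrite (funext ham_t1); clin.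
Qed.

Lemma kap_Gam j a : kap (tens a (Gam j)) = tswap (ham_t j a ** tdif (Gam j)).
Proof.
have ht := flin_tswap K.
rewrite -[LHS]tswapK; congr tswap.
have cl : clin (fun a => tswap (kap (tens a (Gam j)))) by have h := ckl (Gam j); clin.
rewrite (dder_expandG charK0 gG a cl (dder_kapl _)) sum_I2.
have kd i : tswap (kap (tens (Gam i) (Gam i))) = tens (Gam i) 1 ** tdif (Gam i).
  by rewrite kap_diag kap_diag_tswap.
have k10 : tswap (kap (tens (Gam ord_max) (Gam ord0))) = tdif (Gam ord_max) ** tdif (Gam ord0).
  by rewrite kap10 kap_off_tswap.
case: (I2_cases j) => ->.
  have -> : ham_t ord0 a = dG ord0 a ** tens (Gam ord0) 1 + dG ord_max a ** tdif (Gam ord_max).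
    rewrite ham_t0 tdif_expandG addrAC -omulDr; congr (_ ** _ + _).
    by rewrite !tdifE subrK.
  by rewrite kd k10 !omulA omulDl.
rewrite ham_t1 kap01 (lin0 ht.1) (lin0 (flin_omull _).1) add0r kd omulA.
by [].
Qed.

Definition ham_u : 'I_2 -> A -> A := locked (fun j a => - tmult (tswap (ham_t j a))).
Lemma ham_uE j a : ham_u j a = - tmult (tswap (ham_t j a)). Proof. by rewrite /ham_u -lock. Qed.

Lemma clin_ham_u j : clin (ham_u j).
Proof. by have h := clin_ham_t j; rewrite (funext (ham_uE j)); clin. Qed.

Lemma tswap_omul_tdif s a : tswap (s ** tdif a) = - (tdif a ** tswap s).
Proof.
have ht := flin_tswap K.
move: s; apply: (A2_eq (@A2_sep K)) => [||b c]; [clin | clin |].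
rewrite tswap_tens !tdifE omulBr omulBl (linB ht.1) !omul_tens !tswap_tens !mulr1 !mul1r.
by rewrite opprB.
Qed.

Lemma kap_GamE j a : kap (tens a (Gam j)) = - (tdif (Gam j) ** tswap (ham_t j a)).
Proof. by rewrite kap_Gam tswap_omul_tdif. Qed.

Definition ham_der : A -> A -> A := locked (fun a b => tmult (kap (tens a b))).
Lemma ham_derE a b : ham_der a b = tmult (kap (tens a b)). Proof. by rewrite /ham_der -lock. Qed.

Lemma clin_ham_der a : clin (ham_der a).
Proof. by have h := ckr a; rewrite (funext (ham_derE a)); clin. Qed.
Lemma derivation_ham a : derivation (ham_der a).
Proof.
move=> b c; rewrite !ham_derE dder_kap (linD (flin_tmult K).1).
by rewrite tmult_mulr tmult_mull.
Qed.

Lemma ham_der_Gam a j : ham_der a (Gam j) = Gam j * ham_u j a - ham_u j a * Gam j.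
Proof.
rewrite !ham_derE kap_GamE (linN (flin_tmult K).1) tmult_tdif_omul ham_uE.
by rewrite mulrN mulNr opprB opprK addrC.
Qed.

(** The cyclic derivative with respect to Gam_i: p (x) q in dG_i a contributes qp. *)
Definition cder : 'I_2 -> A -> A := locked (fun i a => tmult (tswap (dG i a))).
Lemma cderE i a : cder i a = tmult (tswap (dG i a)). Proof. by rewrite /cder -lock. Qed.

Lemma tmult_tswap_tdif s a : tmult (tswap (s ** tdif a)) =
  tmult (tswap s) * a - a * tmult (tswap s).
Proof.
rewrite tswap_omul_tdif (linN (flin_tmult K).1) tmult_tdif_omul opprB.
by [].
Qed.

(** Swap and multiply the factors in the expansion of [tdif a]: the left side becomes 1a - a1 =
    0. *)
Lemma cder_bracket a : \sum_i (cder i a * Gam i - Gam i * cder i a) = 0.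
Proof.
rewrite sum_I2 !cderE -!tmult_tswap_tdif -(linD (flin_tmult K).1) -(linD (flin_tswap K).1).
rewrite -tdif_expandG !tdifE (linB (flin_tswap K).1) !tswap_tens (linB (flin_tmult K).1).
by rewrite !tmult_tens mulr1 mul1r subrr.
Qed.

Lemma ham_u0 a : ham_u ord0 a = - (Gam ord0 * cder ord0 a).
Proof.
have ht := flin_tswap K; have hm := flin_tmult K.
rewrite ham_uE ham_t0 (linD ht.1) (linD hm.1) !tdifE (linB ht.1) (linB hm.1).
rewrite !tswap_tens !tmult_tens mul1r mulr1 subrr add0r; congr (- _); rewrite cderE.
set t := dG _ _; have cm := clin_comp (flin_clin hm) (flin_clin ht).
move: t; apply: (A2_eq (@A_sep K)) => [||b c]; [clin | clin |].
by rewrite omul_tens !tswap_tens !tmult_tens mulr1 -mulrA.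
Qed.

Lemma ham_u1 a : ham_u ord_max a = - (cder ord_max a * Gam ord_max).
Proof.
have ht := flin_tswap K; have hm := flin_tmult K.
rewrite ham_uE ham_t1; congr (- _); rewrite cderE.
set t := dG _ _.
move: t; apply: (A2_eq (@A_sep K)) => [||b c]; [clin | clin |].
by rewrite omul_tens !tswap_tens !tmult_tens mul1r mulrA.
Qed.

Lemma boundary_identity (R : pzRingType) (x y d e : R) : d * x - x * d = - (e * y - y * e) ->
  (x * - (x * d) - - (x * d) * x) * y + x * (y * - (e * y) - - (e * y) * y) = 0.
Proof.
move=> h; have -> : x * - (x * d) - - (x * d) * x = x * (d * x - x * d).
  by rewrite mulNr mulrN opprK addrC mulrBr !mulrA.
have -> : y * - (e * y) - - (e * y) * y = (e * y - y * e) * y.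
  by rewrite mulNr mulrN opprK addrC mulrBl !mulrA.
by rewrite h mulrN mulNr !mulrA addNr.
Qed.

(** The value equals Gam_0 (sum of [cder_i, Gam_i]) Gam_1, which vanishes by [cder_bracket]. *)
Lemma ham_der_boundary a : ham_der a (Gam ord0 * Gam ord_max) = 0.
Proof.
have := cder_bracket a; rewrite sum_I2 => /eqP; rewrite addr_eq0 => /eqP e.
by rewrite derivation_ham !ham_der_Gam ham_u0 ham_u1 boundary_identity.
Qed.

Lemma sexp_comm i : sexp (gen K i) * gen K i = gen K i * sexp (gen K i).
Proof.
have cP : closed_sub (fun b : A => b * gen K i = gen K i * b).
  by apply: closed_sub_eq (@A_sep K) _ _; clin.
have r : raising (twist (gen K i) (fun=> 0)) by apply: raising_twist (fil_gen K i) (@raising0 K).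
rewrite sexpE; apply: (closed_sub_sum cP _ (expo_sum r 1)) => n; apply: (closed_subZ _ cP).
elim: n => [|n IH]; first by rewrite /= mul1r mulr1.
by rewrite iterS /twist addr0 -mulrA IH.
Qed.

(** For fixed t, the b with kap(a, b) = -(tdif b ** t) form a closed subalgebra. It contains Gam_i,
    and phi(x_i), which commutes with Gam_i, is a series in Gam_i - 1. *)
Lemma kap_phi_gen i a :
  kap (tens a (phi (gen K i))) = - (tdif (phi (gen K i)) ** tswap (ham_t i a)).
Proof.
have [fphi p1 pM] := ahom_phi gG.
have cP : closed_sub (fun b => kap (tens a b) = - (tdif b ** tswap (ham_t i a))).
  by apply: closed_sub_eq (@A2_sep K) (ckr a) _; have h := flin_tdif K; clin.
have P1 : kap (tens a 1) = - (tdif 1 ** tswap (ham_t i a)).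
  by rewrite (dder1 (dder_kap a)) (dder1 (@dder_tdif K)) (lin0 (flin_omulr _).1) oppr0.
have PM b c : kap (tens a b) = - (tdif b ** tswap (ham_t i a)) ->
    kap (tens a c) = - (tdif c ** tswap (ham_t i a)) ->
    kap (tens a (b * c)) = - (tdif (b * c) ** tswap (ham_t i a)).
  move=> hb hc; rewrite (dderE _ _ (dder_kap a)) hb hc (dderE _ _ (@dder_tdif K)).
  by rewrite omulDl !omulNr -!omulA opprD.
have comm : Gam i * phi (gen K i) = phi (gen K i) * Gam i.
  rewrite GamE -!pM; congr phi; exact: sexp_comm.
apply: (closed_sub_sum cP _ (commute_Gam_sum charK0 gG comm)) => n.
apply: (closed_subZ _ cP); elim: n => [|n IH]; first exact: P1.
rewrite exprS; apply: PM IH; rewrite -scaleN1r; apply: (closed_subD cP) (kap_GamE _ _) _.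
by rewrite scaleN1r; have := closed_subZ (-1) cP P1; rewrite scaleN1r.
Qed.

(** Obtained from x_i = G_i phi(x_i) G_i^-1 and the known value of the double derivation kap(a, -)
    at phi(x_i). Swapped, it is the tuple c_i that defines {|a|, -}. *)
Definition ham_s : 'I_2 -> A -> A2 := locked (fun i a =>
  tens 1 (sinv (G i)) ** kap (tens a (G i)) + tens (G i) (sinv (G i)) ** tswap (ham_t i a)).
Lemma ham_sE i a : ham_s i a =
  tens 1 (sinv (G i)) ** kap (tens a (G i)) + tens (G i) (sinv (G i)) ** tswap (ham_t i a).
Proof. by rewrite /ham_s -lock. Qed.

Lemma conj_kap_identity (D : A -> A2) (x X g h : A) t : dder D ->
  g * h = 1 -> x * g = g * X -> X * h = h * x -> D X = - (tdif X ** t) ->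
  D x = - (tdif x ** (tens 1 h ** D g + tens g h ** t)).
Proof.
move=> dD gh xg Xh DX.
have e : tens 1 g ** D x = tens 1 X ** D g + tens g 1 ** D X - tens x 1 ** D g.
  by rewrite -(dderE g X dD) -xg (dderE x g dD) addrK.
have -> : D x = tens 1 h ** (tens 1 g ** D x).
  by rewrite omulA omul_tens mulr1 gh tens11 omul1r.
rewrite e DX omulNr !(omulBr, omulDr) !omulA !omul_tens !mulr1 !mul1r.
rewrite !tdifE !omulBr !omulBl !omul_tens !mul1r !mulr1 xg Xh.
set t1 := _ ** D g; set t2 := _ ** D g; set t3 := _ ** t; set t4 := _ ** t.
by abel2.
Qed.

Lemma kap_gen i a : kap (tens a (gen K i)) = - (tdif (gen K i) ** ham_s i a).
Proof.
have e : phi (gen K i) = sinv (G i) * gen K i * G i by apply: tact_gen.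
rewrite ham_sE; apply: (conj_kap_identity (dder_kap a) _ _ _ (kap_phi_gen i a)).
- exact: mul_sinvr.
- by rewrite e !mulrA mul_sinvr // mul1r.
- by rewrite e -!mulrA mul_sinvr // mulr1.
Qed.

Lemma tdif_gen_omul_inj i s t : tdif (gen K i) ** s = tdif (gen K i) ** t -> s = t.
Proof.
move=> h; have ht := flin_tswap K.
suff: tswap (s - t) = 0 by move/(can_inj (@tswapK K)) => /eqP; rewrite subr_eq0 => /eqP.
have := @tdif_gen_free _ (fun k => if k == i then tswap (s - t) else 0) _ i.
rewrite eqxx; apply; rewrite (bigD1 i) //= eqxx big1 ?addr0 => [|k /negbTE ->]; last first.
  exact: (lin0 (flin_omulr _).1).
apply: (can_inj (@tswapK K)); rewrite tswap_omul_tdif tswapK omulBr h subrr oppr0.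
by rewrite (lin0 ht.1).
Qed.

Lemma hamE i a : ham kap a i = - tmult (ham_s i a).
Proof.
rewrite /ham /ham_rep (@xget_unique _ _ _ (fun k => tswap (ham_s k a))).
- by rewrite tswapK.
- by move=> k; rewrite kap_gen -omul_1tens -omul_tens1 tswapK tdifE omulBl opprB.
move=> c hc; apply: funext => k; apply: (can_inj (@tswapK K)); rewrite tswapK.
apply: (@tdif_gen_omul_inj k); apply: oppr_inj; rewrite -kap_gen (hc k) tdifE.
by rewrite omulBl omul_1tens omul_tens1 opprB.
Qed.

Lemma ham_der_rho a b : ham_der a b = rho (ham kap a) b.
Proof.
apply: deriv_eq (clin_ham_der a) (flin_clin (flin_rho _)) (derivation_ham a) (deriv_rho _) _ => i.
rewrite rho_gen hamE ham_derE kap_gen (linN (flin_tmult K).1) tmult_tdif_omul.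
by rewrite mulrN mulNr opprK opprB addrC.
Qed.

(** Relates the Hamiltonian tuples in the coordinates x_i and Gam_i. Its left side is the right side
    of [conj_tuple_texp], so exp(-ad w) of the first tuple is carried by phi to the second. *)
Lemma ham_G a i : ham kap a i * G i + ham_der a (G i) = G i * ham_u i a.
Proof.
have hm := flin_tmult K.
rewrite hamE ham_sE (linD hm.1) omul_1tens tmult_mulr -ham_derE.
have -> : tens (G i) (sinv (G i)) ** tswap (ham_t i a) =
    tens (G i) 1 * (tswap (ham_t i a) * tens 1 (sinv (G i))).
  by rewrite -omul_tens1 -omul_1tens omulA omul_tens !mulr1.
rewrite tmult_mull tmult_mulr mulNr mulrDl -!mulrA mul_sinvl // !mulr1 ham_uE mulrN.
by rewrite opprD addrAC addNr add0r.
Qed.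

Section Exponential.
Variable w : 'I_2 -> A.
Hypothesis pw : prim w.
Hypothesis Gw : forall i, G i = texp w i.

Lemma phi_conj_tuple a i : phi (conj_tuple w (ham kap a) i) = ham_u i a.
Proof.
have eG : G = texp w by apply: funext.
have := conj_tuple_texp charK0 pw (ham kap a) i; rewrite -Gw -ham_der_rho ham_G.
rewrite -(tact_texp charK0 pw) -eG => h.
by rewrite -[LHS]mul1r -[RHS]mul1r -(@mul_sinvl _ (G i)) // -!mulrA h.
Qed.

(** As phi = exp(rho(w)), it carries [tdL] of exp(-ad w){|a|, -} to the left side by
    [tmap2_phi_pder]; [tDiv_conj_tuple] computes the same class. *)
Lemma tDiv_ham a : \sum_i cp2 (dG i (ham_u i a) ** tdif (Gam i)) =
  tDiv (ham kap a) + cp2 (tder2 (rho (ham kap a)) (tcop (exp_int w (div_lift w) 1))).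
Proof.
have eG : G = texp w by apply: funext.
have hc := flin_cp2 K; have [fphi _ _] := ahom_phi gG; have h2 := flin_tmap2 fphi.
rewrite -(tDiv_conj_tuple charK0 pw) -(lin_sum hc.1) /tdL; congr cp2.
have -> : expo (rho w) = phi by apply: funext => b; rewrite -(tact_texp charK0 pw) -eG.
rewrite (lin_sum h2.1); apply: eq_bigr => i _.
by rewrite -phi_conj_tuple -(tmap2_phi_pder charK0 gG) phiK.
Qed.
End Exponential.
End Intersection.

(** * The center *)

Section CyclicTest.
Variable K : fieldType.
Hypothesis charK0 : [pchar K] =i pred0.
Notation A := 'A[K].
Implicit Types (a b c : A) (i j : 'I_2) (U V W x : seq 'I_2).

Lemma comm_gen_all (V : filtModType K) (f : A -> V) : separated V -> clin f ->
  (forall i a, f (gen K i * a) = f (a * gen K i)) -> forall a b, f (a * b) = f (b * a).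
Proof.
move=> sV cf h a; apply: (A_ind (P := fun a => forall b, f (a * b) = f (b * a))) => [|b|i c IH b].
- apply: closed_sub_all => b.
  by apply: (@closed_sub_eq K A V (fun a => f (a * b)) (fun a => f (b * a))) => //; clin.
- by rewrite mul1r mulr1.
by rewrite -mulrA h -mulrA IH -mulrA.
Qed.

(** Functionals on |A| that detect nonzero classes. All [size W] rotations are counted, with
    repetition when W is periodic. *)
Definition cyc_coef W a : K^o := \sum_(k < size W) a (rot k W).

Lemma clin_cyc_coef W : clin (cyc_coef W).
Proof.
apply: clin_sum => k; split=> [l a b|N]; first by rewrite ncsDE ncsZE.
exists (size W).+1 => a /filA h; rewrite h ?size_rot //; exact: fil0.
Qed.

Lemma cyc_coef_gen W i a : cyc_coef W (gen K i * a) = cyc_coef W (a * gen K i).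
Proof.
rewrite /cyc_coef; case: W => [|l W]; first by rewrite !big_ord0.
have e x : x != [::] -> (gen K i * a) x = (a * gen K i) (rot 1 x).
  by case: x => // m x _; rewrite rot1_cons gen_mulE mul_genE.
under eq_bigr => k _ do rewrite e -?size_eq0 ?size_rot //.
rewrite [LHS]big_ord_recr [RHS]big_ord_recl /= addrC; congr (_ + _).
  by rewrite -rotS // rot0 -[(size W).+1]/(size (l :: W)) rot_size.
by apply: eq_bigr => k _; rewrite -rotS //= ltnS ltnW.
Qed.

Lemma cp_cyc_coef W a b : cp a = cp b -> cyc_coef W a = cyc_coef W b.
Proof.
apply: cp_factor (clin_cyc_coef W) _; first exact: (@fil_sep _ K^o).
apply: comm_gen_all (clin_cyc_coef W) (cyc_coef_gen W); exact: (@fil_sep _ K^o).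
Qed.

Lemma genX_mulE i n a W : (gen K i ^+ n * a) (nseq n i ++ W) = a W.
Proof.
elim: n => [|n IH]; first by rewrite expr0 mul1r.
by rewrite exprS -mulrA gen_mulE /= eqxx mul1r.
Qed.

Lemma genX_mul_eq0 i n a W p : (p < n)%N -> nth i W p != i -> (gen K i ^+ n * a) W = 0.
Proof.
elim: n p W => // n IH [|p] [|l W] pn; rewrite /= ?nth_nil ?eqxx // => ne;
  rewrite exprS -mulrA gen_mulE; first by rewrite (negbTE ne) mul0r.
by rewrite (IH p) ?mulr0.
Qed.

Let x0 := @ord0 1.
Let x1 := @ord_max 1.

(* Only one rotation of the word x0^N x1 W x1 starts with x0^N as soon as N exceeds the      *)
(* length of x1 W x1.                                                                       *)
Lemma cp_genX_mul_eq0 c W : (forall N, cp (gen K x0 ^+ N * c) = 0) -> c (x1 :: rcons W x1) = 0.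
Proof.
set U := x1 :: _ => h; pose N := size U; pose R := nseq N x0 ++ U.
have := @cp_cyc_coef R (gen K x0 ^+ N * c) 0; rewrite h (lin0 (flin_cp K).1) => /(_ erefl).
rewrite (lin0 (clin_cyc_coef R).1) /cyc_coef size_cat size_nseq.
rewrite (_ : (N + size U)%N = (N + (size W).+1).+1); last by rewrite /U /= size_rcons addnS.
rewrite big_ord_recl big1 ?addr0 => [|k _]; first by rewrite rot0 genX_mulE.
have NE : N = (size W).+2 by rewrite /N /U /= size_rcons.
have sR : size R = (N + (size W).+2)%N by rewrite /R size_cat size_nseq -NE.
have lR : nth x0 R (size R).-1 = x1.
  by rewrite nth_last /R last_cat /U /= last_rcons.
have bk := ltn_ord k; rewrite lift0; move: {k} (nat_of_ord k) bk => l bl.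
(* Each rotation by l + 1 > 0 has a letter x1 among its first N: the first letter of U if l + 1 <=
   N, the last letter of R otherwise. *)
have [le|lt] := leqP l.+1 N.
  apply: (@genX_mul_eq0 _ _ _ _ (N - l.+1)); first by rewrite NE; lia.
  rewrite /rot nth_cat size_drop sR (_ : (_ < _)%N); last by rewrite NE; lia.
  by rewrite nth_drop subnKC // /R nth_cat size_nseq ltnn subnn.
apply: (@genX_mul_eq0 _ _ _ _ ((size R).-1 - l.+1)); first by rewrite sR NE; lia.
rewrite /rot nth_cat size_drop (_ : (_ < _)%N); last by rewrite sR NE; lia.
by rewrite nth_drop subnKC ?lR // sR NE; lia.
Qed.

Lemma genX_mul_cat i n a V W : size V = n ->
  (gen K i ^+ n * a) (V ++ W) = (V == nseq n i)%:R * a W.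
Proof.
elim: n V => [|n IH] [|l V] // => [_|[sV]]; first by rewrite expr0 !mul1r.
by rewrite exprS -mulrA gen_mulE /= IH // eqseq_cons mulrA -natrM mulnb.
Qed.

Lemma mul_genX_cat i n a V W : size W = n ->
  (a * gen K i ^+ n) (V ++ W) = (W == nseq n i)%:R * a V.
Proof.
elim: n W => [|n IH] W; first by case: W => // _; rewrite expr0 mulr1 mul1r cats0.
case/lastP: W => // W l; rewrite size_rcons => -[sW].
rewrite exprSr mulrA -rcons_cat mul_genE IH // nseqSr eqseq_rcons mulrA -natrM mulnb.
by rewrite andbC.
Qed.

Section Derivation.
Variable d : A -> A.
Hypothesis cd : clin d.
Hypothesis dd : derivation d.
Hypothesis d0 : d (gen K x0) = 0.
Hypothesis cpd : forall b, cp (d b) = 0.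
Let e := d (gen K x1).

Lemma derX0 n : d (gen K x0 ^+ n) = 0.
Proof.
by elim: n => [|n IH]; rewrite ?expr0 ?(deriv1 dd) // exprS dd d0 IH mul0r mulr0 addr0.
Qed.

(** Since d kills x0, x0^N d(q) = d(x0^N q) has class 0 for every N. *)
Lemma der_coef_eq0 q W : d q (x1 :: rcons W x1) = 0.
Proof.
apply: cp_genX_mul_eq0 => N; rewrite -(cpd (gen K x0 ^+ N * q)) dd derX0.
by rewrite mul0r add0r.
Qed.

(* The coefficient of x1 x0^m c x0^m x1 in d (x1 x0^m x1 x0^m x1), with m = n + 1. *)
Lemma test_identity n (c : seq 'I_2) : size c = n.+1 ->
  e c + (c == rcons (nseq n x0) x1)%:R * e (x1 :: nseq n x0)
  + (c == x1 :: nseq n x0)%:R * e (rcons (nseq n x0) x1) = 0.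
Proof.
move=> sc; pose X := gen K x0 ^+ n.+1; pose y := gen K x1.
have sn : size (nseq n.+1 x0) = n.+1 by rewrite size_nseq.
pose W := nseq n.+1 x0 ++ c ++ nseq n.+1 x0.
rewrite -(der_coef_eq0 (y * X * y * X * y) W).
have -> : d (y * X * y * X * y) = y * X * e * X * y + e * X * y * X * y + y * X * y * X * e.
  by rewrite !dd derX0 !mulr0 !addr0 -/e !mulrDl [y * X * e * _ * _ + _]addrC.
rewrite !ncsDE; congr (_ + _ + _).
- rewrite -!mulrA gen_mulE eqxx mul1r {1}/W rcons_cat genX_mul_cat // eqxx mul1r.
  by rewrite !mulrA rcons_cat -rcons_cat mul_genE eqxx mul1r mul_genX_cat // eqxx mul1r.
- rewrite -rcons_cons mul_genE eqxx mul1r {1}/W -!cat_cons catA mul_genX_cat // eqxx mul1r.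
  case/lastP: c sc @W => // c l; rewrite size_rcons => -[sc] W.
  rewrite cat_cons -rcons_cat -rcons_cons mul_genE nseqSr cat_rcons -cat_cons mul_genX_cat /= ?sc //.
  by rewrite eqseq_rcons eqseq_cons eqxx mulrA -natrM mulnb andbC.
rewrite -!mulrA gen_mulE eqxx mul1r {1}/W rcons_cat genX_mul_cat // eqxx mul1r.
case: c sc @W => // l c [sc] W; rewrite gen_mulE.
rewrite /= rcons_cat -cat_rcons genX_mul_cat ?size_rcons ?sc //.
by rewrite nseqSr eqseq_rcons eqseq_cons eqxx andbT mulrA -natrM mulnb.
Qed.

Hypothesis e0 : forall n, e (rcons (nseq n.+1 x0) x1) = 0.

Lemma three_eq0 (z : K) : z + z + z = 0 -> z = 0.
Proof.
have -> : z + z + z = z * 3%:R by ring.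
by move/eqP; rewrite mulf_eq0 (negbTE (natS_neq0 charK0 2)) orbF => /eqP.
Qed.

Lemma test_der0 b : d b = 0.
Proof.
(* The constant term comes from d(x1^3), where it occurs three times. For longer words, [e0] leaves
   at most one term of [test_identity], except at c = x1, where three equal terms remain. *)
have e_eq0 : e = 0.
  apply: funext => c; rewrite ncs0E; case s : (size c) => [|n].
    rewrite (size0nil s); apply: three_eq0.
    rewrite -[RHS](der_coef_eq0 (gen K x1 * gen K x1 * gen K x1) [::]) !dd -/e.
    rewrite !mulrDl !ncsDE -!mulrA [in RHS]gen_mulE [gen K x1 * (gen K x1 * e)]mulrA.
    rewrite -[gen K x1 * gen K x1 * e]mulrA !gen_mulE eqxx !mul1r.
    have E1 a : (a * gen K x1) [:: x1] = a [::].
      by rewrite -[[:: x1]]/(rcons [::] x1) mul_genE eqxx mul1r.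
    by rewrite E1 /= mulrA -[[:: x1; x1]]/(rcons [:: x1] x1) mul_genE E1 eqxx mul1r.
  have := test_identity s; have [->|ne] := eqVneq c (rcons (nseq n x0) x1).
    case: n {s} => [|n]; last by rewrite e0.
    rewrite (_ : (rcons _ _ == _) = true) ?mulr1n ?mul1r; [exact: three_eq0 | exact: eqxx].
  rewrite mulr0n mul0r addr0; case: n s ne => [|n] s ne; last by rewrite e0 mulr0 addr0.
  by rewrite (negbTE (ne : c != x1 :: nseq 0 x0)) mul0r addr0.
apply: deriv_eq cd (@clin0 _ _ _) dd _ _ => [x y|i]; first by rewrite mul0r mulr0 addr0.
by case: (I2_cases i) => ->.
Qed.

End Derivation.

(** The coefficients of h are those of d(x1) at x0^n x1. Subtracting ad h achieves the hypothesis
    [e0] of [test_der0]; it concerns n.+1 only, as the constant term of h is invisible in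
    [h, x1]. *)
Lemma test_inner (d : A -> A) : clin d -> derivation d -> d (gen K x0) = 0 ->
  (forall b, cp (d b) = 0) ->
  exists h, gen K x0 * h = h * gen K x0 /\ forall b, d b = h * b - b * h.
Proof.
move=> cd dd d0 cpd; pose e := d (gen K x1).
pose al n := e (rcons (nseq n x0) x1).
pose c n := al n *: gen K x0 ^+ n : A.
have fc n : fil n (c n).
  apply: filZ; elim: n => [|n IH]; first exact: filA_0.
  by rewrite exprS -add1n; apply: filAM IH; apply: fil_gen.
have sh := csumP fc; set h := csum c in sh.
have hx : gen K x0 * h = h * gen K x0.
  have cP : closed_sub (fun a : A => gen K x0 * a = a * gen K x0).
    by apply: closed_sub_eq (@A_sep K) _ _; clin.
  apply: (closed_sub_sum cP _ sh) => n; apply: (closed_subZ _ cP).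
  by rewrite -exprS -exprSr.
have hE n : h (nseq n x0) = al n.
  have /filA/(_ (nseq n x0)) := sh n.+1; rewrite size_nseq ltnSn => /(_ isT)/eqP.
  rewrite ncsDE ncsNE subr_eq0 => /eqP ->; rewrite ncs_sumE big_ord_recr big1 => [|k _].
    by rewrite /= add0r /c ncsZE genXE eqxx [LHS]mulr1.
  rewrite /c ncsZE genXE [_ == _](_ : _ = false) ?scaler0 //; apply/eqP => /(congr1 size).
  by rewrite !size_nseq => E; have := ltn_ord k; rewrite ltnNge {1}E leqnn.
exists h; split=> // b; apply/eqP; rewrite -subr_eq0; apply/eqP.
pose d' b := d b - (h * b - b * h); rewrite -[LHS]/(d' b).
apply: test_der0 => [||||n].
- by rewrite /d'; clin.
- by move=> x y; rewrite /d' dd !mulrBl !mulrBr !mulrA; abel1.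
- by rewrite /d' d0 hx subrr subrr.
- by move=> x; rewrite /d' !(linB (flin_cp K).1) cpd cpC subrr subrr.
rewrite /d' -/e !(ncsDE, ncsNE) mul_genE eqxx mul1r hE gen_mulE /=.
by rewrite mulr0n mul0r subr0 subrr.
Qed.

End CyclicTest.

(** * Transport along automorphisms, series in one element, the Euler derivation *)

Section Automorphisms.
Variable K : fieldType.
Hypothesis charK0 : [pchar K] =i pred0.
Notation A := 'A[K].
Notation A2 := 'A2[K].
Implicit Types (a b c h p y z : A) (i j : 'I_2).

Lemma ahomX (f : A -> A) a n : ahom f -> f (a ^+ n) = f a ^+ n.
Proof. by move=> [_ f1 fM]; elim: n => [|n IH]; rewrite ?expr0 // !exprS fM IH. Qed.

Lemma cp_ahom (f : A -> A) a b : ahom f -> cp a = cp b -> cp (f a) = cp (f b).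
Proof.
move=> [ff _ fM]; apply: (cp_factor (f := fun a => cp (f a))) => [||c d]; first exact: cyc_sep.
  by have hc := flin_cp K; clin.
by rewrite !fM cpC.
Qed.

Definition ser y p := exists c : nat -> K, is_sum (fun n => c n *: (y - 1) ^+ n) p.

Section Transport.
Variables s t : A -> A.
Hypotheses (hs : ahom s) (ht : ahom t) (sK : cancel s t) (tK : cancel t s).

Lemma aut_inner (v : A -> A) : clin v -> derivation v -> v (s (gen K ord0)) = 0 ->
  (forall b, cp (v b) = 0) ->
  exists h, s (gen K ord0) * h = h * s (gen K ord0) /\ forall b, v b = h * b - b * h.
Proof.
move=> cv dv v0 cpv; have [fs s1 sM] := hs; have [ft t1 tM] := ht.
have cpt a : cp a = 0 -> cp (t a) = 0.
  have cp0 := lin0 (flin_cp K).1; move=> h; rewrite -cp0.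
  by rewrite -(lin0 ft.1); apply: cp_ahom; rewrite // h cp0.
have [||||h [ch eh]] := @test_inner _ charK0 (fun a => t (v (s a))).
- by clin.
- by move=> a b; rewrite sM dv (linD ft.1) !tM !sK.
- by rewrite v0 (lin0 ft.1).
- by move=> b; apply: cpt.
exists (s h); split=> [|b]; first by rewrite -!sM ch.
by rewrite -[LHS]tK -{1}[b]tK eh (linB fs.1) !sM !tK.
Qed.

Lemma ser_commute i a : s (gen K i) * a = a * s (gen K i) -> ser (1 + s (gen K i)) a.
Proof.
move=> h; have [fs s1 sM] := hs; have [ft t1 tM] := ht.
have : gen K i * t a = t a * gen K i by rewrite -[gen K i]sK -!tM h.
move/commute_gen_sum/(is_sum_flin fs); rewrite tK => e.
exists (fun n => t a (nseq n i)); apply: eq_is_sum e => n.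
by rewrite (linZ fs.1) (ahomX _ _ hs) addrC addKr.
Qed.
End Transport.

Lemma cp_der_exp (d : A -> A) z n : derivation d ->
  cp (d (z ^+ n.+1)) = n.+1%:R *: cp (z ^+ n * d z).
Proof.
move=> dd; suff h m : cp (z ^+ m * d (z ^+ n.+1)) = n.+1%:R *: cp (z ^+ (m + n) * d z).
  by have := h 0%N; rewrite expr0 mul1r.
elim: n m => [|n IH] m; first by rewrite addn0 expr1 scale1r.
rewrite exprSr dd mulrDr (linD (flin_cp K).1) mulrA cpC mulrA -exprS IH.
by rewrite !mulrA -exprD addnS addSn -[n.+2]addn1 natrD scalerDl scale1r.
Qed.

(** H is the formal antiderivative of p in the variable y: modulo commutators, d((y-1)^{n+1}) is
    (n+1)(y-1)^n d(y). The first clause places H in the closed span of the powers of y - 1, in the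
    form used by [tcop_der_poly]. *)
Lemma ser_primitive y p : fil 1 (y - 1) -> ser y p -> exists H,
  (forall P, closed_sub P -> (forall n, P ((y - 1) ^+ n)) -> P H) /\
  (forall d : A -> A, flin d -> derivation d -> cp (d H) = cp (p * d y)).
Proof.
move=> fy [c hc]; pose f n := (c n / n.+1%:R) *: (y - 1) ^+ n.+1 : A.
have fX n : fil n ((y - 1) ^+ n).
  elim: n => [|n IH]; first exact: filA_0.
  by rewrite exprS -add1n; apply: filAM.
have ff n : fil n (f n) by apply: filZ; apply: filW (fX n.+1).
exists (csum f); split=> [P cP Pn|d fd dd].
  by apply: (closed_sub_sum cP _ (csumP ff)) => n; apply: closed_subZ.
have hcp := flin_cp K; have f1 : flin (fun a => cp (d a)) by flin.
have f2 : flin (fun a => cp (a * d y)) by flin.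
apply: is_sum_uniq (@cyc_sep K) (is_sum_flin f1 (csumP ff)) _.
apply: eq_is_sum (is_sum_flin f2 hc) => n; rewrite /f.
have dy : d (y - 1) = d y by rewrite (linB fd.1) (deriv1 dd) subr0.
rewrite (linZ f1.1) (linZ f2.1) cp_der_exp // dy scalerA mulrVK //.
by rewrite unitfE natS_neq0.
Qed.

Definition euler a : A := fun w => (size w)%:R * a w.
(** In degree 0 the factor is 0^-1 = 0: the constant term is lost, whence the constant in
    [cp_euler_const]. *)
Definition euler_inv a : A := fun w => (size w)%:R^-1 * a w.

Lemma flin_weight (k : nat -> K) : flin (fun a : A => (fun w => k (size w) * a w) : A).
Proof.
split=> [c a b|N a /filA h].
  by apply: funext => w; rewrite !ncsDE !ncsZE mulrDr; congr (_ + _); apply: mulrCA.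
by apply/filA => w /h ->; rewrite mulr0.
Qed.

Lemma derivation_euler : derivation euler.
Proof.
move=> a b; apply: funext => w; rewrite /euler ncsDE !ncsME mulr_sumr -big_split.
apply: eq_bigr => k _ /=; have lk : (k <= size w)%N by rewrite -ltnS.
rewrite size_takel // size_drop -{1}(subnKC lk) natrD mulrDl mulrA; congr (_ + _).
by rewrite mulrCA.
Qed.

Lemma euler_invK a : euler_inv (euler a) = a - a [::] *: 1.
Proof.
apply: funext => w; rewrite ncsDE ncsNE ncsZE ncs1E /euler_inv /euler.
case: w => [|i w]; first by rewrite invr0 mul0r /= [_ *: _]mulr1 subrr.
by rewrite mulKf ?natS_neq0 // scaler0 subr0.
Qed.

(** Division by the degree descends to |A| because x_i c and c x_i have the same degree, so
    commutators with generators go to such commutators. *)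
Lemma cp_euler_inv a b : cp a = cp b -> cp (euler_inv a) = cp (euler_inv b).
Proof.
have fe : flin euler_inv := flin_weight (fun n => n%:R^-1).
have fc : clin (fun a => cp (euler_inv a)) by have hc := flin_cp K; clin.
apply: (cp_factor _ fc _); first exact: cyc_sep.
apply: (comm_gen_all _ fc _) => [|i c]; first exact: cyc_sep.
pose L c := (fun w => (size w).+1%:R^-1 * c w) : A.
have -> : euler_inv (gen K i * c) = gen K i * L c.
  apply: funext => w; rewrite /euler_inv !gen_mulE; case: w => [|j w]; first by rewrite mulr0.
  by rewrite /L mulrCA.
have -> : euler_inv (c * gen K i) = L c * gen K i; last exact: cpC.
apply: funext => w; rewrite /euler_inv; case/lastP: w => [|w j].
  by rewrite !ncs_nilE mulr0 /gen /= !mulr0.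
by rewrite !mul_genE size_rcons /L mulrCA.
Qed.

Lemma cp_euler_const a b : cp (euler a) = cp (euler b) ->
  exists k, cp a = cp (b + k *: 1).
Proof.
move/cp_euler_inv; rewrite !euler_invK => h; exists (a [::] - b [::]).
have hc := flin_cp K; apply/eqP; rewrite -subr_eq0 -(linB hc.1) scalerBl.
move/eqP: h; rewrite -subr_eq0 -(linB hc.1) => /eqP e; rewrite -e; apply/eqP; congr cp.
by rewrite !opprD !opprK !addrA; congr (_ + _); rewrite addrAC.
Qed.

End Automorphisms.

(** * Classes made of series in Gam_0, Gam_1 and Gam_0 Gam_1 *)

Section Decomposition.
Variable K : fieldType.
Hypothesis charK0 : [pchar K] =i pred0.
Notation A := 'A[K].
Notation A2 := 'A2[K].
Implicit Types (a b c h p y z : A) (i j : 'I_2).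
Variable G : 'I_2 -> A.
Hypothesis gG : forall i, grouplike (G i).
Notation Gam := (Gam G).
Notation cder := (cder G).

Lemma fil_bdry : fil 1 ((1 + gen K ord0) * (1 + gen K ord_max) - 1).
Proof.
rewrite mulrDl mul1r mulrDr mulr1 [1 + _]addrC addrAC addrK.
by apply: filD; [apply: fil_gen | apply: filD; [apply: fil_gen | apply: (filAM (M := 0)); [apply: filA_0 | apply: fil_gen]]].
Qed.

Let u1 : A := sinv (1 + gen K ord_max).
Let u1l : (1 + gen K ord_max) * u1 = 1.
Proof. by apply: mul_sinvr; rewrite ncsDE ncs1E /= addr0. Qed.
Let u1r : u1 * (1 + gen K ord_max) = 1.
Proof. by apply: mul_sinvl; rewrite ncsDE ncs1E /= addr0. Qed.

(** The coordinate change making the boundary element a generator. It sends x_0 to x_0 + x_1 + ...,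
    hence is not unipotent, and its inverse [t0] is written out explicitly. *)
Let s0 := hsubst (fun i => if i == ord0 then (1 + gen K ord0) * (1 + gen K ord_max) - 1
  else gen K ord_max).
Let t0 := hsubst (fun i => if i == ord0 then (1 + gen K ord0) * u1 - 1 else gen K ord_max).

Let f_s i : fil 1 (if i == ord0 then (1 + gen K ord0) * (1 + gen K ord_max) - 1
  else gen K ord_max).
Proof. by case: ifP => _; [exact: fil_bdry | exact: fil_gen]. Qed.

Let f_t i : fil 1 (if i == ord0 then (1 + gen K ord0) * u1 - 1 else gen K ord_max).
Proof.
case: ifP => _; last exact: fil_gen.
have -> : (1 + gen K ord0) * u1 - 1 = (gen K ord0 - gen K ord_max) * u1.
  by rewrite -{2}u1l -mulrBl opprD addrACA subrr add0r.
apply: (filAM (M := 1) (N := 0)); last exact: filA_0.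
by apply: filB; apply: fil_gen.
Qed.

Let hs0 : ahom s0. Proof. exact: ahom_hsubst f_s. Qed.
Let ht0 : ahom t0. Proof. exact: ahom_hsubst f_t. Qed.
Let s0g : s0 (gen K ord0) = (1 + gen K ord0) * (1 + gen K ord_max) - 1.
Proof. exact: (hsubst_gen f_s ord0). Qed.
Let s0g1 : s0 (gen K ord_max) = gen K ord_max.
Proof. exact: (hsubst_gen f_s ord_max). Qed.
Let t0g : t0 (gen K ord0) = (1 + gen K ord0) * u1 - 1.
Proof. exact: (hsubst_gen f_t ord0). Qed.
Let t0g1 : t0 (gen K ord_max) = gen K ord_max.
Proof. exact: (hsubst_gen f_t ord_max). Qed.

Let s0K : cancel s0 t0.
Proof.
move=> a; apply: (ahom_eq (f := fun a => t0 (s0 a))) (ahom_comp ht0 hs0) (ahom_id K) _ => i.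
have [ft t1 tM] := ht0; case: (I2_cases i) => ->; last by rewrite s0g1 t0g1.
rewrite s0g (linB ft.1) tM !(linD ft.1) t1 t0g t0g1.
by rewrite [1 + (_ - 1)]addrC subrK -mulrA u1r mulr1 addrC addKr.
Qed.

Let t0K : cancel t0 s0.
Proof.
move=> a; apply: (ahom_eq (f := fun a => s0 (t0 a))) (ahom_comp hs0 ht0) (ahom_id K) _ => i.
have [fs s1 sM] := hs0; case: (I2_cases i) => ->; last by rewrite t0g1 s0g1.
have e : s0 (1 + gen K ord_max) = 1 + gen K ord_max by rewrite (linD fs.1) s1 s0g1.
have su : (1 + gen K ord_max) * s0 u1 = 1 by rewrite -e -sM u1l.
rewrite t0g (linB fs.1) sM !(linD fs.1) s1 s0g.
by rewrite [1 + (_ - 1)]addrC subrK -mulrA su mulr1 addrC addKr.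
Qed.

Definition bdry_aut a := psi G (s0 a).
Definition bdry_inv a := t0 (psiV G a).
Lemma ahom_bdry_aut : ahom bdry_aut.
Proof. exact: ahom_comp (ahom_psi charK0 gG) hs0. Qed.
Lemma ahom_bdry_inv : ahom bdry_inv.
Proof. exact: ahom_comp ht0 (ahom_psiV charK0 gG). Qed.
Lemma bdry_autK : cancel bdry_aut bdry_inv.
Proof. by move=> a; rewrite /bdry_inv (psiK charK0 gG) s0K. Qed.
Lemma bdry_invK : cancel bdry_inv bdry_aut.
Proof. by move=> a; rewrite /bdry_aut t0K (psiVK charK0 gG). Qed.
Lemma bdry_aut_gen : bdry_aut (gen K ord0) = Gam ord0 * Gam ord_max - 1.
Proof.
have [fp p1 pM] := ahom_psi charK0 gG.
rewrite /bdry_aut s0g (linB fp.1) pM !(linD fp.1) p1 !psi_gen //.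
by rewrite ![1 + _]addrC !subrK.
Qed.

Let Gi i := sinv (Gam i).
Let Gil i : Gam i * Gi i = 1. Proof. exact: mul_sinvr (Gam_nil charK0 gG i). Qed.
Let Gir i : Gi i * Gam i = 1. Proof. exact: mul_sinvl (Gam_nil charK0 gG i). Qed.

(** Modulo commutators, the sandwich p d(Gam_i) q is qp d(Gam_i). *)
Lemma cp_der_cder (d : A -> A) a : clin d -> derivation d ->
  cp (d a) = \sum_i cp (cder i a * d (Gam i)).
Proof.
move=> cd dd; have hc := flin_cp K.
rewrite (deriv_expandG charK0 gG a cd dd) (lin_sum hc.1); apply: eq_bigr => i _.
rewrite cderE; set t := dG _ _ _; set b := d _.
have hs := flin_sandl b; have hw := flin_tswap K; have hm := flin_tmult K.
move: t; apply: (A2_eq (@cyc_sep K)) => [||p q]; [clin | clin |].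
by rewrite sand_tens tswap_tens tmult_tens cpC mulrA.
Qed.

Lemma comm_inv (x y z : A) : y * z = 1 -> z * y = 1 -> y * x = x * y -> z * x = x * z.
Proof.
by move=> yz zy h; rewrite -[z * x]mulr1 -yz !mulrA -[z * x * y]mulrA -h mulrA zy mul1r.
Qed.

Lemma bdry_comm (R : pzRingType) (h g0 g1 i0 i1 : R) :
  g0 * i0 = 1 -> i0 * g0 = 1 -> g1 * i1 = 1 -> i1 * g1 = 1 ->
  g0 * g1 * h = h * (g0 * g1) -> g0 * g1 * (h * (i1 * i0)) = h * (i1 * i0) * (g0 * g1).
Proof.
move=> gi0 ig0 gi1 ig1 ch; rewrite mulrA ch -!mulrA [g1 * (i1 * _)]mulrA gi1 mul1r gi0.
by rewrite [i0 * (g0 * _)]mulrA ig0 mul1r ig1.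
Qed.

(** Solving for the cyclic derivatives gives d0 = p0 i0 + i0 h and d1 = p1 i1 + h i1. With y = g0
    g1, the two terms in h combine modulo commutators into h y^-1 times the derivative of y. *)
Lemma decomp_identity (p0 p1 h d0 d1 e0 e1 g0 g1 i0 i1 : A) :
  g0 * i0 = 1 -> i0 * g0 = 1 -> g1 * i1 = 1 -> i1 * g1 = 1 ->
  g0 * d0 = p0 + h -> d1 * g1 = p1 + h -> g0 * p0 = p0 * g0 ->
  g0 * g1 * h = h * (g0 * g1) ->
  cp (d0 * e0) + cp (d1 * e1) =
  cp (p0 * i0 * e0) + cp (p1 * i1 * e1) + cp (h * (i1 * i0) * (e0 * g1 + g0 * e1)).
Proof.
move=> gi0 ig0 gi1 ig1 ed0 ed1 c0 ch; have hc := flin_cp K.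
have -> : d0 = p0 * i0 + i0 * h.
  by rewrite -(comm_inv gi0 ig0 c0) -mulrDr -ed0 mulrA ig0 mul1r.
have -> : d1 = p1 * i1 + h * i1 by rewrite -mulrDl -ed1 -mulrA gi1 mulr1.
have gh : g1 * h = i0 * h * g0 * g1.
  by rewrite -[RHS]mulrA -[RHS]mulrA -ch !mulrA ig0 mul1r.
have -> : cp (h * (i1 * i0) * (e0 * g1 + g0 * e1)) = cp (i0 * h * e0) + cp (h * i1 * e1).
  rewrite mulrDr (linD hc.1 (h * _ * _)); congr (_ + cp _); last first.
    by rewrite -!mulrA [i0 * (g0 * _)]mulrA ig0 mul1r.
  rewrite mulrA cpC; congr cp; rewrite !mulrA gh -!mulrA [g1 * (i1 * _)]mulrA gi1 mul1r.
  by rewrite [g0 * (i0 * _)]mulrA gi0 mul1r.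
rewrite !mulrDl !(linD hc.1 (_ * _ * _)); exact: addrACA.
Qed.

Definition poly_closure y H :=
  forall P : A -> Prop, closed_sub P -> (forall n, P ((y - 1) ^+ n)) -> P H.

(** [cp_der_cder] for the Euler derivation and [decomp_identity] write the class of [euler a] as
    three terms, each the Euler derivative of an antiderivative from [ser_primitive]; dividing by
    the degree recovers |a| up to a constant. *)
Lemma cyc_decomp a p0 p1 h :
  Gam ord0 * cder ord0 a = p0 + h -> cder ord_max a * Gam ord_max = p1 + h ->
  Gam ord0 * p0 = p0 * Gam ord0 -> Gam ord_max * p1 = p1 * Gam ord_max ->
  Gam ord0 * Gam ord_max * h = h * (Gam ord0 * Gam ord_max) ->
  exists H0 H1 H2 k, [/\ poly_closure (Gam ord0) H0, poly_closure (Gam ord_max) H1,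
    poly_closure (Gam ord0 * Gam ord_max) H2 & cp a = cp (H0 + H1 + H2 + k *: 1)].
Proof.
move=> e0 e1 c0 c1 ch; set y := Gam ord0 * Gam ord_max.
have serG i p : Gam i * p = p * Gam i -> ser (Gam i) (p * Gi i).
  move=> c; exists (fun n => psiV G (p * Gi i) (nseq n i)); apply: commute_Gam_sum => //.
  by rewrite mulrA c -!mulrA Gil Gir.
have sery : ser y (h * (Gi ord_max * Gi ord0)).
  have -> : y = 1 + bdry_aut (gen K ord0) by rewrite bdry_aut_gen addrC subrK.
  apply: ser_commute ahom_bdry_aut ahom_bdry_inv bdry_autK bdry_invK _ _ _.
  rewrite bdry_aut_gen -/y mulrBl mulrBr mul1r mulr1; congr (_ - _).
  exact: bdry_comm (Gil _) (Gir _) (Gil _) (Gir _) ch.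
have [H0 [P0 D0]] := ser_primitive charK0 (fil_Gam1 charK0 gG _) (serG _ _ c0).
have [H1 [P1 D1]] := ser_primitive charK0 (fil_Gam1 charK0 gG _) (serG _ _ c1).
have fy : fil 1 (y - 1).
  have -> : y - 1 = (Gam ord0 - 1) * Gam ord_max + (Gam ord_max - 1).
    by rewrite mulrBl mul1r addrA subrK.
  apply: filD; last exact: fil_Gam1.
  by apply: (filAM (M := 1) (N := 0)); [apply: fil_Gam1 | apply: filA_0].
have [H2 [P2 D2]] := ser_primitive charK0 fy sery.
have hc := flin_cp K; have fe : flin (@euler K) := flin_weight (fun n => n%:R).
have de := @derivation_euler K.
have [|k ek] := @cp_euler_const _ charK0 a (H0 + H1 + H2); last by exists H0, H1, H2, k.
rewrite !(linD fe.1) !(linD hc.1) (D0 _ fe de) (D1 _ fe de) (D2 _ fe de).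
rewrite (cp_der_cder a (flin_clin fe) de) sum_I2 [euler y]de.
exact: (decomp_identity _ _ (Gil _) (Gir _) (Gil _) (Gir _) e0 e1 c0 ch).
Qed.

(** * Vanishing of v . Dt on series in one group-like element *)

Section Kill.
Variable v : A -> A.
Hypotheses (fv : flin v) (dv : derivation v).

Let Phi a : cyc2 K := cp2 (tder2 v (tcop a)).
Let fPhi : flin Phi.
Proof.
have h1 := flin_tcop K; have h2 := flin_tder2 fv; have h3 := flin_cp2 K.
by rewrite /Phi; flin.
Qed.

Lemma cp2_omul_swap (x x' z z' : A2) :
  cp2 (x ** z) + cp2 (x' ** z') = cp2 (z' ** x') + cp2 (z ** x).
Proof. by rewrite addrC (cp2_omulC x') (cp2_omulC x). Qed.

(** Dt is multiplicative for [**], so the Leibniz rule and [cp2_omulC] make the value on xy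
    symmetric in x and y. *)
Lemma tcop_der_comm a b : cp a = cp b -> Phi a = Phi b.
Proof.
apply: cp_factor (flin_clin fPhi) _ => [|c d]; first exact: cyc2_sep.
have E x y : Phi (x * y) = cp2 (tder2 v (tcop x) ** tcop y) + cp2 (tcop x ** tder2 v (tcop y)).
  rewrite /Phi tcopM (tder2_omul _ _ fv dv).
  exact: (linD (flin_cp2 K).1 (tder2 v (tcop x) ** tcop y) (tcop x ** tder2 v (tcop y))).
by rewrite (E c d) (E d c); apply: cp2_omul_swap.
Qed.

(** Dt(y) = y (x) y^-1, and v acts on y^-1 as the commutator with the same u; each summand then has
    a commutator in one factor. *)
Lemma tcop_der_grouplike y u : grouplike y -> v y = y * u - u * y -> Phi y = 0.
Proof.
move=> gy vy; have hc := flin_cp2 K; have y1 := gy.2.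
rewrite /Phi tcop_grouplike // tder2_tens // (linD hc.1 (tens _ _)).
have vi : v (sinv y) = sinv y * u - u * sinv y.
  have := deriv1 dv; rewrite -(mul_sinvr y1) dv => /eqP; rewrite addrC addr_eq0 => /eqP e.
  rewrite -[v _]mul1r -(mul_sinvl y1) -mulrA e vy mulrN mulrBl mulrBr !mulrA.
  by rewrite mul_sinvl // mul1r -[sinv y * u * y * _]mulrA mul_sinvr // mulr1 opprB.
rewrite vy vi tensBl tensBr !(linB hc.1 (tens _ _)) cp2_comml cp2_commr !subrr addr0.
by [].
Qed.

Lemma tcop_der_poly y u H : grouplike y -> v y = y * u - u * y -> poly_closure y H ->
  Phi H = 0.
Proof.
move=> gy vy cl.
(* Powers of y - 1 are not group-like. The extra factor y^m lets (y-1)^{n+1} y^m = (y-1)^n (y^{m+1}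
   - y^m) reduce them to the group-like y^m. *)
pose P a := forall m, Phi (a * y ^+ m) = 0.
suff PH : P H by rewrite -[H]mulr1 -(expr0 y); apply: PH.
apply: cl => [|n].
  apply: closed_sub_all => m.
  by apply: closed_sub_eq (@cyc2_sep K) _ (@clin0 _ _ _); have h := flin_clin fPhi; clin.
elim: n => [|n IH] m; last first.
  rewrite exprSr -mulrA mulrBl mul1r -exprS mulrBr (linB fPhi.1) !IH.
  exact: subrr.
have gX : grouplike (y ^+ m).
  by elim: m => [|m IH]; rewrite ?expr0 ?exprS; [apply: grouplike1 | apply: grouplikeM].
have eX : v (y ^+ m) = y ^+ m * u - u * y ^+ m.
  elim: m {gX} => [|m IH]; first by rewrite expr0 (deriv1 dv) mul1r mulr1 subrr.
  by rewrite exprS dv vy IH mulrBl mulrBr !mulrA addrC subrKA.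
by rewrite expr0 mul1r; apply: tcop_der_grouplike gX eX.
Qed.

Lemma flin_eq0 (V : filtModType K) (f : A -> V) (a b c d : A) k : flin f ->
  f a = 0 -> f b = 0 -> f c = 0 -> f d = 0 -> f (a + b + c + k *: d) = 0.
Proof. by move=> hf ha hb hc hd; rewrite !(linD hf.1) (linZ hf.1) ha hb hc hd scaler0 !addr0. Qed.

Lemma tcop_der_sum (a H0 H1 H2 : A) k : cp a = cp (H0 + H1 + H2 + k *: 1) ->
  Phi H0 = 0 -> Phi H1 = 0 -> Phi H2 = 0 -> Phi a = 0.
Proof.
move=> e h0 h1 h2; rewrite (tcop_der_comm e); apply: (flin_eq0 k fPhi h0 h1 h2).
apply: (@tcop_der_grouplike _ 0); first exact: grouplike1.
by rewrite (deriv1 dv) mulr0 mul0r subrr.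
Qed.
End Kill.

End Decomposition.

Section Center.
Variable K : fieldType.
Hypothesis charK0 : [pchar K] =i pred0.
Notation A := 'A[K].
Notation A2 := 'A2[K].
Variable G : 'I_2 -> A.
Hypothesis gG : forall i, grouplike (G i).
Notation Gam := (Gam G).
Variable kap : A2 -> A2.
Hypothesis ik : intersection_op G kap.

Lemma commute_shift (R : pzRingType) (x u h : R) :
  x * u - u * x = h * x - x * h -> x * (- (u + h)) = - (u + h) * x.
Proof.
move/eqP; rewrite subr_eq => /eqP e; rewrite mulrN mulNr mulrDr mulrDl e; congr (- _).
by rewrite addrAC subrK addrC.
Qed.

(** The derivation is ad h with h commuting with the boundary element. From [Gam_i, u_i] =
    [h, Gam_i], the element p_i = -(u_i + h) commutes with Gam_i, and u_0 = -Gam_0 cder_0, u_1 =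
    -cder_1 Gam_1 give the hypotheses of [cyc_decomp]. *)
Lemma central_decomp a : (forall b, cp (ham_der kap a b) = 0) ->
  exists H0 H1 H2 k, [/\ poly_closure (Gam ord0) H0, poly_closure (Gam ord_max) H1,
    poly_closure (Gam ord0 * Gam ord_max) H2 & cp a = cp (H0 + H1 + H2 + k *: 1)].
Proof.
move=> cpv; have cv := clin_ham_der ik a; have dv := derivation_ham charK0 gG ik a.
have [] := aut_inner charK0 (ahom_bdry_aut charK0 gG) (ahom_bdry_inv charK0 gG)
  (bdry_autK charK0 gG) (bdry_invK charK0 gG) cv dv _ cpv.
  rewrite (bdry_aut_gen charK0 gG) (linB cv.1 (_ * _)) (ham_der_boundary charK0 gG ik).
  by rewrite (deriv1 dv) subrr.
rewrite (bdry_aut_gen charK0 gG) => h [ch eh].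
have {}ch : Gam ord0 * Gam ord_max * h = h * (Gam ord0 * Gam ord_max).
  by move: ch; rewrite mulrBl mulrBr mul1r mulr1; apply: addIr.
have comm i : Gam i * - (ham_u G i a + h) = - (ham_u G i a + h) * Gam i.
  by apply: commute_shift; rewrite -(ham_der_Gam charK0 gG ik) eh.
apply: (cyc_decomp charK0 gG _ _ (comm ord0) (comm ord_max) ch).
  by rewrite ham_u0 opprD opprK subrK.
by rewrite ham_u1 opprD opprK subrK.
Qed.

Lemma central_tcop a b : (forall c, cp (ham_der kap a c) = 0) ->
  cp2 (tder2 (rho (ham kap b)) (tcop a)) = 0.
Proof.
move=> /central_decomp[H0 [H1 [H2 [k [P0 P1 P2 e]]]]].
have fv := flin_rho (ham kap b); have dv := @deriv_rho _ (ham kap b).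
have gGam := grouplike_Gam charK0 gG.
have vG i : rho (ham kap b) (Gam i) = Gam i * ham_u G i b - ham_u G i b * Gam i.
  by rewrite -(ham_der_rho charK0 gG ik) (ham_der_Gam charK0 gG ik).
have vy : rho (ham kap b) (Gam ord0 * Gam ord_max) = Gam ord0 * Gam ord_max * 0 - 0 * (Gam ord0 * Gam ord_max).
  by rewrite -(ham_der_rho charK0 gG ik) (ham_der_boundary charK0 gG ik) mulr0 mul0r subrr.
have K0 := tcop_der_poly fv dv (gGam ord0) (vG ord0) P0.
have K1 := tcop_der_poly fv dv (gGam ord_max) (vG ord_max) P1.
have K2 := tcop_der_poly fv dv (grouplikeM (gGam ord0) (gGam ord_max)) vy P2.

exact (tcop_der_sum fv dv e K0 K1 K2).
Qed.

(** Centrality speaks of the representatives chosen by [repr]; in the second argument the derivation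
    descends to |A|, so any c may be taken. *)
Lemma central_ham_der a : central kap (cp a) -> forall c, cp (ham_der kap (repr (cp a)) c) = 0.
Proof.
move=> h c; have hc := flin_cp K; have cv := clin_ham_der ik (repr (cp a)).
have dv := derivation_ham charK0 gG ik (repr (cp a)).
have := h (cp c); rewrite /cyc_bracket -ham_derE => <-.
apply: (cp_factor (f := fun c => cp (ham_der kap (repr (cp a)) c))) => [||x y|].
- exact: cyc_sep.
- by clin.
- by rewrite !dv !(linD hc.1) addrC; congr (_ + _); apply: cpC.
by rewrite /cp cprojK.
Qed.

Lemma tcop_central a b : central kap (cp a) -> cp2 (tder2 (rho (ham kap b)) (tcop a)) = 0.
Proof.
move=> h; have e : cp a = cp (repr (cp a)) by rewrite /cp cprojK.
have z := tcop_der_comm (flin_rho _) (@deriv_rho _ (ham kap b)) e.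
exact: (etrans z (central_tcop b (central_ham_der h))).
Qed.

End Center.

(** * The cobracket *)

Ltac zab_bring y :=
  lazymatch goal with
  | |- is_true (y + _ == 0) => idtac
  | _ => rewrite (addrCA _ y); zab_bring y
  end.

Ltac zab_loop :=
  lazymatch goal with
  | |- is_true (- ?y + _ == 0) => zab_bring y; rewrite addNKr; zab_loop
  | |- is_true (?y + _ == 0) => zab_bring (- y); rewrite addKr; zab_loop
  | _ => by rewrite ?oppr0 eqxx
  end.

(* Decides equalities in abelian groups that hold after cancelling opposite terms. *)
Ltac zab := apply/eqP; rewrite -subr_eq0 -[_ - _]addr0 ?(opprD, opprK) -?addrA; zab_loop.

Section DeltaTensors.
Variable K : fieldType.
Notation A := 'A[K].
Notation A2 := 'A2[K].
Implicit Types (a b c p q x y : A) (s t X T : A2).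

Let hc := flin_cp2 K.
Let ht := flin_tswap K.

Lemma clin_sand_tswap c : clin (fun t => sand (tswap t) c).
Proof. exact: (clin_comp (flin_clin (flin_sandl c)) (flin_clin ht)). Qed.

Section Shift.
Variables (D : A -> A2) (L : A -> A) (X T : A2).
Hypotheses (cD : clin D) (dD : dder D) (fL : flin L).

(** With t = p (x) q, the first term differentiates L(qcp), and for X matching L the second removes
    the part where D falls on c. At c = 1 and t = dG_i b, L is applied to the cyclic derivative of
    b. *)
Definition rest_div t c : cyc2 K :=
  cp2 (D (L (sand (tswap t) c)) ** T) - cp2 (X ** tswap t ** D c ** T).

Lemma sand_shift t a c : sand (tswap (tens a 1 * t)) c = sand (tswap t) (c * a).
Proof.
have h1 := clin_sand_tswap (c * a).
have h2 : clin (fun t => sand (tswap (tens a 1 * t)) c).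
  by apply: (clin_comp (clin_sand_tswap c)); clin.
move: t; apply: (A2_eq (@A_sep K)) => [||p q]; [clin | clin |].
by rewrite tens_mul mul1r !tswap_tens !sand_tens !mulrA.
Qed.

Lemma tswap_shift t a : tswap (tens a 1 * t) = tswap t ** tens 1 a.
Proof.
move: t; apply: (A2_eq (@A2_sep K)) => [||p q]; [clin | clin |].
by rewrite tens_mul mul1r !tswap_tens omul_tens mulr1.
Qed.

Lemma rest_div_shift t a c : rest_div (tens a 1 * t) c =
  rest_div t (c * a) + cp2 (X ** tswap t ** tens c 1 ** D a ** T).
Proof.
rewrite /rest_div sand_shift tswap_shift (dderE c a dD).
rewrite [X ** tswap t ** (_ + _)]omulDr (omulDl (X ** tswap t ** (tens 1 a ** D c)) _ T).
rewrite (linD hc.1 (X ** tswap t ** (tens 1 a ** D c) ** T)) opprD addrA !omulA.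
by rewrite subrK.
Qed.

Lemma clin_rest_div c : clin (fun t => rest_div t c).
Proof.
have h1 := clin_comp cD (clin_comp (flin_clin fL) (clin_sand_tswap c)).
have h2 := hc; rewrite /rest_div.
apply: clin_add; last by clin.
exact: (clin_comp (flin_clin hc) (clin_comp (flin_clin (flin_omulr T)) h1)).
Qed.
End Shift.

(** The antisymmetrized |t'| (x) |t''c|, the form in which kappa enters the recursion for mu. *)
Definition alt_act c t : cyc2 K := cp2 (t * tens 1 c) - cp2 (tswap (t * tens 1 c)).
(** For c = 1, [bdry0] at dG_0 b and [bdry1] at dG_1 b add up to |b| ^ 1; this is shown within
    [delta_defect_at1]. *)
Definition bdry0 x c t : cyc2 K := cp2 (tswap (tens 1 x * t * tens 1 c)) - cp2 (tswap (t * tens x c)).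
Definition bdry1 x c t : cyc2 K := cp2 (tswap (tens c x * t)) - cp2 (tswap (tens c 1 * t * tens x 1)).

Lemma clin_alt_act c : clin (alt_act c).
Proof. by have h := hc; rewrite /alt_act; clin. Qed.
Lemma clin_bdry0 x c : clin (bdry0 x c).
Proof. by have h := hc; rewrite /bdry0; clin. Qed.
Lemma clin_bdry1 x c : clin (bdry1 x c).
Proof. by have h := hc; rewrite /bdry1; clin. Qed.

Lemma bdry1_shift x t a c : bdry1 x c (tens a 1 * t) = bdry1 x (c * a) t.
Proof. by rewrite /bdry1 !mulrA !tens_mul !mulr1. Qed.

(** This lemma, [bdry0_off] and [bdry1_diag] account for the three nonzero values of kappa on
    generators, at the index pairs (0,0), (1,0) and (1,1). *)
Lemma bdry0_diag x t c :
  bdry0 x c (tens x 1 * t) - bdry0 x (c * x) t - cp2 (tens 1 (c * x) ** t ** tdif x)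
    - cp2 (tens 1 x ** tswap t ** tens c 1 ** tdif x)
  = alt_act c (t ** (tens 1 (x * x) - tens x x)).
Proof.
have h0 := clin_bdry0 x c; have h1 := clin_bdry0 x (c * x); have h2 := clin_alt_act c.
have h3 := hc.
move: t; apply: (A2_eq (@cyc2_sep K)) => [||p q]; [clin | clin |].
rewrite /bdry0 /alt_act !tdifE !omulBr !tswap_tens !tens_mul !omul_tens !mulr1 !mul1r.
rewrite mulrBl !tens_mul !mulr1 (linB ht.1) !tswap_tens.
rewrite !mulrA !(linB hc.1 (tens _ _) (tens _ _)).
rewrite !(cp2_comml (x * q * c) x) !(cp2_commr (x * q * c) x) !(cp2_commr x p).
rewrite !(cp2_comml (q * c) x) !(cp2_commr (q * c) x) !mulrA.
by rewrite -!(linB hc.1); congr cp2; abel2.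
Qed.

Lemma bdry0_off x z t c : bdry0 z c (tens x 1 * t) - bdry0 z (c * x) t
  + (cp2 (tens x c ** (t ** tdif z)) - cp2 (tens 1 (c * x) ** (t ** tdif z)))
  = alt_act c (t ** (tens 1 (x * z) + tens (z * x) 1 - tens x z - tens z x)).
Proof.
have h0 := clin_bdry0 z c; have h1 := clin_bdry0 z (c * x); have h2 := clin_alt_act c.
have h3 := hc.
move: t; apply: (A2_eq (@cyc2_sep K)) => [||p q]; [clin | clin |].
rewrite /bdry0 /alt_act !tdifE !omulBr !omulDr !tens_mul !omul_tens !mulr1 !mul1r.
rewrite !mulrBl !mulrDl !tens_mul !mulr1.
rewrite !(linB ht.1 _ (tens _ _)) !(linD ht.1 (tens _ _)) !tswap_tens.
rewrite !mulrA !(linB hc.1 _ (tens _ _)) !(linD hc.1 (tens _ _) (tens _ _)).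
rewrite !(cp2_comml (z * q * c) x) !(cp2_commr (z * q * c) x) !(cp2_commr x p) !(cp2_comml x p).
rewrite !(cp2_comml (q * c) x) !(cp2_commr (q * c) x) !(cp2_comml (p * z) x) !(cp2_commr (p * z) x).
by rewrite !mulrA -!(linB hc.1) -!(linD hc.1) -?(linB hc.1); congr cp2; abel2.
Qed.

Lemma bdry1_diag x t c :
  - cp2 (tens 1 (c * x) ** (t ** tdif x)) - cp2 (tens x 1 ** tswap t ** tens c 1 ** tdif x)
  = alt_act c (t ** (tens 1 (x * x) - tens x x)).
Proof.
have h2 := clin_alt_act c; have h3 := hc.
move: t; apply: (A2_eq (@cyc2_sep K)) => [||p q]; [clin | clin |].
rewrite /alt_act !tdifE !omulBr !tswap_tens !omul_tens !mulr1 !mul1r.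
rewrite !mulrBl !tens_mul !mulr1 !(linB ht.1 _ (tens _ _)) !tswap_tens.
rewrite !mulrA !(linB hc.1 _ (tens _ _)).
rewrite !(cp2_comml (x * q * c) x) !(cp2_commr (x * q * c) x) !(cp2_commr x p).
rewrite !(cp2_commr (q * c) x) !mulrA.
by rewrite -!(linB hc.1) -!(linN hc.1) -!(linD hc.1); congr cp2; abel2.
Qed.

Lemma bdry1_one x b c : bdry1 x c (tens 1 b) - cp2 (tens 1 (b * c) ** tdif x) =
  cp2 (tens x c ** tdif b) - cp2 (tens 1 (c * x) ** tdif b).
Proof.
rewrite /bdry1 !tdifE !omulBr !tens_mul !omul_tens !tswap_tens !mulr1 !mul1r !mulrA.
rewrite !(linB hc.1 _ (tens _ _)).
by rewrite (cp2_commr (b * c) x) !mulrA -!(linB hc.1); congr cp2; abel2.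
Qed.

Lemma bdry0_one x b c : bdry0 x c (tens 1 b) = cp2 (tens (b * c) 1 ** tdif x).
Proof.
rewrite /bdry0 tdifE omulBr !tens_mul !omul_tens !tswap_tens !mulr1 !mul1r (linB hc.1 (tens _ _)).
by rewrite (cp2_comml (b * c) x) !mulrA.
Qed.

End DeltaTensors.

Section Delta.
Variable K : fieldType.
Hypothesis charK0 : [pchar K] =i pred0.
Notation A := 'A[K].
Notation A2 := 'A2[K].
Implicit Types (a b c : A) (s t : A2) (i j : 'I_2).
Variable G : 'I_2 -> A.
Hypothesis gG : forall i, grouplike (G i).
Notation Gam := (Gam G).
Notation dG := (dG G).
Notation g0 := (Gam ord0).
Notation g1 := (Gam ord_max).
Variable kap : A2 -> A2.
Hypothesis ik : intersection_op G kap.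

Definition rest0 c t := rest_div (dG ord0) ( *%R^~ g0) (tens 1 g0) (tdif g0) t c.
Definition rest1 c t := rest_div (dG ord_max) ( *%R g1) (tens g1 1) (tdif g1) t c.

(** The closed form of N in [delta_defect_word]. The factor c collects the letters that the
    recursion moves cyclically from the front of the word. *)
Definition delta_defect b c : cyc2 K :=
  (bdry0 g0 c (dG ord0 b) - rest0 c (dG ord0 b))
  + (bdry1 g1 c (dG ord_max b) - rest1 c (dG ord_max b)).

Let cdG i := clin_dG charK0 gG i.
Let ddG i := dder_dG charK0 gG i.
Let hc := flin_cp2 K.
Let ht := flin_tswap K.

Lemma rest0_shift c i t : rest0 c (tens (Gam i) 1 * t) = rest0 (c * Gam i) t
  + (if i == ord0 then cp2 (tens 1 g0 ** tswap t ** tens c 1 ** tdif g0) else 0).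
Proof.
rewrite /rest0 rest_div_shift; last exact: ddG.
rewrite (dG_Gam charK0 gG); case: (I2_cases i) => ->; rewrite /= ?mulr1n ?mulr0n ?omulr1 //.
by rewrite (lin0 (flin_omull _).1) (lin0 (flin_omulr _).1) (lin0 hc.1).
Qed.

Lemma rest1_shift c i t : rest1 c (tens (Gam i) 1 * t) = rest1 (c * Gam i) t
  + (if i == ord_max then cp2 (tens g1 1 ** tswap t ** tens c 1 ** tdif g1) else 0).
Proof.
rewrite /rest1 rest_div_shift; last exact: ddG.
rewrite (dG_Gam charK0 gG); case: (I2_cases i) => ->; rewrite /= ?mulr1n ?mulr0n ?omulr1 //.
by rewrite (lin0 (flin_omull _).1) (lin0 (flin_omulr _).1) (lin0 hc.1).
Qed.

Lemma rest0_one b c : rest0 c (tens 1 b) =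
  cp2 (tens 1 (c * g0) ** dG ord0 b ** tdif g0) + cp2 (tens (b * c) 1 ** tdif g0).
Proof.
rewrite /rest0 /rest_div tswap_tens sand_tens mulr1 -mulrA (dderE _ _ (@ddG ord0)).
rewrite (dderE c g0 (@ddG ord0)) (dG_Gam charK0 gG) eqxx mulr1n omulr1.
rewrite (omulDr (tens b 1)) !omulA !omul_tens !mulr1 !mul1r.
rewrite !(omulDl _ _ (tdif g0)) !(linD hc.1 (_ ** tdif g0)).
by rewrite addrCA [X in X - _]addrC addrK.
Qed.

Lemma rest1_one b c : rest1 c (tens 1 b) =
  cp2 (tens 1 (b * c) ** tdif g1) + cp2 (tens g1 c ** dG ord_max b ** tdif g1).
Proof.
rewrite /rest1 /rest_div tswap_tens sand_tens mulr1 (dderE _ _ (@ddG ord_max)).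
rewrite (dderE b c (@ddG ord_max)) (dG_Gam charK0 gG) eqxx mulr1n omulr1.
rewrite (omulDr (tens g1 1)) !omulA !omul_tens !mulr1.
rewrite !(omulDl _ _ (tdif g1)) !(linD hc.1 (_ ** tdif g1)).
by rewrite addrA addrK.
Qed.

Let cl_rest0 c : clin (rest0 c).
Proof. by apply: clin_rest_div (cdG _) _ _; flin. Qed.
Let cl_rest1 c : clin (rest1 c).
Proof. by apply: clin_rest_div (cdG _) _ _; flin. Qed.

Lemma kap_expand i b : kap (tens (Gam i) b) =
  dG ord0 b ** kap (tens (Gam i) g0) + dG ord_max b ** kap (tens (Gam i) g1).
Proof.
have ck := ik_clin ik; have c : clin (fun b => kap (tens (Gam i) b)) by clin.
by rewrite (dder_expandG charK0 gG b c (dder_kap charK0 gG ik (Gam i))) sum_I2.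
Qed.

Lemma delta_defect0 b c : delta_defect (g0 * b) c =
  delta_defect b (c * g0) + alt_act c (kap (tens g0 b)).
Proof.
rewrite kap_expand (ik_01 ik) (lin0 (flin_omull _).1) addr0 (ik_diag ik) -bdry0_diag.
rewrite /delta_defect !ddG !(dG_Gam charK0 gG) !eqxx /= mulr1n mulr0n mul1r mul0r add0r.
rewrite (linD (clin_bdry0 g0 c).1) (linD (cl_rest0 c).1) rest0_shift rest1_shift bdry1_shift.
rewrite rest0_one bdry0_one /= addr0.
zab.
Qed.

Lemma delta_defect1 b c : delta_defect (g1 * b) c =
  delta_defect b (c * g1) + alt_act c (kap (tens g1 b)).
Proof.
rewrite kap_expand (linD (clin_alt_act c).1) (ik_10 ik) (ik_diag ik) -bdry0_off -bdry1_diag.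
rewrite /delta_defect !ddG !(dG_Gam charK0 gG) !eqxx /= mulr1n mulr0n mul1r mul0r add0r.
rewrite (linD (clin_bdry1 g1 c).1) (linD (cl_rest1 c).1) rest0_shift rest1_shift bdry1_shift.
have -> : bdry1 g1 c (tens 1 b) = cp2 (tens 1 (b * c) ** tdif g1) +
    (cp2 (tens g1 c ** tdif b) - cp2 (tens 1 (c * g1) ** tdif b)).
  by rewrite -bdry1_one; zab.
rewrite rest1_one /= addr0 (tdif_expandG charK0 gG b) !(omulDr (tens _ _)).
rewrite !(linD hc.1 (tens _ _ ** _)) !omulA.
zab.
Qed.

Lemma delta_defect_Gam i b c : delta_defect (Gam i * b) c =
  delta_defect b (c * Gam i) + alt_act c (kap (tens (Gam i) b)).
Proof. by case: (I2_cases i) => ->; [apply: delta_defect0 | apply: delta_defect1]. Qed.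

Lemma delta_defect_one c : delta_defect 1 c = 0.
Proof.
rewrite /delta_defect !(dder1 (@ddG _)) (lin0 (clin_bdry0 g0 c).1) (lin0 (clin_bdry1 g1 c).1).
by rewrite (lin0 (cl_rest0 c).1) (lin0 (cl_rest1 c).1) !subrr addr0.
Qed.

Let f i a := cp2 (dG i a ** tdif (Gam i)).
Let clf i : clin (f i).
Proof.
apply: (clin_comp (flin_clin hc)); exact: (clin_comp (flin_clin (flin_omulr _)) (cdG i)).
Qed.

Lemma delta_defect_at1 b : delta_defect b 1 =
  cp2 (tens b 1) - cp2 (tens 1 b) + \sum_i f i (ham_u G i b).
Proof.
have rE D L X T t : dder D -> rest_div D L X T t 1 = cp2 (D (L (tmult (tswap t))) ** T).
  move=> dD; rewrite /rest_div (dder1 dD) (lin0 (flin_omull _).1) (lin0 (flin_omulr _).1).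
  by rewrite (lin0 hc.1) subr0 sand1.
rewrite /delta_defect /rest0 /rest1 !rE; try exact: ddG.
rewrite -!cderE -/(f ord0 _) -/(f ord_max _) sum_I2 (ham_u0 G b) (ham_u1 G b).
rewrite (linN (clf _).1) (linN (clf _).1).
have fs a : f ord0 a = cp2 (tdif a) - f ord_max a.
  by rewrite (tdif_expandG charK0 gG a) (linD hc.1 (dG _ _ ** _)) addrK.
(* The terms [rest0] and [rest1] contain cder_0 Gam_0 and Gam_1 cder_1, but u_0 and u_1 contain the
   opposite products. The bracket relation and f_0 + f_1 = |tdif| exchange them. *)
have e : g0 * cder G ord0 b =
    cder G ord0 b * g0 + (cder G ord_max b * g1 - g1 * cder G ord_max b).
  have := cder_bracket charK0 gG b; rewrite sum_I2 addrAC => /eqP.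
  by rewrite subr_eq0 => /eqP.
rewrite e (linD (clf ord0).1) (linB (clf ord0).1) [f ord0 (cder G ord_max b * g1)]fs.
rewrite [f ord0 (g1 * _)]fs cp2_tdifC.
have -> : cp2 (tens b 1) - cp2 (tens 1 b) = bdry0 g0 1 (dG ord0 b) + bdry1 g1 1 (dG ord_max b).
  have <- : - cp2 (tswap (tdif b)) = cp2 (tens b 1) - cp2 (tens 1 b).
    by rewrite tdifE (linB ht.1) !tswap_tens (linB hc.1 (tens _ _)) opprB.
  rewrite (tdif_expandG charK0 gG b) (linD ht.1) (linD hc.1 (tswap _)) opprD.
  have h0 := clin_bdry0 g0 1; have h1 := clin_bdry1 g1 1; have h := hc.
  congr (_ + _).
    move: (dG ord0 b); apply: (A2_eq (@cyc2_sep K)) => [||p q]; [clin | clin |].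
    rewrite /bdry0 tdifE omulBr !omul_tens !tens_mul !mulr1 !mul1r.
    by rewrite (linB ht.1) !tswap_tens (linB hc.1 (tens _ _)) opprB.
  move: (dG ord_max b); apply: (A2_eq (@cyc2_sep K)) => [||p q]; [clin | clin |].
  rewrite /bdry1 tdifE omulBr !omul_tens !tens_mul !mulr1 !mul1r.
  by rewrite (linB ht.1) !tswap_tens (linB hc.1 (tens _ _)) opprB.
zab.
Qed.

(* N w c stands for the antisymmetrization of |mu(w)'| (x) |mu(w)'' c|, which the product rule *)
(* of mu determines by recursion on w.                                                       *)
Lemma delta_defect_word (N : seq 'I_2 -> A -> cyc2 K) :
  (forall c, N [::] c = 0) ->
  (forall i w c, N (i :: w) c = N w (c * Gam i) + alt_act c (kap (tens (Gam i) (Gword G w)))) ->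
  forall w c, N w c = delta_defect (Gword G w) c.
Proof.
move=> N0 NS; elim=> [|i w IH] c; first by rewrite N0 Gword_nil delta_defect_one.
by rewrite NS Gword_cons delta_defect_Gam IH.
Qed.

End Delta.

(** * Transfer from the group algebra *)

Section Malg.
Variable K : fieldType.

Lemma mlinE (S : choiceType) (V : lmodType K) (f : S -> V) (p : {malg K[S]}) (D : {fset S}) :
  (msupp p `<=` D)%fset -> mlin f p = \sum_(x <- D) p@_x *: f x.
Proof.
move=> h; rewrite /mlin; apply: big_fset_incl => // x _ /mcoeff_outdom ->.
exact: scale0r.
Qed.

Lemma mlin_linear (S : choiceType) (V : lmodType K) (f : S -> V) : linear (mlin f).
Proof.
move=> c p q; pose D := (msupp (c *: p + q) `|` (msupp p `|` msupp q))%fset.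
rewrite !(@mlinE _ _ _ _ D) ?fsubsetUl //.
- rewrite scaler_sumr -big_split; apply: eq_bigr => x _.
  by rewrite mcoeffD mcoeffZ scalerDl scalerA.
- exact: fsubset_trans (fsubsetUr _ _) (fsubsetUr _ _).
exact: fsubset_trans (fsubsetUl _ _) (fsubsetUr _ _).
Qed.

HB.instance Definition _ (S : choiceType) (V : lmodType K) (f : S -> V) :=
  GRing.isLinear.Build K {malg K[S]} V _ (mlin f) (mlin_linear f).

Lemma mlinU (S : choiceType) (V : lmodType K) (f : S -> V) x : mlin f << x >> = f x.
Proof. by rewrite /mlin msuppU oner_eq0 big_seq_fset1 mcoeffUU scale1r. Qed.

Lemma lin_mlin (S : choiceType) (V W : lmodType K) (h : V -> W) (f : S -> V) p : linear h ->
  h (mlin f p) = mlin (fun x => h (f x)) p.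
Proof.
move=> lh; have h0 : h 0 = 0 by have := lh (-1) 0 0; rewrite scaler0 addr0 scaleN1r addNr.
by rewrite /mlin; elim/big_rec2: _ => // x _ u _ <-; rewrite lh.
Qed.

Lemma mlin_mmap (S T : choiceType) (V : lmodType K) (g : T -> V) (f : S -> T) p :
  mlin g (Defs.mmap f p) = mlin (fun x => g (f x)) p.
Proof.
rewrite /Defs.mmap (lin_mlin _ _ (mlin_linear g)); congr (mlin _ p).
by apply: funext => x; rewrite mlinU.
Qed.

Lemma eq_mlin (S : choiceType) (V : lmodType K) (f g : S -> V) p : f =1 g -> mlin f p = mlin g p.
Proof. by move=> e; rewrite /mlin; apply: eq_bigr => x _; rewrite e. Qed.

End Malg.

Section GroupImage.
Variable K : fieldType.
Hypothesis charK0 : [pchar K] =i pred0.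
Notation A := 'A[K].
Notation A2 := 'A2[K].
Implicit Types (a b c : A).

Lemma expo0 (b : A) : expo (fun=> 0) b = b.
Proof.
apply: (is_sum_uniq (@A_sep K) (expo_sum (@raising0 K) b)) => N.
case: N => [|N]; first exact: filA_0.
rewrite big_ord_recl dpow0 big1 ?addr0 ?subrr => [|k _]; first exact: fil0.
by rewrite /dpow iterS scaler0.
Qed.

Lemma sexpN a : fil 1 a -> sexp a * sexp (- a) = 1.
Proof.
move=> fa; pose L (b : A) := a * b.
have fL : flin L by rewrite /L; flin.
have rL : raising L by move=> N b h; rewrite -add1n; apply: filAM.
have L1 : sexp a = expo L 1.
  by rewrite sexpE; congr (expo _ 1); apply: funext => b; rewrite /twist addr0.
have L2 : sexp (- a) = expo (fun b => (-1) *: L b) 1.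
  by rewrite sexpE; congr (expo _ 1); apply: funext => b; rewrite /twist addr0 scaleN1r mulNr.
have e := expo_add charK0 1 (-1) (1 : A) fL rL; rewrite -L2 in e.
have m : expo L (1 * sexp (- a)) = expo L 1 * expo (fun=> 0) (sexp (- a)).
  apply: (expo_mul charK0 1 (sexp (- a)) fL rL (flin0 _ _) (@raising0 K)) => b c.
  by rewrite mulr0 addr0 /L mulrA.
rewrite expo0 mul1r in m; rewrite L1 -m.
have -> : expo L (sexp (- a)) = expo (fun v => 1 *: L v) (sexp (- a)).
  by congr (expo _ _); apply: funext => b; rewrite scale1r.
rewrite e -[RHS]expo0; congr (expo _ 1); apply: funext => b.
by rewrite subrr scale0r.
Qed.

Definition lexp (l : letter) : A := sexp (if l.1 then - gen K l.2 else gen K l.2).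

Lemma lexpV l : lexp l * lexp (linv l) = 1.
Proof.
case: l => [[] i]; rewrite /lexp /=; last exact/sexpN/fil_gen.
rewrite -{2}[gen K i]opprK; apply: sexpN; rewrite -scaleN1r; exact/filZ/fil_gen.
Qed.

Lemma lexp_push l w : \prod_(m <- push l w) lexp m = lexp l * \prod_(m <- w) lexp m.
Proof.
case: w => [|m w]; first by rewrite big_seq1 big_nil mulr1.
rewrite /=; case: eqP => [->|_]; last by rewrite big_cons.
by rewrite big_cons mulrA lexpV mul1r.
Qed.

Lemma theta_expM (g h : free2) : theta_exp << (g * h)%g >> = theta_exp << g >> * theta_exp << h >> :> A.
Proof.
rewrite /theta_exp !mlinU /= -[RHS]/(\prod_(m <- val g) lexp m * \prod_(m <- val h) lexp m).
rewrite -[LHS]/(\prod_(m <- foldr push (val h) (val g)) lexp m).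
elim: (val g) => [|l w IH] /=; first by rewrite big_nil mul1r.
by rewrite lexp_push IH big_cons mulrA.
Qed.

Lemma theta_exp1 : theta_exp << 1%g >> = 1 :> A.
Proof. by rewrite /theta_exp mlinU big_nil. Qed.

Lemma theta_exp_gamma i : theta_exp << gamma i >> = sexp (gen K i).
Proof. by rewrite /theta_exp mlinU big_seq1. Qed.

End GroupImage.

Section Transfer.
Local Open Scope quotient_scope.
Variable K : fieldType.
Hypothesis charK0 : [pchar K] =i pred0.
Notation A := 'A[K].
Notation A2 := 'A2[K].
Implicit Types (a b c : A) (g h : free2).
Variable G : 'I_2 -> A.
Hypothesis gG : forall i, grouplike (G i).

Let theta : {malg K[free2]} -> A := fun p => tact G (theta_exp p).
Definition image : free2 -> A := locked (fun g => theta << g >>).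
Lemma imageE g : image g = theta << g >>. Proof. by rewrite /image -lock. Qed.

Lemma imageM g h : image (g * h)%g = image g * image h.
Proof.
have [_ _ pM] := ahom_phi gG; rewrite !imageE /theta (theta_expM charK0); exact: pM.
Qed.
Lemma image1 : image 1%g = 1.
Proof. by have [_ p1 _] := ahom_phi gG; rewrite !imageE /theta theta_exp1; exact: p1. Qed.
Lemma image_gamma i : image (gamma i) = Gam G i.
Proof. by rewrite !imageE /theta theta_exp_gamma GamE. Qed.

Definition gword (w : seq 'I_2) : free2 := foldr (fun i g => (gamma i * g)%g) 1%g w.

Lemma image_gword w : image (gword w) = Gword G w.
Proof.
elim: w => [|i w IH] /=; first by rewrite image1 Gword_nil.
by rewrite imageM image_gamma IH Gword_cons.
Qed.

Lemma theta2E p : theta2 theta p = mlin (fun p => tens (image p.1) (image p.2)) p.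
Proof. by apply: eq_mlin => -[u v]; rewrite !imageE. Qed.

Lemma theta2_ract2 p g h : theta2 theta (ract2 p g h) = theta2 theta p * tens (image g) (image h).
Proof.
rewrite !theta2E /ract2 mlin_mmap (lin_mlin _ _ (flin_mulr2 (tens (image g) (image h))).1).
by apply: eq_mlin => -[u v] /=; rewrite !imageM tens_mul.
Qed.

Lemma theta2_lact2 p g h : theta2 theta (lact2 g h p) = tens (image g) (image h) * theta2 theta p.
Proof.
rewrite !theta2E /lact2 mlin_mmap (lin_mlin _ _ (flin_mull2 (tens (image g) (image h))).1).
by apply: eq_mlin => -[u v] /=; rewrite !imageM tens_mul.
Qed.

Lemma theta2U g h : theta2 theta << (g, h) >> = tens (image g) (image h).
Proof. by rewrite theta2E mlinU. Qed.
Lemma theta2D p q : theta2 theta (p + q) = theta2 theta p + theta2 theta q.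
Proof. by rewrite !theta2E linearD. Qed.
Lemma theta2B p q : theta2 theta (p - q) = theta2 theta p - theta2 theta q.
Proof. by rewrite !theta2E linearB. Qed.

Variable kappa : {malg K[(free2 * free2)%type]} -> {malg K[(free2 * free2)%type]}.
Hypothesis kappaP : is_kappa kappa.
Variable kap : A2 -> A2.
Hypothesis ckap : clin kap.
Hypothesis kap_theta : forall p, kap (theta2 theta p) = theta2 theta (kappa p).

Lemma kap_image g h : kap (tens (image g) (image h)) = theta2 theta (kappa << (g, h) >>).
Proof. by rewrite -theta2U kap_theta. Qed.

Lemma kap_imageMr g h k : kap (tens (image g) (image (h * k)%g)) =
  kap (tens (image g) (image h)) * tens 1 (image k) + tens (image h) 1 * kap (tens (image g) (image k)).
Proof.
have [kr _ _ _ _] := kappaP.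
have e1 := theta2_ract2 (kappa << (g, h) >>) 1%g k; rewrite image1 -kap_image in e1.
have e2 := theta2_lact2 (kappa << (g, k) >>) h 1%g; rewrite image1 -kap_image in e2.
apply: etrans (kap_image _ _) _; apply: etrans (congr1 (theta2 theta) (kr _ _ _)) _.
exact: (etrans (theta2D _ _) (congr2 +%R e1 e2)).
Qed.

Lemma kap_imageMl g h k : kap (tens (image (g * h)%g) (image k)) =
  kap (tens (image g) (image k)) * tens (image h) 1 + tens 1 (image g) * kap (tens (image h) (image k)).
Proof.
have [_ kl _ _ _] := kappaP.
have e1 := theta2_ract2 (kappa << (g, k) >>) h 1%g; rewrite image1 -kap_image in e1.
have e2 := theta2_lact2 (kappa << (h, k) >>) 1%g g; rewrite image1 -kap_image in e2.
apply: etrans (kap_image _ _) _; apply: etrans (congr1 (theta2 theta) (kl _ _ _)) _.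
exact: (etrans (theta2D _ _) (congr2 +%R e1 e2)).
Qed.

Lemma intersection_op_transfer : intersection_op G kap.
Proof.
have [_ _ kd klt kgt] := kappaP.
split; first exact: ckap.
- by move=> u v w; rewrite -!image_gword -imageM kap_imageMr.
- by move=> u v w; rewrite -!image_gword -imageM kap_imageMl.
- move=> i; have e := kap_image (gamma i) (gamma i); rewrite !image_gamma in e.
  have e1 := theta2U 1%g (gamma i * gamma i)%g; rewrite imageM image1 !image_gamma in e1.
  have e2 := theta2U (gamma i) (gamma i); rewrite !image_gamma in e2.
  apply: etrans e (etrans (congr1 (theta2 theta) (kd i)) (etrans (theta2B _ _) _)).
  exact: (congr2 (fun x y => x - y) e1 e2).
- have e := kap_image (gamma ord0) (gamma ord_max); rewrite !image_gamma in e.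
  apply: etrans e (etrans (congr1 (theta2 theta) (klt ord0 ord_max isT)) _).
  by rewrite theta2E linear0.
have e := kap_image (gamma ord_max) (gamma ord0); rewrite !image_gamma in e.
have e1 := theta2U 1%g (gamma ord_max * gamma ord0)%g; rewrite imageM image1 !image_gamma in e1.
have e2 := theta2U (gamma ord0 * gamma ord_max)%g 1%g; rewrite imageM image1 !image_gamma in e2.
have e3 := theta2U (gamma ord_max) (gamma ord0); rewrite !image_gamma in e3.
have e4 := theta2U (gamma ord0) (gamma ord_max); rewrite !image_gamma in e4.
apply: etrans e (etrans (congr1 (theta2 theta) (kgt ord_max ord0 isT)) (etrans (theta2B _ _) _)).
apply: (congr2 (fun x y => x - y)) e4; apply: etrans (theta2B _ _) _.
apply: (congr2 (fun x y => x - y)) e3; apply: etrans (theta2D _ _) _.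
exact: (congr2 +%R e1 e2).
Qed.

Variable mu : {malg K[free2]} -> {malg K[(loops * free2)%type]}.
Hypothesis muP : is_mu kappa mu.

Lemma cp_image_conj g k : cp (image (g ^ k)%g) = cp (image g).
Proof. by rewrite conjgE !imageM cpC -mulrA -imageM mulgV image1 mulr1. Qed.

Lemma cp_image_repr g : cp (image (repr (loop_class g))) = cp (image g).
Proof.
have /eqmodP/asboolP[k e] : \pi_loops (repr (loop_class g)) = \pi_loops g by exact: reprK.
by rewrite {2}e cp_image_conj.
Qed.

Definition wedge a b : cyc2 K := cp2 (tens a b) - cp2 (tens b a).

Lemma cp2_tens_eq a a' b b' : cp a = cp a' -> cp b = cp b' -> cp2 (tens a b) = cp2 (tens a' b').
Proof.
have hc := flin_cp2 K; move=> ea eb; transitivity (cp2 (tens a' b)).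
  apply: (cp_factor (f := fun x => cp2 (tens x b))) ea => [||x y]; first exact: cyc2_sep.
    by clin.
  exact: cp2_comml.
apply: (cp_factor (f := fun x => cp2 (tens a' x))) eb => [||x y]; first exact: cyc2_sep.
  by clin.
exact: cp2_commr.
Qed.

Lemma wedge_eq a a' b b' : cp a = cp a' -> cp b = cp b' -> wedge a b = wedge a' b'.
Proof. by move=> ea eb; rewrite /wedge (cp2_tens_eq ea eb) (cp2_tens_eq eb ea). Qed.

(** On mu(w) this is the quantity N w c of [delta_defect_word]. *)
Definition mu_wedge (c : A) : {malg K[(loops * free2)%type]} -> cyc2 K :=
  mlin (fun p : (loops * free2)%type => wedge (image (repr p.1)) (image p.2 * c)).

Lemma mu_wedgeD c p q : mu_wedge c (p + q) = mu_wedge c p + mu_wedge c q.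
Proof. exact: linearD. Qed.

Lemma mu_wedge_kappa c g h :
  mu_wedge c (Defs.mmap (fun p : (free2 * free2)%type => (loop_class p.1, p.2)) (kappa << (g, h) >>)) =
  alt_act c (kap (tens (image g) (image h))).
Proof.
rewrite /mu_wedge mlin_mmap kap_image theta2E (lin_mlin _ _ (clin_alt_act c).1).
apply: eq_mlin => -[u v]; rewrite /= /alt_act tens_mul mulr1 tswap_tens.
by apply: wedge_eq; rewrite ?cp_image_repr.
Qed.

Lemma mu_wedgeM c g h : mu_wedge c (mu << (g * h)%g >>) =
  mu_wedge (image h * c) (mu << g >>) + mu_wedge (c * image g) (mu << h >>)
  + alt_act c (kap (tens (image g) (image h))).
Proof.
have [muM _] := muP.
apply: etrans (congr1 (mu_wedge c) (muM g h)) _.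
apply: etrans (mu_wedgeD _ _ _) _; rewrite mu_wedge_kappa; congr (_ + _).
apply: etrans (mu_wedgeD _ _ _) _; congr (_ + _); rewrite /mu_wedge mlin_mmap.
  by apply: eq_mlin => -[u v]; rewrite /= imageM mulrA.
apply: eq_mlin => -[u v]; rewrite /= imageM; apply: wedge_eq => //.
by rewrite -mulrA cpC mulrA.
Qed.

Lemma mu_wedge_gword w c : mu_wedge c (mu << gword w >>) = delta_defect G (Gword G w) c.
Proof.
have ik := intersection_op_transfer; have [_ mug] := muP.
apply: (delta_defect_word charK0 gG ik (N := fun w c => mu_wedge c (mu << gword w >>))) => {w c}.
  (* The product rule at 1 = 1 * 1, where kap vanishes, gives N = N + N. *)
  move=> c; have := mu_wedgeM c 1%g 1%g; rewrite mulg1 image1 mul1r mulr1.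
  rewrite (dder1 (dder_kap charK0 gG ik 1)) (lin0 (clin_alt_act c).1) addr0.
  by move/eqP; rewrite -subr_eq0 opprD addNKr oppr_eq0 => /eqP.
move=> i w c; rewrite /= mu_wedgeM mug image_gamma image_gword /mu_wedge linear0 add0r.
by [].
Qed.

Variable delta : {malg K[loops]} -> {malg K[(loops * loops)%type]}.
Hypothesis deltaP : is_delta_plus mu delta.
Variable delta_t : cyc K -> cyc2 K.
Hypothesis cdelta : clin delta_t.
Hypothesis delta_theta : forall p, delta_t (theta_cyc theta p) = theta_cyc2 theta (delta p).

Lemma theta_cyc2E p :
  theta_cyc2 theta p = mlin (fun p : (loops * loops)%type => cp2 (tens (image (repr p.1)) (image (repr p.2)))) p.
Proof. by apply: eq_mlin => -[u v]; rewrite !imageE. Qed.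

Lemma mlinB (S : choiceType) (V : lmodType K) (f g : S -> V) p :
  mlin f p - mlin g p = mlin (fun x => f x - g x) p.
Proof. by rewrite /mlin -sumrB; apply: eq_bigr => x _; rewrite scalerBr. Qed.

Lemma mlin_delta (S : choiceType) (V : lmodType K) (f : S -> V) p q x y :
  mlin f (- (p - q) + (<< x >> - << y >>)) = f x - f y - (mlin f p - mlin f q).
Proof. by rewrite linearD linearN !linearB /= !mlinU addrC. Qed.

Lemma theta_cyc2_delta g : theta_cyc2 theta (delta << loop_class g >>) =
  wedge (image g) 1 - mu_wedge 1 (mu << g >>).
Proof.
rewrite (deltaP g) theta_cyc2E /Alt mlin_delta; congr (_ - _).
  by rewrite /wedge -image1; congr (_ - _); apply: cp2_tens_eq; apply: cp_image_repr.
rewrite !mlin_mmap mlinB; apply: eq_mlin => -[u v]; rewrite /= mulr1 /wedge.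
by congr (_ - _); apply: cp2_tens_eq; rewrite ?cp_image_repr.
Qed.

(** Checked on positive words by continuity: the term |w| ^ 1 of delta^+ cancels the one in
    [delta_defect_at1]. *)
Lemma delta_ham b : delta_t (cp b) = - \sum_i cp2 (dG G i (ham_u G i b) ** tdif (Gam G i)).
Proof.
have hc := flin_cp K; have hc2 := flin_cp2 K.
have c1 : clin (fun b => delta_t (cp b)) by clin.
have c2 : clin (fun b => - \sum_i cp2 (dG G i (ham_u G i b) ** tdif (Gam G i))).
  have hu i := clin_ham_u charK0 gG i; have hd i := clin_dG charK0 gG i.
  apply: clin_opp; apply: clin_sum => i; apply: (clin_comp (flin_clin hc2)).
  apply: (clin_comp (flin_clin (flin_omulr _))); exact: (clin_comp (hd i) (hu i)).
apply: (Gword_dense charK0 gG (closed_sub_eq (@cyc2_sep K) c1 c2)) => w.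
have e : theta_cyc theta << loop_class (gword w) >> = cp (Gword G w).
  by rewrite /theta_cyc mlinU -imageE cp_image_repr image_gword.
rewrite -e delta_theta theta_cyc2_delta mu_wedge_gword (delta_defect_at1 charK0 gG).
by rewrite image_gword /wedge opprD addrA subrr add0r.
Qed.

End Transfer.

Theorem theorem1p3 (K : fieldType) (charK0 : [pchar K] =i pred0)
  (kappa : {linear {malg K[(free2 * free2)%type]} -> {malg K[(free2 * free2)%type]}})
  (mu : {linear {malg K[free2]} -> {malg K[(loops * free2)%type]}})
  (delta : {linear {malg K[loops]} -> {malg K[(loops * loops)%type]}})
  (kappaP : is_kappa kappa) (muP : is_mu kappa mu) (deltaP : is_delta_plus mu delta)
  (j : ('I_2 -> 'A[K]) -> cyc K) (jP : is_div_cocycle j)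
  (a : 'I_2 -> 'A[K]) (aL : forall i, primitive (a i)) :
  let F : 'I_2 -> 'A[K] := fun i => sexp (a i) in
  let theta : {malg K[free2]} -> 'A[K] := fun p => tact (tinv F) (theta_exp p) in
  forall (kappa_t : {linear 'A2[K] -> 'A2[K]}) (delta_t : {linear cyc K -> cyc2 K}),
  filt_continuous kappa_t ->
  (forall p, kappa_t (theta2 theta p) = theta2 theta (kappa p)) ->
  filt_continuous delta_t ->
  (forall p, delta_t (theta_cyc theta p) = theta_cyc2 theta (delta p)) ->
  central kappa_t (j (tinv F)) ->
  forall b : 'A[K], delta_t (cp b) = - tDiv (ham kappa_t b).
Proof.
move=> F theta kappa_t delta_t ckappa kappa_theta cdelta delta_theta cen b.
have gG i : grouplike (tinv F i) by apply: grouplike_tinv => k; apply: grouplike_sexp.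
(* F^-1 is group-like, hence exp(w) with w primitive; tDiv and j are integrated along exp(sw). *)
have [w pw ew] := grouplike_texp_ex charK0 gG.
have ck : clin kappa_t by split=> //; apply: linearP.
have cd : clin delta_t by split=> //; apply: linearP.
have ik := intersection_op_transfer charK0 gG kappaP ck kappa_theta.
rewrite (delta_ham charK0 gG kappaP ck kappa_theta muP deltaP cd delta_theta).
rewrite (tDiv_ham charK0 gG ik pw (fun i => esym (ew i))).
(* The integral occurring in [tDiv_ham] represents j(F^-1), so centrality kills the extra term. *)
have jE : j (tinv F) = cp (exp_int w (div_lift w) 1).
  rewrite (_ : tinv F = texp w); last by apply: funext => i; rewrite ew.
  exact: div_cocycle_texp (cp_div_lift w).
rewrite jE in cen; congr (- _).
exact: (etrans (congr2 +%R erefl (tcop_central charK0 gG ik b cen)) (addr0 _)).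
Qed.
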